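(* Let $n\ge 1$, $\lambda>0$, and let $\boldsymbol p$ be a partition of $n$. Then the Hilbert module $\mathbb P_{\boldsymbol p}\big(\mathbb A^{(\lambda)}(\mathbb D^n)\big)$ over $\mathbb C[\boldsymbol z]^{\mathfrak S_n}$ is locally free of rank $\chi_{\boldsymbol p}(1)^2$ on $\mathbb G_n\setminus \boldsymbol s(\mathcal Z)$.
   Context: $\mathbb D^n$ is the open unit polydisc in $\mathbb C^n$. For $\lambda>0$, $\mathbb A^{(\lambda)}(\mathbb D^n)$ is the Hilbert space of holomorphic functions on $\mathbb D^n$ with reproducing kernel $K^{(\lambda)}(\boldsymbol z,\boldsymbol w)=\prod_{j=1}^n(1-z_j\bar w_j)^{-\lambda}$. The symmetric group $\mathfrak S_n$ acts on $\mathbb C^n$ by $\sigma\cdot\boldsymbol z=(z_{\sigma^{-1}(1)},\dots,z_{\sigma^{-1}(n)})$, and $(f\circ\sigma^{-1})(\boldsymbol z)=f(\sigma^{-1}\cdot\boldsymbol z)$. $\mathbb C[\boldsymbol z]^{\mathfrak S_n}$ is the ring of symmetric polynomials in $z_1,\dots,z_n$; it acts on $\mathbb A^{(\lambda)}(\mathbb D^n)$ by pointwise multiplication. $\boldsymbol s=(s_1,\dots,s_n):\mathbb C^n\to\mathbb C^n$, where $s_k$ is the $k$-th elementary symmetric polynomial; $\mathbb G_n=\boldsymbol s(\mathbb D^n)$ is the symmetrized polydisc; $\mathcal Z=\{\boldsymbol z\in\mathbb D^n: z_i=z_j\text{ for some } i\ne j\}$. Irreducible representations of $\mathfrak S_n$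 are indexed up to equivalence by partitions $\boldsymbol p$ of $n$; $\chi_{\boldsymbol p}$ is the character of the irreducible representation corresponding to $\boldsymbol p$, so $\chi_{\boldsymbol p}(1)$ is its dimension. The orthogonal projection $\mathbb P_{\boldsymbol p}$ on $\mathbb A^{(\lambda)}(\mathbb D^n)$ is $\mathbb P_{\boldsymbol p}f=\frac{\chi_{\boldsymbol p}(1)}{n!}\sum_{\sigma\in\mathfrak S_n}\overline{\chi_{\boldsymbol p}(\sigma)}\,(f\circ\sigma^{-1})$; its range is a reducing submodule over $\mathbb C[\boldsymbol z]^{\mathfrak S_n}$. Local freeness: Since $\mathbb C[\boldsymbol z]^{\mathfrak S_n}=\mathbb C[s_1,\dots,s_n]$ is a polynomial ring in $n$ variables, a Hilbert module $\mathcal H$ over it (here a closed submodule of $\mathbb A^{(\lambda)}(\mathbb D^n)$) is a Hilbert module over $\mathbb C[u_1,\dots,u_n]$, with $q$ acting by $f\mapsto (q\circ\boldsymbol s)f$. For $\boldsymbol u\in\mathbb C^n$, $\mathbb C_{\boldsymbol u}$ is the one-dimensional module $\mathbb C$ with $q\cdot c=q(\boldsymbol u)c$, and the module tensor product $\mathcal H\otimes\mathbb C_{\boldsymbol u}$ is the quotient of $\mathcal H$ by the closed subspace generated by $\{(q\circ\boldsymbol s-q(\boldsymbol u))f: q\in\mathbb C[u_1,\dots,u_n], f\in\mathcal H\}$, identified with the orthogonal complement of that subspace in $\mathcal H$. For a bounded open connected $\Omega\subseteq\mathbb C^n$ put $\Omega^*=\{\boldsymbol v:\bar{\boldsymbol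 v}\in\Omega\}$. $\mathcal H$ is locally free of rank $k$ on $\Omega$ if for every $\boldsymbol w\in\Omega^*$ there are a neighbourhood $\Omega_0^*\subseteq\Omega^*$ of $\boldsymbol w$ and holomorphic functions $\gamma_1,\dots,\gamma_k:\Omega_0^*\to\mathcal H$ such that for every $\boldsymbol v\in\Omega_0^*$ the vectors $\gamma_1(\boldsymbol v),\dots,\gamma_k(\boldsymbol v)$ are linearly independent and their linear span is $\mathcal H\otimes\mathbb C_{\bar{\boldsymbol v}}$ (as a subspace of $\mathcal H$). *)

(* Defs.v *)
From HB Require Import structures.
From mathcomp Require Import all_boot all_order all_algebra all_fingroup.
From mathcomp Require Import mxrepresentation complex.
From mathcomp Require mpoly.
From mathcomp Require Import all_classical all_reals all_analysis.

Set Implicit Arguments.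
Unset Strict Implicit.
Unset Printing Implicit Defensive.

Import Order.TTheory GRing.Theory Num.Theory.
Import numFieldNormedType.Exports.

Local Open Scope ring_scope.

(* The library equips an abstract numFieldType, but not the concrete type R[i],
   with the topology and norm of the regular module. *)
HB.instance Definition _ (R : rcfType) := PseudoPointedMetric.copy R[i] R[i]^o.
HB.instance Definition _ (R : rcfType) := NormedModule.copy R[i] R[i]^o.

Definition is_intpart (n : nat) (p : seq nat) : bool :=
  [&& sorted geq p, 0%N \notin p & sumn p == n].

(* Irreducible characters of the symmetric group.  The cells of the Young
   diagram of p are numbered 0, ..., n-1 row by row, so that cell k lies in row
   [reshape_index p k] and column [reshape_offset p k]. *)
Section Specht.
Variables (F : fieldType) (n : nat) (p : seq nat).

Definition row_stab : {set 'S_n} :=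
  [set s : 'S_n | [forall k, reshape_index p (s k) == reshape_index p k]].

Definition col_stab : {set 'S_n} :=
  [set s : 'S_n | [forall k, reshape_offset p (s k) == reshape_offset p k]].

(* The Young symmetrizer, as a row vector of the regular representation. *)
Definition young_symmetrizer : 'rV[F]_#|[set: 'S_n]| :=
  gring_row (\sum_(s in row_stab) \sum_(t in col_stab)
    (-1) ^+ odd_perm t *: regular_repr F [set: 'S_n] (s * t)%g).

(* The Specht module of p: the ideal of the group algebra generated by the
   Young symmetrizer.  MathComp representations act on row vectors from the
   right and (s * t)%g is "s, then t"; with composition of functions as the
   product this is the usual left ideal generated by (column antisymmetrizer)
   (row symmetrizer), so that p = [:: n] gives the trivial representation. *)
Definition specht_mx : 'M[F]_#|[set: 'S_n]| :=
  cyclic_mx (regular_repr F [set: 'S_n]) young_symmetrizer.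

Definition specht_dim : nat := \rank specht_mx.

Definition specht_repr : mx_representation F [set: 'S_n] specht_dim :=
  submod_repr (cyclic_mx_module (regular_repr F [set: 'S_n]) young_symmetrizer).

Definition specht_char (s : 'S_n) : F := \tr (specht_repr s).

Lemma specht_char1 : specht_char 1%g = specht_dim%:R.
Proof. by rewrite /specht_char repr_mx1 mxtrace1. Qed.

End Specht.
Arguments specht_char F n p s : clear implicits.

Local Open Scope classical_set_scope.

Section WeightedBergman.
Variables (R : realType) (n : nat).
Local Notation C := R[i].

Definition polydisc : set 'rV[C]_n := [set z | forall j, `|z ord0 j| < 1].

(* z ^ a for real a, principal branch; only meant for 0 < Re z, where the
   argument of z is atan (Im z / Re z). *)
Definition rpow (z : C) (a : R) : C :=
  let rho := complex.Re `|z| `^ a in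
  let theta := a * atan (complex.Im z / complex.Re z) in
  Complex (rho * cos theta) (rho * sin theta).

Definition bergman_kernel (lambda : R) (z w : 'rV[C]_n) : C :=
  \prod_(j < n) rpow (1 - z ord0 j * (w ord0 j)^*) (- lambda).

(* (H, ip, ev) is the Hilbert space of holomorphic functions on the polydisc
   with reproducing kernel [bergman_kernel lambda]; the function represented by
   the vector f : H is the restriction of [ev f] to the polydisc.  By the
   Moore-Aronszajn theorem such a space exists, and it is unique up to a unique
   unitary compatible with [ev] on the polydisc.  Holomorphy is complex Frechet
   differentiability. *)
Record is_bergman (lambda : R) (H : completeNormedModType C)
    (ip : {dot H for (@Num.conj C)}) (ev : H -> 'rV[C]_n -> C) : Prop := {
  bergman_norm : forall f, `|f| ^+ 2 = ip f f;
  bergman_linear : forall a f g z, polydisc z ->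
    ev (a *: f + g) z = a * ev f z + ev g z;
  bergman_inj : forall f, (forall z, polydisc z -> ev f z = 0) -> f = 0;
  bergman_holomorphic : forall f z, polydisc z -> differentiable (ev f) z;
  bergman_reproducing : forall w, polydisc w ->
    exists2 k : H, (forall z, polydisc z -> ev k z = bergman_kernel lambda z w)
                 & forall f, ev f w = ip f k }.

Definition perm_act (s : 'S_n) (z : 'rV[C]_n) : 'rV[C]_n :=
  \row_j z ord0 ((s^-1)%g j).

Definition elem_sym (z : 'rV[C]_n) : 'rV[C]_n :=
  \row_(k < n) mpoly.meval (z ord0) (mpoly.mesym n C k.+1).

Definition symmetrized_polydisc : set 'rV[C]_n := elem_sym @` polydisc.

Definition diagonal_locus : set 'rV[C]_n :=
  [set z | polydisc z /\ exists i j : 'I_n, i != j /\ z ord0 i = z ord0 j].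

Definition conj_set (Omega : set 'rV[C]_n) : set 'rV[C]_n :=
  [set v | Omega (map_mx Num.conj v)].

Section Module.
Variables (H : completeNormedModType C) (ip : {dot H for (@Num.conj C)}).
Variable ev : H -> 'rV[C]_n -> C.

(* The range of the projection P_p: the g in H representing
   chi(1)/n! sum_s conj(chi s) (f o s^-1) for some f in H.  The kernel is
   invariant under permutations, hence so is H. *)
Definition isotypic (p : seq nat) : set H :=
  [set g | exists f : H, forall z, polydisc z ->
     ev g z = specht_char C n p 1%g / n`!%:R *
       \sum_(s : 'S_n) (specht_char C n p s)^* * ev f (perm_act (s^-1)%g z)].

Definition lin_span (A : set H) : set H :=
  [set h | exists (m : nat) (a : 'I_m -> C) (x : 'I_m -> H),
     (forall i, A (x i)) /\ h = \sum_i a i *: x i].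

(* The vectors (q o s - q(u)) f of the module over C[u_1, ..., u_n]; H is stable
   under multiplication by polynomials, and [ev] is injective, so g exists and
   is determined by q and f. *)
Definition fibre_relations (M : set H) (u : 'rV[C]_n) : set H :=
  [set g | exists (q : mpoly.mpoly n C) (f : H), M f /\
     forall z, polydisc z ->
       ev g z = (mpoly.meval (elem_sym z ord0) q - mpoly.meval (u ord0) q)
                * ev f z].

(* M (x) C_u, as the orthogonal complement in M. *)
Definition fibre (M : set H) (u : 'rV[C]_n) : set H :=
  [set h | M h /\
     forall g, closure (lin_span (fibre_relations M u)) g -> ip h g = 0].

Definition locally_free (M : set H) (k : nat) (Omega : set 'rV[C]_n) : Prop :=
  forall w, conj_set Omega w ->
  exists (U : set 'rV[C]_n) (gamma : 'I_k -> 'rV[C]_n -> H),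
    [/\ open U, U w, U `<=` conj_set Omega,
        forall i v, U v -> differentiable (gamma i) v
      & forall v, U v ->
          (forall a : 'I_k -> C,
             \sum_i a i *: gamma i v = 0 -> forall i, a i = 0) /\
          [set h | exists a : 'I_k -> C, h = \sum_i a i *: gamma i v]
            = fibre M (map_mx Num.conj v)].

End Module.
End WeightedBergman.

Arguments polydisc R n : clear implicits.
Arguments symmetrized_polydisc R n : clear implicits.
Arguments diagonal_locus R n : clear implicits.

(* Main.v *)
(* Over a point u of the symmetrized polydisc off the discriminant, the fibre of
   s is a free orbit of n! points.  The kernel functions at these points span
   the joint eigenspace of the adjoints over u: a vector h of that space gives
   the functional q |-> <q, h>, which kills the ideal of the polynomials s_k -
   u_k, hence by interpolation on the free orbit is a combination of point
   evaluations, and polynomials are dense.  On the span of these n! independent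
   kernel functions the symmetric group acts by its regular representation, in
   which P_p is an idempotent of trace, hence of rank, chi_p(1)^2; this trace is
   computed from the quasi-idempotence of Young symmetrizers.  A holomorphic
   frame is obtained by choosing locally the coordinates of the points of the
   orbit, which are simple roots and so depend holomorphically on u. *)
From HB Require Import structures.
Require Import Defs.
From mathcomp Require Import all_boot all_order all_algebra all_fingroup.
From mathcomp Require Import mxrepresentation complex.
Set Implicit Arguments.
Unset Strict Implicit.
Unset Printing Implicit Defensive.
Import Order.TTheory GRing.Theory Num.Theory.
Local Open Scope ring_scope.

(** * Young symmetrizers and the Specht character *)

(** The hypotheses on [H] supply point evaluations and the kernel, but neither polynomials nor a
    permutation action on [H]. Polynomials are therefore built as limits, for [r -> 0], of
    combinations of kernel functions at points of size [r], with the weights of polynomial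
    interpolation. The Gram matrices involved consist of values of products of (1 - x)^(-lambda).
    Convergence, orthogonality and density of the monomials, and differentiability of the kernel
    functions, thus all reduce to the binomial series for a power defined by modulus and arctangent,
    which is summed by means of its differential equation. A second obstacle: the relations that
    define a fibre multiply only vectors of the isotypic submodule, whereas interpolation needs a
    functional that vanishes on a whole polynomial ideal. The gap closes because P_p is self-adjoint
    and commutes with multiplication by symmetric polynomials. *)

Section RowTransversal.
Variables (T : finType) (ro co : T -> nat) (g : {perm T}).
Hypothesis co_initial :
  forall k j, (j < co k)%N -> exists2 l, ro l = ro k & co l = j.
Hypothesis row_transversal :
  forall k l, ro k = ro l -> co (g k) = co (g l) -> k = l.

(* In each row the cells whose g-image lies in the first j columns are at most
   as many as the cells of the row in those columns; the totals over the rows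
   agree, so equality holds in every row. *)
Let cnt (f : T -> nat) r j := (\sum_(l | ro l == r) (f l < j)%N)%N.

Let cntE f r j : cnt f r j = #|[set l | (ro l == r) && (f l < j)%N]|.
Proof. by rewrite /cnt -sum1dep_card big_mkcondr. Qed.

(** A row without cells in columns [j] and beyond is counted entirely on the right. Otherwise,
    columns of a row being an initial segment, it has a cell in each of the first [j] columns and
    the right side is at least [j]; the left side is at most [j] because [g] sends the cells of a
    row to distinct columns. *)
Let cnt_le r j : (cnt (co \o g) r j <= cnt co r j)%N.
Proof.
have [/existsP[k /andP[/eqP rk jk]]|] :=
  boolP [exists k, (ro k == r) && (j <= co k)%N]; last first.
  rewrite negb_exists => /forallP h.
  apply: leq_sum => l rl; have := h l; rewrite rl /= -ltnNge => ->.
  by case: (_ < _)%N.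
apply: (@leq_trans j).
  have [->|j0] := posnP j; first by rewrite /cnt big1.
  rewrite cntE -[leqRHS]card_ord.
  pose h (l : T) := insubd (Ordinal j0) (co (g l)).
  rewrite -(@card_in_imset _ _ h) ?max_card // => a b; rewrite !inE.
  move=> /andP[/eqP ra aj] /andP[/eqP rb bj] /(congr1 val).
  by rewrite !val_insubd aj bj; apply: row_transversal; rewrite ra rb.
have hex (i : 'I_j) : exists l, (ro l == r) && (co l == i).
  have [|l lr li] := @co_initial k i; first by rewrite (leq_trans (ltn_ord i)).
  by exists l; rewrite lr rk li !eqxx.
pose h (i : 'I_j) := xchoose (hex i).
have hP i : ro (h i) = r /\ co (h i) = i.
  by have /andP[/eqP ? /eqP ?] := xchooseP (hex i).
rewrite cntE -[leqLHS]card_ord -(@card_imset _ _ h); last first.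
  by move=> a b ab; apply: val_inj; rewrite /= -(hP a).2 -(hP b).2 ab.
apply/subset_leq_card/subsetP => _ /imsetP[i _ ->].
by rewrite inE (hP i).1 (hP i).2 eqxx ltn_ord.
Qed.

Let sum_cnt (f : T -> nat) j m : (forall l, (ro l < m)%N) ->
  (\sum_(r < m) cnt f r j = \sum_l (f l < j)%N)%N.
Proof.
move=> rm; rewrite /cnt (exchange_big_dep xpredT) //=; apply: eq_bigr => l _.
by rewrite (big_pred1 (Ordinal (rm l))) // => r; rewrite eq_sym.
Qed.

Let cnt_eq r j : cnt (co \o g) r j = cnt co r j.
Proof.
pose m := (maxn r (\max_l ro l)).+1.
have rm l : (ro l < m)%N by rewrite ltnS leq_max (leq_bigmax l) ?orbT.
have rm' : (r < m)%N by rewrite ltnS leq_max leqnn.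
have le_sum : (\sum_(r < m) cnt (co \o g) r j <= \sum_(r < m) cnt co r j
    ?= iff [forall r : 'I_m, cnt (co \o g) r j == cnt co r j])%N.
  by apply: leqif_sum => i _; split.
have : (\sum_(r < m) cnt (co \o g) r j == \sum_(r < m) cnt co r j)%N.
  by rewrite !sum_cnt // [X in _ == X](reindex_perm g).
by rewrite (le_sum.2) => /forallP/(_ (Ordinal rm'))/eqP.
Qed.

(** Subtract the counts for [j] from those for [j + 1], with [j = co k]: as many cells of the row of
    [k] are sent to column [j] as lie in it, and [k] itself lies in it. *)
Lemma row_transversal_onto k : exists2 l, ro l = ro k & co (g l) = co k.
Proof.
have cntS f r j : cnt f r j.+1 =
    (cnt f r j + \sum_(l | ro l == r) (f l == j))%N.
  rewrite /cnt -big_split /=; apply: eq_bigr => l _.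
  by rewrite ltnS leq_eqVlt; case: ltngtP.
have : (\sum_(l | ro l == ro k) ((co \o g) l == co k) =
        \sum_(l | ro l == ro k) (co l == co k))%N.
  by apply: (@addnI (cnt (co \o g) (ro k) (co k)));
    rewrite -cntS !cnt_eq -cntS.
rewrite [RHS](bigD1 k) //= eqxx => e.
have /existsP[l /andP[/eqP ? /eqP ?]] :
    [exists l, (ro l == ro k) && (co (g l) == co k)]; last by exists l.
apply: contraPT e; rewrite negb_exists => /forallP h.
by rewrite big1 // => l rl; have := h l; rewrite rl /= => /negPf ->.
Qed.

End RowTransversal.

(** * The Young symmetrizer as a function on the group *)

Section YoungCoef.
Variables (F : fieldType) (n : nat) (p : seq nat).
Hypothesis sump : sumn p = n.
Local Notation Rs := (row_stab n p).
Local Notation Cs := (col_stab n p).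

Lemma row_stab_group : group_set Rs.
Proof.
apply/group_setP; split=> [|s t].
  by rewrite inE; apply/forallP => k; rewrite perm1.
rewrite !inE => /forallP hs /forallP ht; apply/forallP => k.
by rewrite permM (eqP (ht _)).
Qed.
Canonical row_stab_groupType := Group row_stab_group.

Lemma col_stab_group : group_set Cs.
Proof.
apply/group_setP; split=> [|s t].
  by rewrite inE; apply/forallP => k; rewrite perm1.
rewrite !inE => /forallP hs /forallP ht; apply/forallP => k.
by rewrite permM (eqP (ht _)).
Qed.
Canonical col_stab_groupType := Group col_stab_group.

Lemma reshape_inj (k l : 'I_n) : reshape_index p k = reshape_index p l ->
  reshape_offset p k = reshape_offset p l -> k = l.
Proof.
move=> e1 e2; apply: val_inj => /=.
by rewrite -(reshape_indexK p k) -(reshape_indexK p l) e1 e2.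
Qed.

Lemma reshape_initial (k : 'I_n) j : (j < reshape_offset p k)%N ->
  exists2 l : 'I_n, reshape_index p l = reshape_index p k
                  & reshape_offset p l = j.
Proof.
move=> jk; have kn : (k < sumn p)%N by rewrite sump.
have jr : (j < nth 0 p (reshape_index p k))%N.
  exact: ltn_trans jk (reshape_offsetP kn).
have := flatten_indexP jr; rewrite sump => ln.
by exists (Ordinal ln); rewrite /= ?flatten_indexKl ?flatten_indexKr.
Qed.

Lemma row_col_stabI s : s \in Rs -> s \in Cs -> s = 1%g.
Proof.
rewrite !inE => /forallP hr /forallP hc; apply/permP => k.
by rewrite perm1; apply: reshape_inj; apply/eqP.
Qed.

(** The coefficient of [g] in the Young symmetrizer. As the two stabilizers meet trivially, it is
    the sign of [t] if [g = s t] with [s] a row and [t] a column permutation, and 0 for all other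
    [g]. *)
Definition young_coef (g : 'S_n) : F :=
  \sum_(s in Rs) \sum_(t in Cs) ((s * t)%g == g)%:R * (-1) ^+ odd_perm t.

Lemma young_coefl s g : s \in Rs -> young_coef (s * g)%g = young_coef g.
Proof.
move=> sR; rewrite /young_coef (reindex_inj (mulgI s)) /=.
apply: eq_big => [t|t _]; first by rewrite groupMl.
by apply: eq_bigr => u _; rewrite -mulgA (inj_eq (mulgI s)).
Qed.

Lemma young_coefr t g : t \in Cs ->
  young_coef (g * t)%g = (-1) ^+ odd_perm t * young_coef g.
Proof.
move=> tC; rewrite /young_coef mulr_sumr; apply: eq_bigr => s _.
rewrite mulr_sumr (reindex_inj (mulIg t)) /=.
apply: eq_big => [u|u _]; first by rewrite groupMr.
by rewrite mulgA (inj_eq (mulIg t)) odd_permM signr_addb mulrA [RHS]mulrC.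
Qed.

Lemma young_coef1 : young_coef 1%g = 1.
Proof.
rewrite /young_coef (bigD1 1%g) ?group1 //= (bigD1 1%g) ?group1 //=.
rewrite mulg1 eqxx odd_perm1 mulr1 big1 ?addr0 => [|t /andP[_ t1]]; last first.
  by rewrite mul1g (negPf t1) mul0r.
rewrite big1 ?addr0 // => s /andP[sR s1]; rewrite big1 // => t tC.
have [st|] := eqVneq; last by rewrite mul0r.
have tR : t \in Rs.
  by rewrite -(mulKg s t) st mulg1 groupV.
by move/eqP: st; rewrite (row_col_stabI tR tC) mulg1 (negPf s1).
Qed.

(** Von Neumann's lemma. If [g] sends two cells [k], [l] of one row to one column, then swapping [k]
    and [l] before [g] amounts to swapping their images after [g]; the first leaves [f g] unchanged,
    the second negates it, so [f g = 0]. Otherwise [row_transversal_onto] writes [g] as a row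
    permutation followed by a column permutation, and the value at [g] is determined by that at
    1. *)
Lemma young_coef_unique (f : 'S_n -> F) : (2 : F) != 0 ->
  (forall s g, s \in Rs -> f (s * g)%g = f g) ->
  (forall t g, t \in Cs -> f (g * t)%g = (-1) ^+ odd_perm t * f g) ->
  forall g, f g = f 1%g * young_coef g.
Proof.
move=> two0 fl fr g.
have vanish (h : 'S_n -> F) : (forall s g, s \in Rs -> h (s * g)%g = h g) ->
    (forall t g, t \in Cs -> h (g * t)%g = (-1) ^+ odd_perm t * h g) ->
    forall k l : 'I_n, k != l -> reshape_index p k = reshape_index p l ->
      reshape_offset p (g k) = reshape_offset p (g l) -> h g = 0.
  move=> hl hr k l kl rkl ckl.
  have tR : tperm k l \in Rs.
    by rewrite inE; apply/forallP => i; case: tpermP => // ->; rewrite ?rkl.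
  have tC : tperm (g k) (g l) \in Cs.
    by rewrite inE; apply/forallP => i; case: tpermP => // ->; rewrite ?ckl.
  have : h (g * tperm (g k) (g l))%g = h g.
    by rewrite -[in RHS](hl (tperm k l)) // -tpermJ conjgE !mulgA mulgV mul1g.
  rewrite hr // odd_tperm (inj_eq perm_inj) kl expr1 mulN1r.
  move/eqP; rewrite eq_sym -addr_eq0 -mulr2n -mulr_natl mulf_eq0 (negPf two0).
  by move/eqP.
have [/existsP[k /existsP[l /and3P[kl /eqP rkl /eqP ckl]]]|] :=
  boolP [exists k : 'I_n, exists l : 'I_n, [&& k != l, reshape_index p k == reshape_index p l
    & reshape_offset p (g k) == reshape_offset p (g l)]].
  rewrite (vanish f fl fr k l) // (vanish young_coef _ _ k l) ?mulr0 //.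
    exact: young_coefl.
  exact: young_coefr.
rewrite negb_exists => /forallP hn.
have tr (k l : 'I_n) : reshape_index p k = reshape_index p l ->
    reshape_offset p (g k) = reshape_offset p (g l) -> k = l.
  move=> rkl ckl; have := hn k; rewrite negb_exists => /forallP/(_ l).
  by rewrite rkl ckl !eqxx !andbT negbK => /eqP.
have onto := row_transversal_onto reshape_initial tr.
have hex (k : 'I_n) : exists l : 'I_n, (reshape_index p l == reshape_index p k)
    && (reshape_offset p (g l) == reshape_offset p k).
  by have [l rl cl] := onto k; exists l; rewrite rl cl !eqxx.
(* [h k] is the cell in the row of [k] that [g] sends to the column of [k]: [h] permutes rows, and
   [h] followed by [g] permutes columns. *)
pose h k := xchoose (hex k).
have hP k : reshape_index p (h k) = reshape_index p k /\
    reshape_offset p (g (h k)) = reshape_offset p k.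
  by have /andP[/eqP ? /eqP ?] := xchooseP (hex k).
have h_inj : injective h.
  move=> k l e; apply: reshape_inj; first by rewrite -(hP k).1 -(hP l).1 e.
  by rewrite -(hP k).2 -(hP l).2 e.
pose s := perm h_inj.
have sR : s \in Rs.
  by rewrite inE; apply/forallP => k; rewrite permE (hP k).1.
have tC : (s * g)%g \in Cs.
  by rewrite inE; apply/forallP => k; rewrite permM permE (hP k).2.
rewrite -(fl s) // -(young_coefl _ sR) -[(s * g)%g]mul1g fr // young_coefr //.
by rewrite young_coef1 mulr1 mulrC.
Qed.

End YoungCoef.

(** For a rank factorization [A = C B] the relation forces [B C = m I] in size [\rank A], and [A]
    has the same trace as [B C]. *)
Lemma mxtrace_quasi_idem (F : fieldType) n (A : 'M[F]_n) (m : F) :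
  A *m A = m *: A -> \tr A = m * (\rank A)%:R.
Proof.
move=> AA.
have [C [B [CBA Cfull Bfree]]] : exists (C : 'M_(n, \rank A)) (B : 'M_(\rank A, n)),
    [/\ C *m B = A, row_full C & row_free B].
  by exists (col_base A), (row_base A); rewrite mulmx_base col_base_full row_base_free.
have BC : B *m C = m%:M.
  have : C *m (B *m C - m%:M) *m B = 0.
    rewrite mulmxBr mulmxBl !mulmxA CBA -[A *m _ *m _]mulmxA CBA AA.
    by rewrite scalar_mxC -mulmxA CBA mul_scalar_mx subrr.
  move/(congr1 (mulmx (pinvmx C))).
  rewrite !mulmxA mulVpmx // mul1mx mulmx0 => /eqP.
  by rewrite mulmx_free_eq0 // subr_eq0 => /eqP.
by rewrite -[in LHS]CBA mxtrace_mulC BC mxtrace_scalar mulr_natr.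
Qed.

(** The projection [e] fixes the vectors of the stable subspace [U], so cyclicity of the trace lets
    the coordinate maps of [U] cancel. *)
Lemma mxtrace_submod_repr (F : fieldType) (gT : finGroupType) (G : {group gT})
    n (rG : mx_representation F G n) (U e : 'M_n) (Umod : mxmodule rG U) x :
  x \in G -> (e :=: U)%MS -> e *m e = e ->
  \tr (submod_repr Umod x) = \tr (e *m rG x).
Proof.
move=> Gx eU ee.
have We m (W : 'M_(m, n)) : (W <= U)%MS -> W *m e = W.
  by rewrite -eU => /submxP[D ->]; rewrite -mulmxA ee.
have WXB m (W : 'M_(m, n)) : (W <= U)%MS ->
    W *m in_submod U 1%:M *m val_submod 1%:M = W.
  by move=> WU; rewrite -in_submodE -val_submodE in_submodK.
have BU : (val_submod (1%:M : 'M_(\rank U)) *m rG x <= U)%MS.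
  by apply: mxmodule_trans => //; rewrite val_submod1.
rewrite /= /submod_mx in_submodE.
move: (in_submod _ _) (val_submod _) WXB BU => X B WXB BU.
rewrite mxtrace_mulC -(We _ _ BU) mulmxA mxtrace_mulC !mulmxA WXB //.
by rewrite eU.
Qed.

(** * Convolution operators on the regular representation *)

Section GroupFunctions.
Variables (F : fieldType) (gT : finGroupType).
Local Notation G := [set: gT].

Definition fconv (a b : gT -> F) (g : gT) := \sum_h a h * b (h^-1 * g)%g.

(** Left multiplication by the group algebra element with coefficients [a], acting on row vectors;
    it commutes with the regular representation, which multiplies on the right. Composition of
    operators on row vectors reverses the factors, hence [fconv b a] in [lmul_mxM]. *)
Definition lmul_mx (a : gT -> F) : 'M[F]_#|G| :=
  \matrix_(i, j) a (enum_val j * (enum_val i)^-1)%g.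

Lemma sum_enum_val (V : nmodType) (f : gT -> V) :
  \sum_(i < #|G|) f (enum_val i) = \sum_g f g.
Proof. by rewrite -(big_enum_val f); apply: eq_bigl => g; rewrite inE. Qed.

Lemma lmul_mxM a b : lmul_mx a *m lmul_mx b = lmul_mx (fconv b a).
Proof.
apply/matrixP => i j; rewrite !mxE.
transitivity (\sum_g a (g * (enum_val i)^-1)%g * b (enum_val j * g^-1)%g).
  by rewrite -sum_enum_val; apply: eq_bigr => k _; rewrite !mxE.
rewrite /fconv.
rewrite (reindex (fun h => h^-1 * enum_val j)%g) /=; last first.
  exists (fun h => enum_val j * h^-1)%g => h _;
  by rewrite invMg ?invgK ?mulKVg ?mulgK ?mulgKV.
by apply: eq_bigr => h _; rewrite mulrC invMg invgK mulKVg mulgA.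
Qed.

Lemma mxtrace_lmul_mx a : \tr (lmul_mx a) = #|G|%:R * a 1%g.
Proof.
rewrite /mxtrace (eq_bigr (fun=> a 1%g)) => [|i _]; last by rewrite mxE mulgV.
by rewrite sumr_const card_ord mulr_natl.
Qed.

Lemma mxtrace_lmul_regular a x :
  \tr (lmul_mx a *m regular_repr F G x) = \sum_h a (h * x^-1 * h^-1)%g.
Proof.
rewrite mxtrace_mulC /mxtrace -sum_enum_val; apply: eq_bigr => i _.
rewrite mxE (bigD1 (gring_index G (enum_val i * x)%g)) //= big1 ?addr0.
  by rewrite !mxE !eqxx mul1r gring_indexK ?inE // invMg mulgA.
by move=> j ji; rewrite !mxE (negPf ji) mul0r.
Qed.

Lemma gring_row_regular_entry x j :
  (gring_row (regular_repr F G x)) 0 j = (enum_val j == x)%:R.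
Proof.
rewrite /gring_row !mxE gring_indexK ?inE // mul1g /=.
by rewrite -(inj_eq (can_inj (@gring_valK _ _))) gring_indexK ?inE.
Qed.

(** Row [i] of the matrix is [u] times the [i]-th group element, so the rows span the right ideal
    generated by [u]. *)
Lemma cyclic_regular_mx (u : 'rV[F]_#|G|) :
  (cyclic_mx (regular_repr F G) u :=:
     lmul_mx (fun g => u 0 (gring_index G g)))%MS.
Proof.
set a := fun g => _.
have rowE (i : 'I_#|G|) : row i (lmul_mx a) = u *m regular_repr F G (enum_val i).
  apply/rowP => j; rewrite !mxE.
  rewrite (bigD1 (gring_index G (enum_val j * (enum_val i)^-1)%g)) //= big1.
    by rewrite addr0 !mxE gring_indexK ?inE // mulgKV gring_valK !eqxx mulr1.
  move=> k kj; rewrite !mxE eqxx; case: eqP => [e|]; last by rewrite mulr0.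
  by case/eqP: kj; rewrite e gring_indexK ?inE // mulgK gring_valK.
apply/eqmxP/andP; split; last first.
  apply/row_subP => i; rewrite rowE.
  by rewrite mxmodule_trans ?cyclic_mx_module ?cyclic_mx_id ?inE.
apply: cyclic_mx_sub; last first.
  suff <- : row (gring_index G 1%g) (lmul_mx a) = u by exact: row_sub.
  by rewrite rowE gring_indexK ?inE // repr_mx1 mulmx1.
apply/mxmoduleP => x _; apply/row_subP => i.
rewrite row_mul rowE -mulmxA -repr_mxM ?inE //.
have -> : (enum_val i * x)%g = enum_val (gring_index G (enum_val i * x)%g).
  by rewrite gring_indexK ?inE.
by rewrite -rowE row_sub.
Qed.

End GroupFunctions.

(** * Specht characters and the isotypic idempotent *)

Section SpechtCharacter.
Variables (F : numFieldType) (n : nat) (p : seq nat).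
Hypothesis sump : sumn p = n.
Local Notation Rs := (row_stab n p).
Local Notation Cs := (col_stab n p).
Local Notation c := (@young_coef F n p).
Local Notation d := (specht_dim F n p).
Local Notation chi := (specht_char F n p).

Let c_real g : c g \is Num.real.
Proof.
apply: rpred_sum => s _; apply: rpred_sum => t _.
by rewrite rpredM ?realn ?rpredX ?rpredN ?real1.
Qed.

Let two0 : (2 : F) != 0. Proof. by rewrite pnatr_eq0. Qed.

(** The left side is the coefficient at [g] of [c x c] in the group algebra. It inherits row
    invariance from the left factor and column signs from the right one, hence is a multiple of
    [c]. *)
Let young_sandwich x g :
  \sum_u c u * c (x^-1 * u^-1 * g)%g =
  (\sum_u c u * c (x^-1 * u^-1)%g) * c g.
Proof.
have := @young_coef_unique F n p sump
  (fun g => \sum_u c u * c (x^-1 * u^-1 * g)%g) two0 _ _ g.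
move=> ->; first by under [in RHS]eq_bigr do rewrite -[(_ * _)%g]mulg1.
- move=> s h sR; rewrite (reindex_inj (mulgI s)) /=; apply: eq_bigr => u _.
  by rewrite young_coefl // invMg !mulgA mulgKV.
- move=> t h tC; rewrite mulr_sumr; apply: eq_bigr => u _.
  by rewrite mulgA young_coefr // mulrCA.
Qed.

Let m := \sum_u c u * c (u^-1)%g.

Let young_sq g : fconv c c g = m * c g.
Proof.
have := young_sandwich 1%g g; rewrite /fconv /m invg1.
by under eq_bigr do rewrite mul1g; under [in RHS]eq_bigr do rewrite mul1g.
Qed.

Let specht_mxE : (specht_mx F n p :=: lmul_mx c)%MS.
Proof.
apply: eqmx_trans (cyclic_regular_mx _) _.
set A := lmul_mx _; suff -> : A = lmul_mx c by [].
rewrite /A /young_symmetrizer; apply/matrixP => i j; rewrite [LHS]mxE [RHS]mxE.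
set g := (_ * _)%g; rewrite -[c g]/(\sum_(s in Rs) _).
rewrite linear_sum summxE; apply: eq_bigr => s _.
rewrite linear_sum summxE; apply: eq_bigr => t _.
rewrite linearZ mxE gring_row_regular_entry gring_indexK ?inE // eq_sym.
by rewrite mulrC.
Qed.

Let lmul_young_sq : lmul_mx c *m lmul_mx c = m *: lmul_mx c.
Proof. by rewrite lmul_mxM; apply/matrixP => i j; rewrite !mxE young_sq. Qed.

(** The trace of left multiplication by [c] is computed twice: as [n!] times the coefficient at 1,
    and as [m] times the rank, by quasi-idempotence. In characteristic 0 this makes [m] and [d]
    nonzero. *)
Let fact_md : n`!%:R = m * d%:R.
Proof.
have := mxtrace_quasi_idem lmul_young_sq.
have -> : \rank (lmul_mx c) = d by rewrite -specht_mxE.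
by rewrite mxtrace_lmul_mx young_coef1 // mulr1 => <-; rewrite cardsT card_Sn.
Qed.

Let fact0 : n`!%:R != 0 :> F. Proof. by rewrite pnatr_eq0 -lt0n fact_gt0. Qed.
Let m0 : m != 0.
Proof. by apply: contraNneq fact0 => e; rewrite fact_md e mul0r. Qed.
Let d0 : d%:R != 0 :> F.
Proof. by apply: contraNneq fact0 => e; rewrite fact_md e mulr0. Qed.
Let mE : m = n`!%:R / d%:R. Proof. by rewrite fact_md mulfK. Qed.

Let chiE' g : chi g = m^-1 * \sum_h c (h * g^-1 * h^-1)%g.
Proof.
rewrite /specht_char /specht_repr.
rewrite (@mxtrace_submod_repr _ _ _ _ _ _ (m^-1 *: lmul_mx c)) ?inE //.
- by rewrite -scalemxAl linearZ -mxtrace_lmul_regular.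
- by apply: eqmx_trans (eqmx_scale _ _) _; rewrite ?invr_eq0 //;
    apply: eqmx_sym; apply: specht_mxE.
- by rewrite -scalemxAl -scalemxAr lmul_young_sq !scalerA -!mulrA mulVf // mulr1.
Qed.

(** Inverting [s] and [t] turns [s t = h g^-1 h^-1] into [t s = h g h^-1]; conjugation by [s]
    restores the order [s t] and is absorbed by the sum over [h]. *)
Let sum_young_inv g :
  \sum_h c (h * g^-1 * h^-1)%g = \sum_h c (h * g * h^-1)%g.
Proof.
rewrite /young_coef exchange_big /= [RHS]exchange_big /=.
rewrite (reindex_inj invg_inj); apply: eq_big => [s|s _]; first exact: groupV.
rewrite exchange_big /= [RHS]exchange_big /=.
rewrite (reindex_inj invg_inj); apply: eq_big => [t|t _]; first exact: groupV.
rewrite (reindex_inj (mulgI s^-1)%g) /= odd_permV.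
apply: eq_bigr => h _; congr (_%:R * _).
rewrite -[in LHS](inj_eq invg_inj) !invMg !invgK.
rewrite -(inj_eq (mulgI s)) -[in LHS](inj_eq (mulIg s^-1)%g).
by rewrite !mulgA mulgV mul1g !mulgK.
Qed.

Let chiE g : chi g = m^-1 * \sum_h c (h * g * h^-1)%g.
Proof. by rewrite chiE' sum_young_inv. Qed.

Lemma specht_charV g : chi (g^-1)%g = chi g.
Proof. by rewrite chiE' invgK -chiE. Qed.

Lemma specht_char_real g : chi g \is Num.real.
Proof.
by rewrite chiE rpredM ?rpred_sum ?mE ?rpredV ?rpredM ?realn ?rpredV ?realn.
Qed.

Let chiJ g h : chi (g ^ h)%g = chi g.
Proof.
rewrite conjgE !chiE; congr (_ * _); rewrite (reindex_inj (mulIg h)) /=.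
by apply: eq_bigr => u _; rewrite invMg !mulgA !mulgK.
Qed.

(** By the sandwich at [g = x], the sum over [x] becomes the coefficient of [c c = m c] at [u^-1];
    the remaining sum over [u] is [m] again. *)
Let sum_young_young :
  \sum_x \sum_u c u * c (x^-1 * u^-1 * x)%g = m ^+ 2.
Proof.
under eq_bigr do rewrite young_sandwich mulr_suml.
rewrite exchange_big /=.
have e u : \sum_x c u * c (x^-1 * u^-1)%g * c x = m * (c u * c (u^-1)%g).
  rewrite mulrCA -young_sq /fconv mulr_sumr.
  by apply: eq_bigr => x _; rewrite -mulrA [c x * _]mulrC.
under eq_bigr do rewrite e.
by rewrite -mulr_sumr expr2.
Qed.

(** A class function is central, so [m chi c = chi c c = c chi c], which is [K c] by the sandwich.
    Comparing at 1, with [chi] expanded into conjugates of [c], gives [K = m ^+ 2]. *)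
Let chi_young g : fconv chi c g = m * c g.
Proof.
pose K := \sum_t chi t * \sum_u c u * c (t^-1 * u^-1)%g.
have KE h : m * fconv chi c h = K * c h.
  rewrite /fconv mulr_sumr /K mulr_suml.
  under eq_bigr do rewrite mulrCA -young_sq mulr_sumr.
  under [RHS]eq_bigr do rewrite -mulrA -young_sandwich mulr_sumr.
  rewrite exchange_big [RHS]exchange_big /=; apply: eq_bigr => u _.
  rewrite (reindex_inj (conjg_inj u^-1)%g) /=; apply: eq_bigr => t _.
  rewrite chiJ conjgE !invMg !invgK !mulgA; congr (_ * (_ * c _)).
  by rewrite mulVg mul1g.
have m2 : K = m ^+ 2.
  have := KE 1%g; rewrite young_coef1 // mulr1 => <-.
  rewrite -sum_young_young /fconv mulr_sumr exchange_big /=.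
  under eq_bigr do rewrite chiE mulg1 -mulrA mulVKf // mulr_suml.
  rewrite exchange_big [RHS]exchange_big /=; apply: eq_bigr => h _.
  rewrite (reindex_inj (conjg_inj h)) /=; apply: eq_bigr => t _.
  rewrite conjgE !invMg !invgK !mulgA mulgV mul1g mulgK.
  by congr (_ * c _).
by apply: (mulfI m0); rewrite KE m2 mulrA expr2.
Qed.

(** [chi] is [m^-1] times the sum of the conjugates of [c], and convolution by [chi] multiplies each
    of these by [m]. *)
Lemma specht_char_conv g : fconv chi chi g = n`!%:R / d%:R * chi g.
Proof.
rewrite -mE /fconv; under eq_bigr do rewrite [X in _ * X]chiE mulrCA mulr_sumr.
rewrite -mulr_sumr exchange_big /= (chiE g) mulrCA; congr (_ * _).
rewrite mulr_sumr; apply: eq_bigr => h _.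
rewrite -chi_young /fconv (reindex_inj (conjg_inj h)) /=.
apply: eq_bigr => t _; rewrite chiJ conjgE; congr (_ * c _).
by rewrite !invMg !invgK !mulgA !mulgV !mul1g.
Qed.

Definition isotypic_mx : 'M[F]_#|[set: 'S_n]| :=
  (d%:R / n`!%:R) *: lmul_mx chi.

Lemma isotypic_mx_idem : isotypic_mx *m isotypic_mx = isotypic_mx.
Proof.
rewrite /isotypic_mx -scalemxAl -scalemxAr lmul_mxM scalerA.
apply/matrixP => i j; rewrite !mxE specht_char_conv -mulrA; congr (_ * _).
by rewrite mulrA mulrA divfK // divff // mul1r.
Qed.

Lemma rank_isotypic_mx : \rank isotypic_mx = (d ^ 2)%N.
Proof.
have := @mxtrace_quasi_idem F _ isotypic_mx 1.
rewrite isotypic_mx_idem scale1r mul1r => /(_ erefl)/esym.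
have cardS : #|[set: 'S_n]|%:R = n`!%:R :> F by rewrite cardsT card_Sn.
rewrite linearZ /= mxtrace_lmul_mx specht_char1 cardS mulrA divfK //.
by rewrite -natrM => /eqP; rewrite eqr_nat => /eqP ->.
Qed.

End SpechtCharacter.

From mathcomp Require Import ring lra.
From mathcomp Require mpoly.
From mathcomp Require Import all_classical all_reals all_analysis.
Import Normc.
Import (canonicals, coercions) mpoly.
Import Order.TTheory GRing.Theory Num.Theory.
Import numFieldNormedType.Exports.
Local Open Scope classical_set_scope.
Local Open Scope ring_scope.

(** * Symmetric polynomials and interpolation on a free orbit *)

Section Vieta.
Variables (A : idomainType) (n : nat).

(** Coefficients lie in an integral domain, so that the roots may also be the variables of a
    polynomial ring. *)
Definition vieta_poly (v : 'rV[A]_n) : {poly A} :=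
  'X^n + \sum_(k < n) ((-1) ^+ k.+1 * v ord0 k) *: 'X^(n - k.+1).

Definition esym_row (x : 'I_n -> A) : 'rV[A]_n :=
  \row_(k < n) mpoly.meval x (mpoly.mesym n A k.+1).

Lemma vieta_poly_coef v (k : 'I_n) :
  (vieta_poly v)`_(n - k.+1) = (-1) ^+ k.+1 * v ord0 k.
Proof.
have kn := ltn_ord k.
rewrite coefD coefXn coef_sum (bigD1 k) //= coefZ coefXn eqxx mulr1.
rewrite [(_ - _ == n)%N]ltn_eqF ?add0r ?ltn_subrL ?(leq_ltn_trans _ kn) //.
rewrite big1 ?addr0 // => l lk; rewrite coefZ coefXn.
case: eqP => [e|]; last by rewrite mulr0.
case/eqP: lk; apply: val_inj => /=; have ln := ltn_ord l.
by apply: succn_inj; rewrite -(subKn kn) e subKn.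
Qed.

Lemma vieta_poly_inj : injective vieta_poly.
Proof.
move=> v w e; apply/rowP => k; have := vieta_poly_coef v k.
rewrite e vieta_poly_coef => /mulfI -> //.
by rewrite expf_neq0 // oppr_eq0 oner_eq0.
Qed.

Lemma vieta_poly_esym x : vieta_poly (esym_row x) = \prod_i ('X - (x i)%:P).
Proof.
pose cs := [tuple x i | i < n].
have csE : tnth cs =1 x by move=> i; rewrite tnth_mktuple.
have -> : \prod_i ('X - (x i)%:P) = \prod_(c <- cs) ('X - c%:P).
  by rewrite big_tuple; apply: eq_bigr => i _; rewrite csE.
have Pc (k : 'I_n.+1) : (\prod_(c <- cs) ('X - c%:P))`_(n - k) =
    (-1) ^+ k * mpoly.meval x (mpoly.mesym n A k).
  by rewrite mpoly.mroots_coeff; congr (_ * _); apply: mpoly.meval_eq.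
apply/polyP => i; have [ni|ni] := leqP i n; last first.
  rewrite [RHS]nth_default; last first.
    by rewrite size_prod_XsubC size_tuple.
  rewrite coefD coefXn gtn_eqF // add0r coef_sum big1 // => k _.
  by rewrite coefZ coefXn gtn_eqF ?mulr0 // (leq_ltn_trans _ ni) // leq_subr.
have -> : i = (n - (n - i))%N by rewrite subKn.
have ki : (n - i < n.+1)%N by rewrite ltnS leq_subr.
move: (n - i)%N ki => k ki.
rewrite (Pc (Ordinal ki)) /=; case: k ki => [|k] ki.
  rewrite subn0 expr0 mul1r mpoly.mesym0E mpoly.meval1 coefD coefXn eqxx.
  rewrite coef_sum big1 ?addr0 // => k _; rewrite coefZ coefXn gtn_eqF ?mulr0 //.
  by rewrite ltn_subrL /= (leq_ltn_trans _ (ltn_ord k)).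
by rewrite (vieta_poly_coef _ (Ordinal (ki : (k < n)%N))) mxE.
Qed.

Lemma esym_row_inj_prod x y :
  (esym_row x == esym_row y) =
  (\prod_i ('X - (x i)%:P) == \prod_i ('X - (y i)%:P)).
Proof. by rewrite -!vieta_poly_esym (inj_eq vieta_poly_inj). Qed.

Lemma esym_row_perm x (s : 'S_n) : esym_row (fun i => x (s i)) = esym_row x.
Proof.
by apply/eqP; rewrite esym_row_inj_prod [X in _ == X](reindex_perm s).
Qed.

Lemma root_prod_XsubC_fin (x : 'I_n -> A) (c : A) :
  (\prod_i ('X - (x i)%:P)).[c] = 0 -> exists i, x i = c.
Proof.
rewrite horner_prod => /eqP/prodf_eq0[i _].
by rewrite hornerXsubC subr_eq0 => /eqP ->; exists i.
Qed.

Lemma esym_row_eq x y : injective x -> esym_row x = esym_row y ->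
  exists s : 'S_n, forall i, y (s i) = x i.
Proof.
move=> xi /eqP; rewrite esym_row_inj_prod => /eqP e.
have hf i : exists j, y j = x i.
  apply: root_prod_XsubC_fin; rewrite -e horner_prod (bigD1 i) //=.
  by rewrite hornerXsubC subrr mul0r.
pose f i := projT1 (cid (hf i)).
have fE i : y (f i) = x i by rewrite /f; case: cid.
have fi : injective f by move=> i j ij; apply: xi; rewrite -!fE ij.
by exists (perm fi) => i; rewrite permE.
Qed.
End Vieta.

Lemma esym_row_surj (A : closedFieldType) n (v : 'rV[A]_n) :
  exists x : 'I_n -> A, esym_row x = v.
Proof.
have sv : size (vieta_poly v) = n.+1.
  rewrite /vieta_poly size_polyDl size_polyXn // ltnS.
  apply: (leq_trans (size_sum _ _ _)); apply/bigmax_leqP => k _.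
  apply: leq_trans (size_scale_leq _ _) _; rewrite size_polyXn.
  by rewrite ltn_subrL /= (leq_ltn_trans _ (ltn_ord k)).
have lv : lead_coef (vieta_poly v) = 1.
  rewrite lead_coefE sv /= coefD coefXn eqxx coef_sum big1 ?addr0 // => k _.
  rewrite coefZ coefXn gtn_eqF ?mulr0 //.
  by rewrite ltn_subrL /= (leq_ltn_trans _ (ltn_ord k)).
have [r rE] := closed_field_poly_normal (vieta_poly v).
rewrite lv scale1r in rE.
have sr : size r = n by apply: succn_inj; rewrite -sv rE size_prod_XsubC.
exists (fun i => r`_i); apply: vieta_poly_inj; rewrite vieta_poly_esym rE.
by rewrite (big_nth 0) big_mkord sr.
Qed.

(** * Interpolation at tuples of nodes *)

Section Lagrange.
Variables (K : fieldType) (n : nat) (a : 'I_n -> K).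
Hypothesis a_inj : injective a.

Definition lagrange_coef j : K := \prod_(k | k != j) (a j - a k)^-1.

Definition lagrange_val (B : comAlgType K) j (x : B) : B :=
  lagrange_coef j *: \prod_(k | k != j) (x - (a k)%:A).

Lemma lagrange_coef_mul j : lagrange_coef j * \prod_(k | k != j) (a j - a k) = 1.
Proof.
rewrite /lagrange_coef -big_split big1 //= => k kj; rewrite mulVf // subr_eq0.
by apply: contra kj => /eqP/a_inj ->.
Qed.

(** The difference of the two sides comes from a polynomial of degree below [n] that vanishes at the
    [n] nodes. The argument ['I_n] excludes [n = 0], where the sum is empty. *)
Lemma sum_lagrange_val (B : comAlgType K) (x : B) : 'I_n ->
  \sum_j lagrange_val j x = 1.
Proof.
move=> i0; pose l j : {poly K} := lagrange_coef j *: \prod_(k | k != j) ('X - (a k)%:P).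
have lE j i : (l j).[a i] = (j == i)%:R.
  rewrite /l hornerZ horner_prod; have [->|ji] := eqVneq j i.
    by under eq_bigr do rewrite hornerXsubC; rewrite lagrange_coef_mul.
  by rewrite (bigD1 i) 1?eq_sym //= hornerXsubC subrr mul0r mulr0.
pose P : {poly K} := \sum_j l j - 1.
have P0 : P = 0.
  apply: (@roots_geq_poly_eq0 _ P [seq a i | i <- enum 'I_n]).
  - apply/allP => _ /mapP[i _ ->]; rewrite rootE hornerD hornerN hornerC horner_sum.
    under eq_bigr do rewrite lE.
    by rewrite (bigD1 i) //= eqxx big1 ?addr0 ?subrr // => j /negPf ->.
  - by rewrite map_inj_uniq // enum_uniq.
  rewrite size_map size_enum_ord; apply: leq_trans (size_polyD _ _) _.
  rewrite size_polyN size_poly1 geq_max (leq_ltn_trans _ (ltn_ord i0)) // andbT.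
  apply: leq_trans (size_sum _ _ _) _; apply/bigmax_leqP => j _.
  apply: leq_trans (size_scale_leq _ _) _.
  rewrite -big_filter size_prod_XsubC -sum1_size big_filter sum1_card.
  by rewrite cardC1 card_ord prednK // (leq_ltn_trans _ (ltn_ord i0)).
have := congr1 (horner_alg x) P0; rewrite rmorph0 rmorphB rmorph1 /= => /eqP.
rewrite subr_eq0 => /eqP <-; rewrite rmorph_sum; apply: eq_bigr => j _.
rewrite /lagrange_val /l -mul_polyC rmorphM /= horner_algC mulr_algl rmorph_prod.
congr (_ *: _).
by apply: eq_bigr => k _; rewrite rmorphB /= horner_algX horner_algC.
Qed.

Variables (B : comAlgType K) (X : 'I_n -> B) (L : {scalar B}).
(** As seen by [L], each [X i] takes its value among the nodes ([LX]), and each node occurs among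
    the [X i] ([La]). *)
Hypothesis LX : forall i y, L (\prod_j (X i - (a j)%:A) * y) = 0.
Hypothesis La : forall j y, L (\prod_i ((a j)%:A - X i) * y) = 0.

(** The product of one-variable Lagrange polynomials: 1 at the point with coordinates [a (phi i)],
    and 0 at every other point with coordinates among the nodes. *)
Definition node (phi : {ffun 'I_n -> 'I_n}) : B := \prod_i lagrange_val (phi i) (X i).

Lemma sum_node : \sum_phi node phi = 1.
Proof.
rewrite /node -(bigA_distr_bigA (fun i j => lagrange_val j (X i))).
by rewrite big1 // => i _; apply: sum_lagrange_val.
Qed.

(** Multiplication by [X i - a (phi i)] completes the [i]-th factor of [node phi] to the product
    over all nodes, which [L] kills. *)
Lemma node_eigen phi i y : L (X i * node phi * y) = a (phi i) * L (node phi * y).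
Proof.
apply/eqP; rewrite -subr_eq0.
have <- : L (X i * node phi * y - a (phi i) *: (node phi * y)) =
    L (X i * node phi * y) - a (phi i) * L (node phi * y).
  by rewrite linearB linearZ.
have -> : X i * node phi * y - a (phi i) *: (node phi * y) =
   lagrange_coef (phi i) *: (\prod_j (X i - (a j)%:A) *
    (\prod_(j | j != i) lagrange_val (phi j) (X j) * y)).
  transitivity ((X i - (a (phi i))%:A) * (node phi * y)).
    by rewrite mulrBl mulr_algl mulrA.
  rewrite /node (bigD1 i) //= {1}/lagrange_val [in RHS](bigD1 (phi i)) //=.
  by rewrite -!scalerAl -scalerAr !mulrA.
by rewrite linearZ /= LX mulr0.
Qed.

(** A map that is not injective misses some [j]. By [node_eigen] the product in [La] for this [j]
    acts on [node phi] as the scalar [\prod_i (a j - a (phi i))], which is nonzero. *)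
Lemma node_kill (phi : {ffun 'I_n -> 'I_n}) (y : B) : ~~ injectiveb phi -> L (node phi * y) = 0.
Proof.
move=> nphi.
have /existsP[j /forallP hj] : [exists j, forall i, phi i != j].
  apply: contraR nphi; rewrite negb_exists => /forallP h.
  have onto j : j \in codom phi.
    have := h j; rewrite negb_forall => /existsP [i /negPn/eqP <-].
    exact: codom_f.
  have gK : cancel (fun j => iinv (onto j)) phi by move=> j; rewrite f_iinv.
  by apply/injectiveP; apply: can_inj (canF_sym gK).
have Ls (s : seq 'I_n) z : L (\prod_(i <- s) ((a j)%:A - X i) * (node phi * z)) =
    \prod_(i <- s) (a j - a (phi i)) * L (node phi * z).
  elim: s => [|i s IH] in z *; first by rewrite !big_nil !mul1r.
  rewrite !big_cons.
  have -> : ((a j)%:A - X i) * \prod_(k <- s) ((a j)%:A - X k) * (node phi * z) =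
      \prod_(k <- s) ((a j)%:A - X k) * (node phi * (((a j)%:A - X i) * z)) by ring.
  rewrite IH.
  have -> : node phi * (((a j)%:A - X i) * z) =
      a j *: (node phi * z) - X i * node phi * z.
    by rewrite mulrBl mulrBr -scalerAl mul1r -scalerAr; congr (_ - _); ring.
  have -> : L (a j *: (node phi * z) - X i * node phi * z) =
      a j * L (node phi * z) - a (phi i) * L (node phi * z).
    by rewrite linearB linearZ /= node_eigen.
  by ring.
have := La j (node phi * y); rewrite Ls => /eqP; rewrite mulf_eq0.
have /negPf-> : \prod_i (a j - a (phi i)) != 0.
  apply/prodf_neq0 => i _; rewrite subr_eq0; apply: contra (hj i) => /eqP/a_inj ->.
  by [].
by move/eqP.
Qed.

End Lagrange.

Section SymmetricIdeal.
Variables (K : fieldType) (n : nat) (a : 'I_n -> K).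
Hypothesis a_inj : injective a.
Local Notation B := (mpoly.mpoly n K).
Local Notation X i := (mpoly.mpolyX K (mpoly.mnm1 i) : B).
Variable L : {scalar B}.
Hypothesis Lsym : forall (k : 'I_n) y,
  L ((mpoly.mesym n K k.+1 - (esym_row a ord0 k)%:A) * y) = 0.

(** Expanding both products in powers of [t] exhibits the difference as a combination of the
    generators of the ideal. If [t] is a variable or a node, one of the products vanishes, which
    gives [LX] and [La]. *)
Let vieta_diff (t y : B) :
  L ((\prod_j (t - X j) - \prod_j (t - (a j)%:A)) * y) = 0.
Proof.
have e1 : \prod_j (t - X j) = (vieta_poly (esym_row (fun j => X j))).[t].
  rewrite vieta_poly_esym horner_prod.
  by apply: eq_bigr => j _; rewrite hornerXsubC.
have e2 : \prod_j (t - (a j)%:A) = (vieta_poly (esym_row (fun j => (a j)%:A : B))).[t].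
  rewrite vieta_poly_esym horner_prod.
  by apply: eq_bigr => j _; rewrite hornerXsubC.
have -> : \prod_j (t - X j) - \prod_j (t - (a j)%:A) = \sum_(k < n)
    (mpoly.mesym n K k.+1 - (esym_row a ord0 k)%:A) * ((-1) ^+ k.+1 * t ^+ (n - k.+1)).
  rewrite e1 e2 /vieta_poly !hornerD opprD addrACA subrr add0r !horner_sum -sumrB.
  apply: eq_bigr => k _; rewrite !hornerZ hornerXn !mxE.
  have -> : mpoly.meval (fun j => X j) (mpoly.mesym n B k.+1) = mpoly.mesym n K k.+1.
    rewrite /mpoly.mesym rmorph_sum; apply: eq_bigr => h _ /=.
    by rewrite rmorph_prod; apply: eq_bigr => j _ /=; rewrite mpoly.mevalXU.
  have -> : mpoly.meval (fun j => (a j)%:A : B) (mpoly.mesym n B k.+1) =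
      (mpoly.meval a (mpoly.mesym n K k.+1))%:A.
    rewrite /mpoly.mesym !rmorph_sum /= scaler_suml; apply: eq_bigr => h _ /=.
    rewrite !rmorph_prod /=.
    transitivity (\prod_(j in h) GRing.in_alg B (a j)).
      by apply: eq_bigr => j _; rewrite mpoly.mevalXU.
    rewrite -rmorph_prod /=; congr (_ *: _).
    by apply: eq_bigr => j _; rewrite mpoly.mevalXU.
  by ring.
rewrite mulr_suml linear_sum; apply: big1 => k _ /=.
by rewrite -mulrA Lsym.
Qed.

Let LX i y : L (\prod_j (X i - (a j)%:A) * y) = 0.
Proof.
have := vieta_diff (X i) y; rewrite (bigD1 i) //= subrr mul0r sub0r mulNr.
by rewrite linearN => /eqP; rewrite oppr_eq0 => /eqP.
Qed.

Let La j y : L (\prod_i ((a j)%:A - X i) * y) = 0.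
Proof.
have := vieta_diff (a j)%:A y.
by rewrite [Y in _ - Y](bigD1 j) //= subrr mul0r subr0.
Qed.

Let nd := node (B := B) a (fun i => X i).

Let L_node p phi y : L (p * nd phi * y) = mpoly.meval (fun i => a (phi i)) p * L (nd phi * y).
Proof.
pose good (q : B) := forall y,
  L (q * nd phi * y) = mpoly.meval (fun i => a (phi i)) q * L (nd phi * y).
have goodM q r : good q -> good r -> good (q * r).
  move=> hq hr z; have -> : q * r * nd phi * z = q * nd phi * (r * z) by ring.
  rewrite hq; have -> : nd phi * (r * z) = r * nd phi * z by ring.
  by rewrite hr rmorphM mulrA.
have good1 : good 1 by move=> z; rewrite rmorph1 !mul1r.
have goodX i : good (X i).
  by move=> z; rewrite mpoly.mevalXU; exact: (node_eigen LX).
have goodE q k : good q -> good (q ^+ k).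
  by move=> hq; elim: k => [|k IH]; rewrite ?expr0 ?exprS //; apply: goodM.
suff : good p by apply.
elim/mpoly.mpolyind: p => [|c m p _ _ hp] z.
  by rewrite rmorph0 !mul0r linear0.
have goodm : good (mpoly.mpolyX K m).
  rewrite mpoly.mpolyXE_id; elim/big_ind: _ => // i _; exact: goodE.
rewrite rmorphD [in RHS]mulrDl !mulrDl linearD hp; congr (_ + _).
by rewrite -!scalerAl linearZ /= goodm mpoly.mevalZ mulrA.
Qed.

(** Insert [1 = \sum_phi node phi] into [L p]: the nodes of non-injective [phi] contribute nothing,
    and on the others [p] acts as its value at a point of the orbit. The [e s] are the Lagrange
    polynomials of the orbit. *)
Lemma symmetric_ideal_functional : 'I_n -> exists e : 'S_n -> B,
  (forall p, L p = \sum_(s : 'S_n) mpoly.meval (fun i => a (s i)) p * L (e s)) /\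
  (forall s t : 'S_n, mpoly.meval (fun i => a (t i)) (e s) = (s == t)%:R).
Proof.
move=> i0; exists (fun s : 'S_n => nd (val s)); split.
  move=> p; have /(congr1 L) -> : p = \sum_phi p * nd phi * 1.
    by under eq_bigr do rewrite mulr1; rewrite -mulr_sumr sum_node ?mulr1.
  rewrite linear_sum (bigID (fun phi : {ffun 'I_n -> 'I_n} => injectiveb phi)) /=.
  rewrite [Y in _ + Y]big1 ?addr0 => [|phi nphi]; last first.
    by rewrite L_node (node_kill a_inj LX La) ?mulr0.
  rewrite (reindex_omap (fun s : 'S_n => pval s) (fun f => insub f : option 'S_n)) /=; last first.
    by move=> phi hphi; rewrite insubT.
  apply: eq_big => [s|s _].
    by rewrite valK eqxx andbT (valP s).
  rewrite L_node mulr1; congr (_ * _); apply: mpoly.meval_eq => i.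
  by rewrite -[LHS]/(a (pval s i)) pvalE.
move=> s t.
have lv i : mpoly.meval (fun i => a (t i)) (lagrange_val a (val s i) (X i)) =
    lagrange_coef a (s i) * \prod_(k | k != s i) (a (t i) - a k).
  rewrite /lagrange_val mpoly.mevalZ rmorph_prod -[val s i]/(pval s i) pvalE.
  congr (_ * _); apply: eq_bigr => k _ /=.
  by rewrite rmorphB /= mpoly.mevalXU mpoly.mevalZ rmorph1 mulr1.
rewrite /nd /node rmorph_prod /=; under eq_bigr do rewrite lv.
have [->|st] := eqVneq s t.
  by rewrite big1 // => i _; rewrite lagrange_coef_mul.
have /existsP[i si] : [exists i, s i != t i].
  apply: contraR st; rewrite negb_exists => /forallP h.
  by apply/eqP/permP => i; apply/eqP; have := h i; rewrite negbK.
rewrite (bigD1 i) //= [Y in _ * Y * _](bigD1 (t i)) 1?eq_sym //=.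
by rewrite subrr mul0r mulr0 mul0r.
Qed.

End SymmetricIdeal.

(** * The binomial series *)

Section PowerSeriesRadius.
Variable R : realType.
Implicit Types (c : R^nat) (rho : R).

(** A radius of convergence of at least [rho], expressed by bounded terms at every smaller radius;
    in this form it passes easily to the differentiated series. *)
Definition pseries_bounded c rho := forall q : R, 0 <= q -> q < rho ->
  exists M : R, forall k, `|c k| * q ^+ k <= M.

Lemma pseries_bounded_cvg c rho x :
  pseries_bounded c rho -> `|x| < rho -> cvgn (pseries c x).
Proof.
move=> cb xr; have [q /andP[xq qr]] : exists q, `|x| < q < rho.
  by exists ((`|x| + rho) / 2); rewrite midf_lt // midf_lt.
have q0 : 0 < q by apply: le_lt_trans xq.
have [M HM] := cb q (ltW q0) qr.
apply: normed_cvg.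
apply: (@series_le_cvg _ _ (geometric M (`|x| / q))).
- by move=> k; rewrite normr_ge0.
- move=> k; rewrite /geometric /= mulr_ge0 ?exprn_ge0 ?divr_ge0 ?(ltW q0) //.
  by apply: le_trans (HM 0%N); rewrite mulr_ge0 ?exprn_ge0 ?(ltW q0).
- move=> k; rewrite /geometric /= normrM normrX expr_div_n mulrCA [leLHS]mulrC.
  rewrite ler_wpM2l ?exprn_ge0 //.
  by rewrite ler_pdivlMr ?exprn_gt0.
apply: is_cvg_geometric_series.
by rewrite normrM normr_id normfV (gtr0_norm q0) ltr_pdivrMr // mul1r.
Qed.

(** A slightly larger radius [s] absorbs the factor [k + 1]: with [t = q / s], (k + 1) t^k is at
    most 1 + t + ... + t^k, hence at most 1 / (1 - t). *)
Lemma pseries_bounded_diffs c rho :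
  pseries_bounded c rho -> pseries_bounded (pseries_diffs c) rho.
Proof.
move=> cb q q0 qr; have [s /andP[qs sr]] : exists s, q < s < rho.
  by exists ((q + rho) / 2); rewrite midf_lt // midf_lt.
have s0 : 0 < s by apply: le_lt_trans qs.
have [M HM] := cb s (ltW s0) sr.
have M0 : 0 <= M by apply: le_trans (HM 0%N); rewrite mulr_ge0 ?exprn_ge0 ?(ltW s0).
pose t := q / s.
have t0 : 0 <= t by rewrite divr_ge0 ?(ltW s0).
have t1 : t < 1 by rewrite ltr_pdivrMr // mul1r.
exists (M / s * (1 - t)^-1) => k.
have kt : k.+1%:R * t ^+ k <= (1 - t)^-1.
  rewrite -div1r ler_pdivlMr ?subr_gt0 //.
  have -> : k.+1%:R * t ^+ k = \sum_(i < k.+1) t ^+ k.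
    by rewrite sumr_const card_ord mulr_natl.
  apply: (@le_trans _ _ ((\sum_(i < k.+1) t ^+ i) * (1 - t))).
    apply: ler_wpM2r; first by rewrite subr_ge0 ltW.
    apply: ler_sum => i _.
    by apply: ler_wiXn2l => //; [exact: ltW | rewrite -ltnS].
  have -> : (\sum_(i < k.+1) t ^+ i) * (1 - t) = 1 - t ^+ k.+1.
    by rewrite mulrC -opprB mulNr -subrX1 opprB.
  by rewrite lerBlDr lerDl exprn_ge0.
rewrite /pseries_diffs normrM (ger0_norm (ler0n _ _)).
have -> : q ^+ k = t ^+ k * s ^+ k by rewrite -exprMn divfK // gt_eqF.
have -> : k.+1%:R * `|c k.+1| * (t ^+ k * s ^+ k) =
    (`|c k.+1| * s ^+ k.+1) / s * (k.+1%:R * t ^+ k).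
  by rewrite exprS; field; rewrite gt_eqF.
apply: ler_pM => //; rewrite ?divr_ge0 ?mulr_ge0 ?exprn_ge0 ?(ltW s0) //.
by rewrite ler_pdivlMr ?divfK // ?gt_eqF.
Qed.

Lemma pseries_bounded_derive c rho x : pseries_bounded c rho -> `|x| < rho ->
  is_derive x (1 : R) (fun x => limn (pseries c x))
    (limn (pseries (pseries_diffs c) x)).
Proof.
move=> cb xr; have [q /andP[xq qr]] : exists q, `|x| < q < rho.
  by exists ((`|x| + rho) / 2); rewrite midf_lt // midf_lt.
have nq : `|q| = q by rewrite gtr0_norm //; apply: le_lt_trans xq.
have cq c' : pseries_bounded c' rho -> cvgn (pseries c' q).
  by move=> /pseries_bounded_cvg; apply; rewrite nq.
by apply: (@pseries_snd_diffs _ _ q); rewrite ?nq //; do ?apply: cq;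
  do ?apply: pseries_bounded_diffs.
Qed.

Lemma pseries_diffs_shift c rho x : pseries_bounded c rho -> `|x| < rho ->
  pseries (fun k => k%:R * c k) x @ \oo --> x * limn (pseries (pseries_diffs c) x).
Proof.
move=> cb xr; have cd : cvgn (pseries (pseries_diffs c) x).
  by apply: pseries_bounded_cvg xr; apply: pseries_bounded_diffs.
have -> : pseries (fun k => k%:R * c k) x =
    cst x \* series (fun i => i%:R * c i * x ^+ i.-1).
  apply/funext => K; rewrite /pseries /series /= mulr_sumr.
  apply: eq_bigr => -[|k] _; first by rewrite !mul0r mulr0.
  by rewrite [x ^+ k.+1]exprS /=; ring.
by apply: cvgM; [exact: cvg_cst | exact: pseries_diffs_equiv].
Qed.

End PowerSeriesRadius.

Section BinomialCoefficients.
Variables (R : realType) (lambda : R).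
Hypothesis lambda0 : 0 < lambda.

(** lambda (lambda + 1) ... (lambda + k - 1) / k!, the coefficient of x^k in (1 - x)^(-lambda). *)
Definition binom_coef k : R := \prod_(i < k) ((lambda + i%:R) / i.+1%:R).

Lemma binom_coefS k :
  k.+1%:R * binom_coef k.+1 = (lambda + k%:R) * binom_coef k.
Proof.
by rewrite /binom_coef big_ord_recr /= [LHS]mulrC -mulrA divfK ?pnatr_eq0 // mulrC.
Qed.

Lemma binom_coef_gt0 k : 0 < binom_coef k.
Proof. by apply: prodr_gt0 => i _; rewrite divr_gt0 // ltr_wpDr. Qed.

Lemma binom_coef_bounded : pseries_bounded binom_coef 1.
Proof.
(* From [k0] on, the ratio [(lambda + k) q / (k + 1)] of consecutive terms is at most 1, so the sum
   of the terms up to [k0] bounds them all. *)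
move=> q q0 q1; pose k0 := Num.bound (lambda * q / (1 - q)).
have hk0 k : (k0 <= k)%N -> (lambda + k%:R) * q <= k.+1%:R.
  move=> k0k; have : lambda * q / (1 - q) < k%:R.
    apply: lt_le_trans (archi_boundP _) _; last by rewrite ler_nat.
    by rewrite divr_ge0 ?mulr_ge0 ?subr_ge0 ?(ltW lambda0) ?(ltW q1).
  rewrite ltr_pdivrMr ?subr_gt0 // -natr1; nra.
have cq0 k : 0 <= binom_coef k * q ^+ k.
  by rewrite mulr_ge0 ?exprn_ge0 // ltW // binom_coef_gt0.
exists (\sum_(k < k0.+1) binom_coef k * q ^+ k) => k.
rewrite gtr0_norm ?binom_coef_gt0 //.
have le_low j : (j <= k0)%N ->
    binom_coef j * q ^+ j <= \sum_(k < k0.+1) binom_coef k * q ^+ k.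
  move=> jk; rewrite (bigD1 (inord j)) //= inordK ?ltnS // lerDl.
  by apply: sumr_ge0 => i _.
have [|/ltnW k0k] := leqP k k0; first exact: le_low.
rewrite -(subnK k0k); elim: (k - k0)%N => [|j IH]; first exact: le_low.
apply: le_trans IH; rewrite addSn exprS mulrA ler_wpM2r ?exprn_ge0 //.
rewrite -(ler_pM2l (ltr0Sn R (j + k0))) mulrA binom_coefS mulrAC.
by rewrite ler_wpM2r ?hk0 ?leq_addl // ltW // binom_coef_gt0.
Qed.

End BinomialCoefficients.

Lemma cst_on_unit_segment (R : realType) (f : R -> R) :
  (forall x : R, 0 <= x <= 1 -> is_derive x (1 : R) f 0) -> f 1 = f 0.
Proof.
move=> fd; apply/eqP; rewrite -subr_eq0; apply/eqP.
have [||c _ ->] := @MVT_segment R f (fun=> 0) 0 1 ler01; last by rewrite mul0r.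
  by move=> x; rewrite in_itv /= => /andP[x0 x1]; apply: fd; rewrite !ltW.
apply: derivable_within_continuous => x; rewrite in_itv /= => x01.
by have [] := fd x x01.
Qed.

(** * The binomial series sums to the principal power *)

Section BinomialSeries.
Variables (R : realType) (lambda : R) (z : R[i]).
Hypotheses (lambda0 : 0 < lambda) (z1 : normc z < 1).
Local Notation X := (complex.Re z).
Local Notation Y := (complex.Im z).
Local Notation b := (binom_coef lambda).

Let sr k := b k * complex.Re (z ^+ k).
Let si k := b k * complex.Im (z ^+ k).
(** A radius with [1 < rho] and [normc z * rho < 1], so that [t = 1] is an interior point of
    convergence of both real series. *)
Let rho : R := 2 / (1 + normc z).

Let nz0 : 0 <= normc z.
Proof. by case: (z) => x y /=; exact: sqrtr_ge0. Qed.

Let rho1 : 1 < rho.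
Proof.
rewrite /rho ltr_pdivlMr ?mul1r; last by rewrite ltr_wpDr.
by rewrite -[2]/(1 + 1) ltrD2l.
Qed.

Lemma normcX (w : R[i]) k : normc (w ^+ k) = normc w ^+ k.
Proof.
elim: k => [|k IH]; first by rewrite !expr0 normc1.
by rewrite !exprS normcM IH.
Qed.

Lemma le_Re_normc (w : R[i]) : `|complex.Re w| <= normc w.
Proof.
case: w => x y /=; rewrite -sqrtr_sqr ler_sqrt ?addr_ge0 ?sqr_ge0 //.
by rewrite lerDl sqr_ge0.
Qed.

Lemma le_Im_normc (w : R[i]) : `|complex.Im w| <= normc w.
Proof.
case: w => x y /=; rewrite -sqrtr_sqr ler_sqrt ?addr_ge0 ?sqr_ge0 //.
by rewrite lerDr sqr_ge0.
Qed.

Let coef_bounded (c : nat -> R) : (forall k, `|c k| <= normc z ^+ k) ->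
  pseries_bounded (fun k => b k * c k) rho.
Proof.
move=> cz q q0 qr.
have nq0 : 0 <= normc z * q by rewrite mulr_ge0.
have nq1 : normc z * q < 1.
  move: qr z1 nz0; rewrite /rho; move: (normc z : R) => r qr r1 r0.
  by move: qr; rewrite ltr_pdivlMr; [nra | lra].
have [M HM] := binom_coef_bounded lambda0 nq0 nq1.
exists M => k; apply: le_trans (HM k).
rewrite normrM -mulrA exprMn; apply: ler_wpM2l => //.
by apply: ler_wpM2r; rewrite ?exprn_ge0.
Qed.

Let sr_bounded : pseries_bounded sr rho.
Proof.
by apply: coef_bounded => k; apply: le_trans (le_Re_normc _) _; rewrite normcX.
Qed.

Let si_bounded : pseries_bounded si rho.
Proof.
by apply: coef_bounded => k; apply: le_trans (le_Im_normc _) _; rewrite normcX.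
Qed.

Let Sr t := limn (pseries sr t).
Let Si t := limn (pseries si t).
Let dSr t := limn (pseries (pseries_diffs sr) t).
Let dSi t := limn (pseries (pseries_diffs si) t).

Let srS k : k.+1%:R * sr k.+1 = (lambda + k%:R) * (X * sr k - Y * si k).
Proof.
rewrite /sr /si mulrA binom_coefS exprS.
by case: (z) => x y; case: (_ ^+ k) => u v /=; ring.
Qed.

Let siS k : k.+1%:R * si k.+1 = (lambda + k%:R) * (X * si k + Y * sr k).
Proof.
rewrite /sr /si mulrA binom_coefS exprS.
by case: (z) => x y; case: (_ ^+ k) => u v /=; ring.
Qed.

Let cvg_comb (c1 c2 : R^nat) t (u v : R) : `|t| < rho ->
  pseries_bounded c1 rho -> pseries_bounded c2 rho ->
  pseries (fun k => (lambda + k%:R) * (u * c1 k + v * c2 k)) t @ \oo -->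
  u * (lambda * limn (pseries c1 t) + t * limn (pseries (pseries_diffs c1) t)) +
  v * (lambda * limn (pseries c2 t) + t * limn (pseries (pseries_diffs c2) t)).
Proof.
move=> tr b1 b2.
have -> : pseries (fun k => (lambda + k%:R) * (u * c1 k + v * c2 k)) t =
  (cst u \* (cst lambda \* pseries c1 t + pseries (fun k => k%:R * c1 k) t)) +
  (cst v \* (cst lambda \* pseries c2 t + pseries (fun k => k%:R * c2 k) t)).
  apply/funext => K; rewrite !fctE /pseries /series /=.
  rewrite !mulr_sumr -!big_split /= !mulr_sumr -!big_split /=.
  by apply: eq_bigr => k _; ring.
by apply: cvgD; apply: cvgM; try exact: cvg_cst;
  apply: cvgD; try exact: pseries_diffs_shift tr;
  apply: cvgM; try exact: cvg_cst; apply: pseries_bounded_cvg tr.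
Qed.

(** Real part of S' = z (lambda S + t S') for S(t) = sum of b_k (t z)^k, that is, of (1 - t z) S' =
    lambda z S; it is the recurrence [binom_coefS] of the coefficients. *)
Let dSrE t : `|t| < rho ->
  dSr t = X * (lambda * Sr t + t * dSr t) - Y * (lambda * Si t + t * dSi t).
Proof.
move=> tr; rewrite -mulNr; apply/cvg_lim => //.
rewrite (_ : pseries_diffs sr =
  fun k => (lambda + k%:R) * (X * sr k + (- Y) * si k)); first exact: cvg_comb.
by apply/funext => k; rewrite /pseries_diffs srS mulNr.
Qed.

Let dSiE t : `|t| < rho ->
  dSi t = X * (lambda * Si t + t * dSi t) + Y * (lambda * Sr t + t * dSr t).
Proof.
move=> tr; apply/cvg_lim => //.
rewrite (_ : pseries_diffs si =
  fun k => (lambda + k%:R) * (X * si k + Y * sr k)); first exact: cvg_comb.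
by apply/funext => k; rewrite /pseries_diffs siS.
Qed.

(** [U + i V] is [1 - t z], and [E], [theta] are modulus and argument of W(t) = (1 - t z)^lambda;
    the arctangent gives the argument because [U] is positive on the segment. *)
Let U t := 1 - t * X.
Let V t := - (t * Y).
Let D t := U t * U t + V t * V t.
Let E t := expR (lambda / 2 * ln (D t)).
Let theta t := lambda * atan (V t / U t).

Let U_gt0 t : 0 <= t <= 1 -> 0 < U t.
Proof.
move=> /andP[t0 t1]; rewrite /U subr_gt0.
apply: le_lt_trans z1; apply: le_trans (le_Re_normc z).
apply: le_trans (ler_norm _) _; rewrite normrM ger0_norm //.
by rewrite ler_piMl.
Qed.

Let D_gt0 t : 0 <= t <= 1 -> 0 < D t.
Proof. by move=> /U_gt0 h; rewrite /D; nra. Qed.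

Let dU t : is_derive t (1 : R) U (- X).
Proof.
rewrite /U; apply: is_derive_eq.
by rewrite /GRing.scale /=; ring.
Qed.

Let dV t : is_derive t (1 : R) V (- Y).
Proof.
rewrite /V; apply: is_derive_eq.
by rewrite /GRing.scale /=; ring.
Qed.

Let dD t : is_derive t (1 : R) D (- 2 * (X * U t + Y * V t)).
Proof.
rewrite /D; apply: is_derive_eq.
by rewrite /GRing.scale /=; ring.
Qed.

Let dE (t : R) : 0 <= t <= 1 ->
  is_derive t (1 : R) E (- lambda * (X * U t + Y * V t) / D t * E t).
Proof.
move=> t01; have D0 := D_gt0 t01.
have dln : is_derive t (1 : R) (fun t => ln (D t))
    ((D t)^-1 * (- 2 * (X * U t + Y * V t))).
  exact: (is_derive1_comp (is_derive1_ln D0) (dD t)).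
have dlin := is_deriveZ (lambda / 2) dln.
have dexp := @is_derive1_comp _ (@expR R) (fun t => lambda / 2 * ln (D t)) t _ _
  (is_derive_expR _) dlin.
apply: is_derive_eq dexp _.
by rewrite /E /GRing.scale /=; field; rewrite gt_eqF.
Qed.

Let dtheta (t : R) : 0 <= t <= 1 ->
  is_derive t (1 : R) theta (lambda * (X * V t - Y * U t) / D t).
Proof.
move=> t01; have U0 := U_gt0 t01; have D0 := D_gt0 t01.
have U0' : U t != 0 by rewrite gt_eqF.
have dq := is_deriveM (dV t) (is_deriveV U0' (dU t)).
have da := @is_derive1_comp _ (@atan R) (fun t => V t / U t) t _ _
  (is_derive1_atan _) dq.
apply: is_derive_eq (is_deriveZ lambda da) _.
rewrite /D /GRing.scale /=; field.
by rewrite U0' /= gt_eqF //; apply: D_gt0.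
Qed.

Let dS_solve (t : R) : 0 <= t <= 1 ->
  dSr t = lambda * ((X * U t + Y * V t) * Sr t - (Y * U t - X * V t) * Si t) / D t
  /\
  dSi t = lambda * ((X * U t + Y * V t) * Si t + (Y * U t - X * V t) * Sr t) / D t.
Proof.
move=> t01; have D0 : D t != 0 by rewrite gt_eqF ?D_gt0.
have tr : `|t| < rho.
  by case/andP: t01 => t0 t1; rewrite ger0_norm //; apply: le_lt_trans rho1.
have e1 : U t * dSr t - V t * dSi t = lambda * (X * Sr t - Y * Si t).
  apply/eqP; rewrite -subr_eq0; have /eqP := dSrE tr.
  by rewrite -subr_eq0 => /eqP <-; rewrite /U /V; apply/eqP; ring.
have e2 : U t * dSi t + V t * dSr t = lambda * (X * Si t + Y * Sr t).
  apply/eqP; rewrite -subr_eq0; have /eqP := dSiE tr.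
  by rewrite -subr_eq0 => /eqP <-; rewrite /U /V; apply/eqP; ring.
split; apply: (mulIf D0); rewrite divfK //.
  transitivity (U t * (U t * dSr t - V t * dSi t) +
                V t * (U t * dSi t + V t * dSr t)); first by rewrite /D; ring.
  by rewrite e1 e2; ring.
transitivity (U t * (U t * dSi t + V t * dSr t) -
              V t * (U t * dSr t - V t * dSi t)); first by rewrite /D; ring.
by rewrite e1 e2; ring.
Qed.

Let pseries0 (c : R^nat) : limn (pseries c 0) = c 0%N.
Proof.
apply/cvg_lim => //; rewrite -(cvg_shiftS (pseries c 0)) /=.
rewrite (_ : (fun _ => _) = cst (c 0%N)); first exact: cvg_cst.
apply/funext => K; rewrite /pseries /series /= big_nat_recl // expr0 mulr1 big1.
  by rewrite addr0.
by move=> k _; rewrite exprS mul0r mulr0.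
Qed.

Let unit01 (t : R) : 0 <= t <= 1 -> `|t| < rho.
Proof.
by move=> /andP[t0 t1]; rewrite ger0_norm //; apply: le_lt_trans rho1.
Qed.

(** The differential equations make S W constant on the segment, with value 1 at [t = 0], so S(1) is
    the inverse of W(1). [F1] and [F2] are the real and imaginary parts of this. *)
Let series_at_1 : Sr 1 = (E 1)^-1 * cos (theta 1) /\ Si 1 = - ((E 1)^-1 * sin (theta 1)).
Proof.
pose Wr t := E t * cos (theta t); pose Wi t := E t * sin (theta t).
have dSr' (t : R) : 0 <= t <= 1 -> is_derive t (1 : R) Sr (dSr t).
  by move=> t01; apply: pseries_bounded_derive (unit01 t01); apply: sr_bounded.
have dSi' (t : R) : 0 <= t <= 1 -> is_derive t (1 : R) Si (dSi t).
  by move=> t01; apply: pseries_bounded_derive (unit01 t01); apply: si_bounded.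
have dWr (t : R) : 0 <= t <= 1 -> is_derive t (1 : R) Wr
    (lambda * (- (X * U t + Y * V t) * Wr t + (Y * U t - X * V t) * Wi t) / D t).
  move=> t01; have D0 : D t != 0 by rewrite gt_eqF ?D_gt0.
  have dc := @is_derive1_comp _ (@cos R) theta t _ _ (is_derive_cos _) (dtheta t01).
  apply: is_derive_eq (is_deriveM (dE t01) dc) _.
  by rewrite /Wr /Wi /GRing.scale /=; field.
have dWi (t : R) : 0 <= t <= 1 -> is_derive t (1 : R) Wi
    (lambda * (- (X * U t + Y * V t) * Wi t - (Y * U t - X * V t) * Wr t) / D t).
  move=> t01; have D0 : D t != 0 by rewrite gt_eqF ?D_gt0.
  have dc := @is_derive1_comp _ (@sin R) theta t _ _ (is_derive_sin _) (dtheta t01).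
  apply: is_derive_eq (is_deriveM (dE t01) dc) _.
  by rewrite /Wr /Wi /GRing.scale /=; field.
have F1 : Sr 1 * Wr 1 - Si 1 * Wi 1 = Sr 0 * Wr 0 - Si 0 * Wi 0.
  apply: (cst_on_unit_segment (f := fun t => Sr t * Wr t - Si t * Wi t)) => t t01.
  have D0 : D t != 0 by rewrite gt_eqF ?D_gt0.
  apply: is_derive_eq (is_deriveB (is_deriveM (dSr' t t01) (dWr t t01))
    (is_deriveM (dSi' t t01) (dWi t t01))) _.
  have [-> ->] := dS_solve t01.
  by rewrite /GRing.scale /=; field.
have F2 : Sr 1 * Wi 1 + Si 1 * Wr 1 = Sr 0 * Wi 0 + Si 0 * Wr 0.
  apply: (cst_on_unit_segment (f := fun t => Sr t * Wi t + Si t * Wr t)) => t t01.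
  have D0 : D t != 0 by rewrite gt_eqF ?D_gt0.
  apply: is_derive_eq (is_deriveD (is_deriveM (dSr' t t01) (dWi t t01))
    (is_deriveM (dSi' t t01) (dWr t t01))) _.
  have [-> ->] := dS_solve t01.
  by rewrite /GRing.scale /=; field.
have Wr0 : Wr 0 = 1.
  rewrite /Wr /E /theta /D /U /V !mul0r subr0 oppr0 !mul0r addr0 mulr1.
  by rewrite ln1 mulr0 expR0 atan0 mulr0 cos0 mulr1.
have Wi0 : Wi 0 = 0.
  rewrite /Wi /E /theta /D /U /V !mul0r subr0 oppr0 !mul0r addr0 mulr1.
  by rewrite ln1 mulr0 expR0 atan0 mulr0 sin0 mulr0.
have Sr0 : Sr 0 = 1 by rewrite /Sr pseries0 /sr /binom_coef big_ord0 expr0 mulr1.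
have Si0 : Si 0 = 0 by rewrite /Si pseries0 /si expr0 mulr0.
move: F1 F2; rewrite Sr0 Si0 Wr0 Wi0 mulr1 !mul0r mulr0 subr0 addr0 /Wr /Wi.
have := cos2Dsin2 (theta 1); have : E 1 != 0 by rewrite gt_eqF ?expR_gt0.
move: (E 1) (cos _) (sin _) (Sr 1) (Si 1) => e c s a b' e0 cs h1 h2.
split; apply: (mulfI e0).
  rewrite mulrA divff // mul1r.
  transitivity (e * a * (c ^+ 2 + s ^+ 2)); first by rewrite cs mulr1.
  transitivity (c * (a * (e * c) - b' * (e * s)) + s * (a * (e * s) + b' * (e * c))).
    by ring.
  by rewrite h1 h2; ring.
rewrite mulrN mulrA divff // mul1r.
transitivity (e * b' * (c ^+ 2 + s ^+ 2)); first by rewrite cs mulr1.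
transitivity (- s * (a * (e * c) - b' * (e * s)) + c * (a * (e * s) + b' * (e * c))).
  by ring.
by rewrite h1 h2; ring.
Qed.

Let rpowE : rpow (1 - z) (- lambda) = Complex (Sr 1) (Si 1).
Proof.
have [-> ->] := series_at_1.
have h1 : 0 <= (1 : R) <= 1 by rewrite ler01 lexx.
have D0 := D_gt0 h1.
have UE : complex.Re (1 - z) = U 1 by rewrite /U mul1r; case: (z).
have VE : complex.Im (1 - z) = V 1.
  by rewrite /V mul1r; case: (z) => x y /=; rewrite sub0r.
rewrite /rpow UE VE mulNr cosN sinN mulrN -/(theta 1).
suff -> : complex.Re `|1 - z| `^ (- lambda) = (E 1)^-1 by [].
rewrite normc_def UE VE [complex.Re _]/= /E /powR gt_eqF ?sqrtr_gt0; last first.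
  exact: D0.
rewrite -expRN; congr expR; rewrite -[U 1 ^+ 2 + _]/(D 1).
rewrite -(sqr_sqrtr (ltW D0)) lnXn ?sqrtr_gt0 ?D0 //.
rewrite -mulr_natr sqrtr_sqr ger0_norm ?sqrtr_ge0 //.
by field.
Qed.

Lemma Re_binomial_series :
  (fun K => \sum_(k < K) b k * complex.Re (z ^+ k)) @ \oo -->
  complex.Re (rpow (1 - z) (- lambda)).
Proof.
rewrite rpowE /=.
have := @pseries_bounded_cvg _ _ _ 1 sr_bounded.
rewrite normr1 => /(_ rho1) h.
rewrite (_ : (fun K => _) = pseries sr 1) //; apply/funext => K.
rewrite /pseries /series /= big_mkord; apply: eq_bigr => k _.
by rewrite expr1n mulr1.
Qed.

Lemma Im_binomial_series :
  (fun K => \sum_(k < K) b k * complex.Im (z ^+ k)) @ \oo -->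
  complex.Im (rpow (1 - z) (- lambda)).
Proof.
rewrite rpowE /=.
have := @pseries_bounded_cvg _ _ _ 1 si_bounded.
rewrite normr1 => /(_ rho1) h.
rewrite (_ : (fun K => _) = pseries si 1) //; apply/funext => K.
rewrite /pseries /series /= big_mkord; apply: eq_bigr => k _.
by rewrite expr1n mulr1.
Qed.

End BinomialSeries.

Lemma cvg_norm_le (K : numFieldType) (V : normedModType K) (T : Type)
    (F : set_system T) {FF : ProperFilter F} (u : T -> V) (l : V) (M : K) :
  u @ F --> l -> (\forall x \near F, `|u x| <= M) -> `|l| <= M.
Proof.
move=> ul uM; have [x0 Mx0] := @filter_ex _ _ FF _ uM.
have Mr : M \is Num.real by apply: ger0_real; apply: le_trans Mx0.
rewrite real_leNgt ?normr_real //; apply/negP => Ml.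
have /cvgrPdist_lt/(_ (`|l| - M)) := ul; rewrite subr_gt0 => /(_ Ml) near_l.
have [x [xM]] := @filter_ex _ _ FF _ (filterI uM near_l).
apply/negP; rewrite -real_leNgt ?rpredB ?normr_real //.
rewrite lerBlDr -[in leLHS](subrK (u x) l).
by apply: le_trans (ler_normD _ _) _; rewrite lerD2l.
Qed.

Section ProductDistance.
Variables (K : numDomainType) (I : Type).

(** One factor is exchanged at a time; [1 <= B] lets the full product bound each partial one. *)
Lemma prod_distance (s : seq I) (x y B : I -> K) (theta : K) :
  (forall i, `|x i| <= B i) -> (forall i, `|y i| <= B i) ->
  (forall i, 1 <= B i) -> (forall i, `|x i - y i| <= theta) ->
  `|\prod_(i <- s) x i - \prod_(i <- s) y i|
    <= (size s)%:R * theta * \prod_(i <- s) B i.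
Proof.
move=> xB yB B1 xy.
have B0 i : 0 <= B i by apply: le_trans (B1 i).
elim: s => [|i s IH]; first by rewrite !big_nil subrr normr0 !mul0r.
have theta0 : 0 <= theta by apply: le_trans (xy i).
have PB1 : 1 <= \prod_(i <- s) B i.
  by elim/big_rec: _ => // j a _ a1; rewrite -[1]mulr1 ler_pM.
rewrite !big_cons.
have -> : x i * \prod_(j <- s) x j - y i * \prod_(j <- s) y j =
   y i * (\prod_(j <- s) x j - \prod_(j <- s) y j) +
   (x i - y i) * \prod_(j <- s) x j by ring.
apply: le_trans (ler_normD _ _) _; rewrite !normrM.
have Px : `|\prod_(j <- s) x j| <= \prod_(j <- s) B j.
  by rewrite normr_prod; apply: ler_prod => j _; rewrite normr_ge0 xB.
rewrite /= -natr1 !mulrDl mul1r; apply: lerD.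
  by rewrite [leRHS]mulrCA ler_pM.
rewrite ler_pM //; apply: le_trans Px _.
by rewrite -[leLHS]mul1r ler_pM // (le_trans _ PB1).
Qed.

End ProductDistance.

Section Complex.
Variable R : realType.
Local Notation C := R[i].

Lemma cvg_complex (u : C^nat) (l : C) :
  (fun k => complex.Re (u k)) @ \oo --> complex.Re l ->
  (fun k => complex.Im (u k)) @ \oo --> complex.Im l -> u @ \oo --> l.
Proof.
move=> ur ui; apply/cvgrPdist_lt => e e0.
have [d d0 de] : exists2 d : R, 0 < d & e = d%:C%C.
  exists (complex.Re e); last by rewrite RRe_real ?gtr0_real.
  by move: e0; rewrite ltcE => /andP[].
have d2 : 0 < d / 2 by rewrite divr_gt0.
have /cvgrPdist_lt/(_ _ d2) hr := ur; have /cvgrPdist_lt/(_ _ d2) hi := ui.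
near=> k.
have h1 : `|complex.Re l - complex.Re (u k)| < d / 2 by near: k.
have h2 : `|complex.Im l - complex.Im (u k)| < d / 2 by near: k.
rewrite de normc_def ltcR; case: (l) (u k) h1 h2 => a b [a' b'] /= h1 h2.
apply: (@le_lt_trans _ _ (`|a - a'| + `|b - b'|)); last first.
  by rewrite [ltRHS](splitr d) ltrD.
rewrite -[leRHS]ger0_norm ?addr_ge0 // -[leRHS]sqrtr_sqr ler_sqrt ?sqr_ge0 //.
rewrite [leRHS]sqrrD !real_normK ?num_real // lerD2r lerDl.
by rewrite mulrn_wge0 // mulr_ge0.
Unshelve. all: by end_near. Qed.

(** Entries of the inverse Vandermonde matrix at the nodes [j / (N + 1)]: they recover each
    coefficient of a polynomial of degree at most [N] from its values at these points of the
    disc. *)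
Lemma interpolation_coef N : exists (t : 'I_N.+1 -> C) (a : nat -> 'I_N.+1 -> C),
  (forall j, `|t j| < 1) /\
  forall k l, (k <= N)%N -> (l <= N)%N ->
    \sum_j a k j * t j ^+ l = (l == k)%:R.
Proof.
pose t (j : 'I_N.+1) : C := j%:R / N.+1%:R.
pose V := \matrix_(i < N.+1, j < N.+1) t j ^+ i.
have tinj : injective t.
  move=> i j /mulIf; rewrite invr_eq0 pnatr_eq0 => /(_ isT)/eqP.
  by rewrite eqr_nat => /eqP/val_inj.
have Vu : V \in unitmx.
  rewrite unitmxE unitfE.
  have -> : V = Vandermonde N.+1 (\row_j t j).
    by apply/matrixP => i j; rewrite !mxE.
  rewrite det_Vandermonde; apply/prodf_neq0 => i _; apply/prodf_neq0 => j ij.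
  rewrite !mxE subr_eq0; apply: contraTneq ij => /tinj ->.
  by rewrite ltnn.
exists t, (fun k j => (invmx V) j (inord k)); split.
  move=> j; rewrite normrM normfV !normr_nat ltr_pdivrMr ?ltr0Sn // mul1r.
  by rewrite ltr_nat.
move=> k l kN lN; have /matrixP/(_ (inord l) (inord k)) := mulmxV Vu.
rewrite !mxE -val_eqE /= !inordK ?ltnS // => <-.
by apply: eq_bigr => j _; rewrite !mxE inordK ?ltnS // mulrC.
Qed.

End Complex.

Section BinomialComplex.
Variables (R : realType) (lambda : R).
Hypothesis lambda0 : 0 < lambda.
Local Notation C := R[i].

Definition bcoef k : C := (binom_coef lambda k)%:C%C.

Lemma bcoef_gt0 k : 0 < bcoef k.
Proof. by rewrite ltcR binom_coef_gt0. Qed.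

Lemma bcoef_ge0 k : 0 <= bcoef k. Proof. exact: ltW (bcoef_gt0 k). Qed.

Lemma bcoef_neq0 k : bcoef k != 0. Proof. by rewrite gt_eqF ?bcoef_gt0. Qed.

Definition bseries K (x : C) := \sum_(k < K) bcoef k * x ^+ k.

Definition binomial_fun (x : C) : C := rpow (1 - x) (- lambda).

Lemma bseries_cvg x : `|x| < 1 -> (bseries ^~ x) @ \oo --> binomial_fun x.
Proof.
rewrite normc_def ltcE /= eqxx /= => x1.
have x1' : normc x < 1 by case: (x) x1.
apply: cvg_complex.
  rewrite (_ : (fun _ => _) =
    fun K => \sum_(k < K) binom_coef lambda k * complex.Re (x ^+ k)).
    exact: Re_binomial_series.
  apply/funext => K; rewrite /bseries.
  elim/big_rec2: _ => //= k a b _ <-; rewrite /bcoef.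
  by case: (x ^+ k) b => u v [a' b'] /=; rewrite mul0r subr0.
rewrite (_ : (fun _ => _) =
  fun K => \sum_(k < K) binom_coef lambda k * complex.Im (x ^+ k)).
  exact: Im_binomial_series.
apply/funext => K; rewrite /bseries.
elim/big_rec2: _ => //= k a b _ <-; rewrite /bcoef.
by case: (x ^+ k) b => u v [a' b'] /=; rewrite mul0r addr0.
Qed.

Lemma bseries_ge0 K x : 0 <= x -> 0 <= bseries K x.
Proof.
by move=> x0; apply: sumr_ge0 => k _; rewrite mulr_ge0 ?exprn_ge0 ?bcoef_ge0.
Qed.

Lemma bseries_le x : 0 <= x -> x < 1 -> exists M, forall K, bseries K x <= M.
Proof.
move=> x0; have [r xr] : exists r : R, x = r%:C%C.
  by exists (complex.Re x); rewrite RRe_real // ger0_real.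
rewrite xr -[1]/(1%:C%C) ltcR => r1.
have r0 : 0 <= r by rewrite -lecR -xr.
have nr : `|r| < 1 by rewrite ger0_norm.
have cv := pseries_bounded_cvg (binom_coef_bounded lambda0) nr.
have nd : nondecreasing_seq (pseries (binom_coef lambda) r).
  apply/nondecreasing_seqP => k; rewrite /pseries /series /= big_nat_recr //= lerDl.
  by rewrite mulr_ge0 ?exprn_ge0 ?(ltW (binom_coef_gt0 _ _)).
exists (limn (pseries (binom_coef lambda) r))%:C%C => K.
have -> : bseries K r%:C%C = (pseries (binom_coef lambda) r K)%:C%C.
  rewrite /pseries /series /= big_mkord rmorph_sum; apply: eq_bigr => k _.
  by rewrite rmorphM rmorphXn.
by rewrite lecR; apply: nondecreasing_cvgn_le.
Qed.

Lemma bseries_tail N : exists2 M, 0 <= M & forall x, `|x| <= 2^-1 ->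
  `|binomial_fun x - bseries N x| <= M * `|x| ^+ N.
Proof.
have h0 : 0 <= (2^-1 : C) by rewrite invr_ge0.
have h1 : (2^-1 : C) < 1 by rewrite invf_lt1 // ltr1n.
have [M HM] := bseries_le h0 h1.
have M0 : 0 <= M by apply: le_trans (HM 0%N); rewrite bseries_ge0.
(* [M] bounds the partial sums at 1/2, and |x|^(N + k) <= (2 |x|)^N 2^-(N + k) when |x| <= 1/2. *)
exists (M * 2 ^+ N); first by rewrite mulr_ge0 ?exprn_ge0.
move=> x x2; have x1 : `|x| < 1 by apply: le_lt_trans x2 h1.
have cv : (fun K => bseries K x - bseries N x) @ \oo -->
    binomial_fun x - bseries N x.
  by apply: cvgB; [exact: bseries_cvg | exact: cvg_cst].
apply: (cvg_norm_le cv); near=> K.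
have NK : (N <= K)%N by near: K; exists N.
rewrite /bseries -(subnKC NK) big_split_ord /= addrAC subrr add0r.
apply: le_trans (ler_norm_sum _ _ _) _.
apply: (@le_trans _ _ (2 ^+ N * `|x| ^+ N * bseries K 2^-1)); last first.
  rewrite [leLHS]mulrC [leLHS]mulrA.
  by rewrite ler_wpM2r ?exprn_ge0 // ler_wpM2r ?exprn_ge0.
rewrite /bseries -[in leRHS](subnKC NK) big_split_ord /= mulrDr.
apply: ler_wpDl.
  by rewrite mulr_ge0 ?bseries_ge0 // mulr_ge0 ?exprn_ge0.
rewrite mulr_sumr; apply: ler_sum => k _.
rewrite normrM normrX (gtr0_norm (bcoef_gt0 _)) mulrCA.
apply: ler_wpM2l; first exact: bcoef_ge0.
rewrite !exprD [leRHS]mulrACA -exprMn divff ?pnatr_eq0 // expr1n mul1r.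
by apply: ler_wpM2l; rewrite ?exprn_ge0 // lerXn2r // nnegrE.
Unshelve. all: by end_near. Qed.

End BinomialComplex.

(** * Monomials in the weighted Bergman space *)

Section TaylorFunctional.
Variables (R : realType) (N : nat).
Local Notation C := R[i].

Let interp_spec (ta : ('I_N.+1 -> C) * (nat -> 'I_N.+1 -> C)) :=
  (forall j, `|ta.1 j| < 1) /\
  forall k l, (k <= N)%N -> (l <= N)%N ->
    \sum_j ta.2 k j * ta.1 j ^+ l = (l == k)%:R.

Let interp_data : {ta | interp_spec ta}.
Proof.
by apply: cid; have [t [a h]] := interpolation_coef R N; exists (t, a).
Qed.

Definition interp_node : 'I_N.+1 -> C := (projT1 interp_data).1.
Definition interp_coef : nat -> 'I_N.+1 -> C := (projT1 interp_data).2.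

Let interpP : interp_spec (interp_node, interp_coef).
Proof. by rewrite /interp_node /interp_coef; case: interp_data => -[]. Qed.

Lemma interp_node_lt1 j : `|interp_node j| < 1.
Proof. by case: interpP. Qed.

Lemma interp_coefP k l : (k <= N)%N -> (l <= N)%N ->
  \sum_j interp_coef k j * interp_node j ^+ l = (l == k)%:R.
Proof. by case: interpP => _; apply. Qed.

(* For r -> 0 this tends to the k-th Taylor coefficient of phi at 0. *)
Definition taylor1 (r : C) k (phi : C -> C) : C :=
  \sum_j ((r ^+ k)^-1 * interp_coef k j) * phi (r * interp_node j).

Let A : C := \sum_(k < N.+1) \sum_j `|interp_coef k j|.

Let A_ge0 : 0 <= A.
Proof. by apply: sumr_ge0 => k _; apply: sumr_ge0. Qed.

Lemma taylor1_pow r k l c : r != 0 -> (k <= N)%N -> (l <= N)%N ->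
  taylor1 r k (fun x => c * x ^+ l) = c * (l == k)%:R.
Proof.
move=> r0 kN lN; rewrite /taylor1.
transitivity ((r ^+ k)^-1 * c * r ^+ l *
    \sum_j interp_coef k j * interp_node j ^+ l).
  by rewrite mulr_sumr; apply: eq_bigr => j _; rewrite exprMn; ring.
rewrite interp_coefP //; case: eqP => [->|_]; last by rewrite !mulr0.
by rewrite !mulr1 mulrAC mulVf ?expf_neq0 // mul1r.
Qed.

Lemma taylor1_bound r k phi S : 0 < r -> (k <= N)%N ->
  (forall j, `|phi (r * interp_node j)| <= S) ->
  `|taylor1 r k phi| <= (r ^+ k)^-1 * A * S.
Proof.
move=> r0 kN hS; apply: le_trans (ler_norm_sum _ _ _) _.
have S0 : 0 <= S by apply: le_trans (hS ord0).
apply: (@le_trans _ _ (\sum_j ((r ^+ k)^-1 * `|interp_coef k j|) * S)).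
  apply: ler_sum => j _; rewrite !normrM normfV normrX (gtr0_norm r0).
  by apply: ler_wpM2l => //; rewrite mulr_ge0 // invr_ge0 exprn_ge0 // ltW.
rewrite -mulr_suml -mulr_sumr; apply: ler_wpM2r => //.
apply: ler_wpM2l; first by rewrite invr_ge0 exprn_ge0 // ltW.
rewrite /A [leRHS](bigD1 (Ordinal (kN : (k < N.+1)%N))) //= lerDl.
by apply: sumr_ge0 => i _; apply: sumr_ge0.
Qed.

Lemma taylor1B r k phi psi :
  taylor1 r k (fun x => phi x - psi x) = taylor1 r k phi - taylor1 r k psi.
Proof. by rewrite /taylor1 -sumrB; apply: eq_bigr => j _; rewrite mulrBr. Qed.

Variable lambda : R.
Hypothesis lambda0 : 0 < lambda.
Local Notation b := (bcoef lambda).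
Local Notation F := (binomial_fun lambda).

Lemma taylor1_bseries r k y : r != 0 -> (k <= N)%N ->
  taylor1 r k (fun x => bseries lambda N.+1 (x * y)) = b k * y ^+ k.
Proof.
move=> r0 kN.
have -> : taylor1 r k (fun x => bseries lambda N.+1 (x * y)) =
    \sum_(l < N.+1) taylor1 r k (fun x => (b l * y ^+ l) * x ^+ l).
  rewrite /taylor1 exchange_big /=; apply: eq_bigr => j _.
  rewrite /bseries mulr_sumr; apply: eq_bigr => l _.
  by rewrite [(_ * y) ^+ l]exprMn; ring.
rewrite (bigD1 (Ordinal (kN : (k < N.+1)%N))) //= taylor1_pow // eqxx mulr1.
rewrite big1 ?addr0 // => l lk; rewrite taylor1_pow //; last by rewrite -ltnS.
by rewrite -val_eqE /= in lk; rewrite (negPf lk) mulr0.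
Qed.

(** [taylor1] is exact on the truncation at degree [N], and the tail is of order (r |y|)^(N + 1);
    division by [r ^+ k] with [k <= N] leaves at least one factor [r]. *)
Lemma taylor1_binomial : exists2 M, 0 <= M & forall r k y,
  0 < r -> r <= 2^-1 -> (k <= N)%N -> `|y| <= 1 ->
  `|taylor1 r k (fun x => F (x * y)) - b k * y ^+ k| <= M * r * `|y| ^+ N.+1.
Proof.
have [M M0 HM] := bseries_tail lambda0 N.+1.
exists (A * M); first exact: mulr_ge0.
move=> r k y r0 r2 kN y1; have rn0 : r != 0 by rewrite gt_eqF.
have r1 : r <= 1 by apply: le_trans r2 _; rewrite invf_le1 // ler1n.
rewrite -(taylor1_bseries y rn0 kN) -taylor1B.
have h j : `|F (r * interp_node j * y) - bseries lambda N.+1 (r * interp_node j * y)|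
    <= M * (r ^+ N.+1 * `|y| ^+ N.+1).
  have ry : `|r * interp_node j * y| <= r * `|y|.
    rewrite !normrM (gtr0_norm r0) -mulrA; apply: ler_wpM2l; first exact: ltW.
    by rewrite -[leRHS]mul1r; apply: ler_wpM2r => //; apply/ltW/interp_node_lt1.
  apply: le_trans (HM _ _) _.
    apply: le_trans ry _; apply: le_trans r2; rewrite -[leRHS]mulr1.
    by apply: ler_wpM2l => //; apply: ltW.
  by apply: ler_wpM2l => //; rewrite -exprMn lerXn2r // nnegrE mulr_ge0 // ltW.
apply: le_trans (taylor1_bound r0 kN h) _.
have -> : (r ^+ k)^-1 * A * (M * (r ^+ N.+1 * `|y| ^+ N.+1)) =
    A * M * `|y| ^+ N.+1 * ((r ^+ k)^-1 * r ^+ N.+1) by ring.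
rewrite [leRHS]mulrAC; apply: ler_wpM2l.
  by rewrite !mulr_ge0 ?exprn_ge0.
rewrite mulrC -expfB ?ltnS // subSn // exprS ler_piMr ?(ltW r0) //.
by rewrite exprn_ile1 // ltW.
Qed.

(** The previous bound at [y = w^*] with |w| <= r' carries r'^(N + 1), of which the outer [taylor1]
    uses up at most r'^N. The limit does not depend on how the two radii tend to 0. *)
Lemma taylor1_gram : exists2 M, 0 <= M & forall r r' k,
  0 < r -> r <= 2^-1 -> 0 < r' -> r' <= 2^-1 -> (k <= N)%N ->
  `|taylor1 r' k (fun w => (taylor1 r k (fun v => F (v * w^*)))^*) - b k|
    <= M * (r * r').
Proof.
have [M M0 HM] := taylor1_binomial.
exists (A * M); first exact: mulr_ge0.
move=> r r' k r0 r2 r0' r2' kN.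
have rn0' : r' != 0 by rewrite gt_eqF.
have r1' : r' <= 1 by apply: le_trans r2' _; rewrite invf_le1 // ler1n.
have -> : b k = taylor1 r' k (fun w => b k * w ^+ k).
  by rewrite taylor1_pow // eqxx mulr1.
rewrite -taylor1B.
have h j : `|(taylor1 r k (fun v => F (v * (r' * interp_node j)^*)))^*
     - b k * (r' * interp_node j) ^+ k| <= M * r * r' ^+ N.+1.
  have bk : b k = (b k)^* by rewrite conj_Creal // ger0_real // bcoef_ge0.
  rewrite -[X in _ - X]conjCK -rmorphB norm_conjC.
  have -> w : (b k * w ^+ k)^* = b k * w^* ^+ k.
    by rewrite rmorphM rmorphXn /= -bk.
  have le_r' : `|(r' * interp_node j)^*| <= r'.
    rewrite norm_conjC normrM (gtr0_norm r0') ler_piMr ?ltW //.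
    exact: interp_node_lt1.
  apply: le_trans (HM _ _ _ r0 r2 kN (le_trans le_r' r1')) _.
  apply: ler_wpM2l; first by rewrite mulr_ge0 // ltW.
  by rewrite lerXn2r // nnegrE // ltW.
apply: le_trans (taylor1_bound r0' kN h) _.
have -> : (r' ^+ k)^-1 * A * (M * r * r' ^+ N.+1) =
    A * M * r * ((r' ^+ k)^-1 * r' ^+ N.+1) by ring.
rewrite [leRHS]mulrA; apply: ler_wpM2l.
  by rewrite !mulr_ge0 // ltW.
rewrite mulrC -expfB ?ltnS // subSn // exprS ler_piMr ?(ltW r0') //.
by rewrite exprn_ile1 // ltW.
Qed.

End TaylorFunctional.

Section InnerProduct.
Variables (R : realType) (H : completeNormedModType R[i]).
Variable ip : {dot H for (@Num.conj R[i])}.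
Hypothesis ip_norm : forall f, `|f| ^+ 2 = ip f f.
Local Notation C := R[i].

Lemma ipC f g : ip g f = (ip f g)^*.
Proof. by rewrite hermC /= expr0 mul1r. Qed.

Lemma ipDl f g h : ip (f + g) h = ip f h + ip g h.
Proof. exact: linearDl. Qed.

Lemma ipZl a f h : ip (a *: f) h = a * ip f h.
Proof. by rewrite linearZl_LR. Qed.

Lemma ipBl f g h : ip (f - g) h = ip f h - ip g h.
Proof. exact: linearBl. Qed.

Lemma ipBr f g h : ip h (f - g) = ip h f - ip h g.
Proof. exact: linearBr. Qed.

Lemma ipZr a f h : ip h (a *: f) = a^* * ip h f.
Proof. by rewrite linearZr_LR. Qed.

Lemma ip_suml (I : Type) (s : seq I) (P : pred I) (f : I -> H) h :
  ip (\sum_(i <- s | P i) f i) h = \sum_(i <- s | P i) ip (f i) h.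
Proof.
by apply: (big_morph (fun f => ip f h)) => [x y|]; rewrite ?linear0l ?ipDl.
Qed.

Lemma ip_sumr (I : Type) (s : seq I) (P : pred I) (f : I -> H) h :
  ip h (\sum_(i <- s | P i) f i) = \sum_(i <- s | P i) ip h (f i).
Proof.
by apply: (big_morph (ip h)) => [x y|]; rewrite ?linear0r ?linearDr.
Qed.

Lemma ip0l h : ip 0 h = 0. Proof. exact: linear0l. Qed.

Lemma ip_CauchySchwarz f g : `|ip f g| <= `|f| * `|g|.
Proof.
have [->|g0] := eqVneq g 0; first by rewrite linear0r normr0 mulr_ge0.
have ng0 : 0 < `|g| ^+ 2 by rewrite exprn_gt0 // normr_gt0.
rewrite -(@ler_pXn2r _ 2) // ?nnegrE ?mulr_ge0 //.
pose a := ip f g / `|g| ^+ 2.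
have aE : a * ip g g = ip f g by rewrite -ip_norm divfK // gt_eqF.
have : 0 <= `|f - a *: g| ^+ 2 by rewrite exprn_ge0.
have -> : `|f - a *: g| ^+ 2 = ip f f - a * ip g f.
  rewrite ip_norm ipBl !ipBr !ipZl !ipZr ?ipBr ?ipZr -[ip f g in LHS]aE.
  by ring.
rewrite (ipC f g) /a -ip_norm mulrAC -normCK subr_ge0 ler_pdivrMr //.
by rewrite exprMn.
Qed.

Lemma ip_cvgl (u : nat -> H) (l g : H) :
  u @ \oo --> l -> (fun m => ip (u m) g) @ \oo --> ip l g.
Proof.
move=> ul; apply/cvgrPdist_lt => e e0.
have d0 : 0 < e / (1 + `|g|) by rewrite divr_gt0 // ltr_pwDl.
have /cvgrPdist_lt/(_ _ d0) h := ul; near=> m.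
have hm : `|l - u m| < e / (1 + `|g|) by near: m.
rewrite -ipBl; apply: le_lt_trans (ip_CauchySchwarz _ _) _.
apply: (@le_lt_trans _ _ (`|l - u m| * (1 + `|g|))).
  by apply: ler_wpM2l => //; rewrite lerDr.
by rewrite -ltr_pdivlMr // ltr_pwDl.
Unshelve. all: by end_near. Qed.

Lemma ip_cvg_unique (u : nat -> H) (l g : H) (v : C^nat) (c : C) :
  u @ \oo --> l -> (forall m, ip (u m) g = v m) -> v @ \oo --> c -> ip l g = c.
Proof.
move=> ul uv vc; have := ip_cvgl (g := g) ul.
rewrite (_ : (fun m => _) = v); last by apply/funext.
by move=> h; apply: cvg_unique h vc.
Qed.
End InnerProduct.

(** * Kernel functions and their finite combinations *)

Section Bergman.
Variables (R : realType) (n : nat) (lambda : R).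
Variables (H : completeNormedModType R[i]) (ip : {dot H for (@Num.conj R[i])}).
Variable ev : H -> 'rV[R[i]]_n -> R[i].
Hypotheses (lambda0 : 0 < lambda) (HB : is_bergman lambda ip ev).
Local Notation C := R[i].
Local Notation D := (polydisc R n).
Local Notation F := (binomial_fun lambda).
Local Notation b := (bcoef lambda).

Let ip_norm := bergman_norm HB.

Definition conj_rV (w : 'rV[C]_n) : 'rV[C]_n := map_mx Num.conj w.

Lemma conj_rVK w : conj_rV (conj_rV w) = w.
Proof. by apply/rowP => j; rewrite !mxE conjCK. Qed.

Lemma polydisc_conj w : D w -> D (conj_rV w).
Proof. by move=> Dw j; rewrite mxE norm_conjC. Qed.

(* The kernel function at conj w, so that kappa is holomorphic. *)
Definition kappa (w : 'rV[C]_n) : H :=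
  if pselect (D (conj_rV w)) is left Dw
  then projT1 (cid2 (bergman_reproducing HB Dw)) else 0.

Lemma ev_ip f z : D z -> ev f z = ip f (kappa (conj_rV z)).
Proof.
move=> Dz; rewrite /kappa; case: pselect => [Dw|].
  by case: cid2 => k _ /= hk; rewrite -hk conj_rVK.
by rewrite conj_rVK.
Qed.

Lemma kappa_ip f w : D w -> ip (kappa w) f = (ev f (conj_rV w))^*.
Proof.
move=> Dw; rewrite ev_ip ?conj_rVK; last exact: polydisc_conj.
by rewrite -ipC.
Qed.

Lemma ev_kappa z w : D z -> D w ->
  ev (kappa w) z = \prod_j F (z ord0 j * w ord0 j).
Proof.
move=> Dz Dw; rewrite /kappa; case: pselect => [Dw'|]; last first.
  by move=> nDw; case: nDw; apply: polydisc_conj.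
case: cid2 => k /= -> // _; apply: eq_bigr => j _.
by rewrite mxE conjCK.
Qed.

Lemma kappa_gram v w : D v -> D w ->
  ip (kappa v) (kappa w) = \prod_j F (v ord0 j * (w ord0 j)^*).
Proof.
move=> Dv Dw; rewrite -[w]conj_rVK -ev_ip; last exact: polydisc_conj.
rewrite ev_kappa //; last exact: polydisc_conj.
by apply: eq_bigr => j _; rewrite !mxE conjCK mulrC.
Qed.

Lemma bergman_ext f g : (forall z, D z -> ev f z = ev g z) -> f = g.
Proof.
move=> fg; apply/eqP; rewrite -subr_eq0; apply/eqP.
apply: (bergman_inj HB) => z Dz.
by rewrite ev_ip // ipBl -!ev_ip // fg // subrr.
Qed.

Lemma kappa_total f g : (forall w, D w -> ip (kappa w) f = ip (kappa w) g) -> f = g.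
Proof.
move=> fg; apply: bergman_ext => z Dz.
by rewrite !ev_ip // [ip f _]ipC [ip g _]ipC fg //; apply: polydisc_conj.
Qed.

Section Taylor.
Variable N : nat.
Local Notation t := (@interp_node R N).
Local Notation a := (@interp_coef R N).
Implicit Types (alpha : 'I_n -> nat) (r : C) (phi : 'rV[C]_n -> C).

Definition grid r (j : {ffun 'I_n -> 'I_N.+1}) : 'rV[C]_n := \row_i (r * t (j i)).

Definition grid_coef r alpha (j : {ffun 'I_n -> 'I_N.+1}) : C :=
  \prod_i ((r ^+ alpha i)^-1 * a (alpha i) (j i)).

Definition taylor r alpha phi : C := \sum_j grid_coef r alpha j * phi (grid r j).

(** Pairing with this vector is the functional [taylor r alpha] on the functions
    [w |-> ip (kappa w) f]. For exponents at most [N] it tends to a multiple of a monomial as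
    [r -> 0]. *)
Definition taylor_vec r alpha : H := \sum_j grid_coef r alpha j *: kappa (grid r j).

Lemma grid_polydisc r j : 0 < r -> r <= 2^-1 -> D (grid r j).
Proof.
move=> r0 r2 i; rewrite mxE normrM (gtr0_norm r0).
apply: (@le_lt_trans _ _ r).
  by rewrite ler_piMr // ltW // interp_node_lt1.
by apply: le_lt_trans r2 _; rewrite invf_lt1 // ltr1n.
Qed.

Lemma taylor_prod r alpha (phi : 'I_n -> C -> C) :
  taylor r alpha (fun w => \prod_i phi i (w ord0 i)) =
  \prod_i taylor1 N r (alpha i) (phi i).
Proof.
rewrite /taylor /taylor1 bigA_distr_bigA; apply: eq_bigr => j _.
rewrite /grid_coef -big_split /=; apply: eq_bigr => i _.
by rewrite mxE.
Qed.

Lemma eq_taylor r alpha phi psi : 0 < r -> r <= 2^-1 ->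
  (forall w, D w -> phi w = psi w) -> taylor r alpha phi = taylor r alpha psi.
Proof.
move=> r0 r2 e; apply: eq_bigr => j _; rewrite e //; exact: grid_polydisc.
Qed.

Lemma taylor_vec_ip r alpha f :
  ip (taylor_vec r alpha) f = taylor r alpha (fun w => ip (kappa w) f).
Proof. by rewrite ip_suml; apply: eq_bigr => j _; rewrite ipZl. Qed.

(** Kernel and grid are both products over the coordinates, so the Gram entry factors into the
    one-variable entries of [taylor1_gram]. *)
Lemma taylor_vec_gram : exists2 M, 0 <= M & forall r r' alpha,
  0 < r -> r <= 2^-1 -> 0 < r' -> r' <= 2^-1 -> (forall i, alpha i <= N)%N ->
  `|ip (taylor_vec r' alpha) (taylor_vec r alpha) - \prod_i b (alpha i)|
    <= M * (r * r').
Proof.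
have [M M0 HM] := taylor1_gram N lambda0.
(* Bounds the factors [b (alpha i)] as well as their approximations, and is at least 1 as
   [prod_distance] demands. *)
pose B := \sum_(k < N.+1) b k + M + 1.
have SB0 : 0 <= \sum_(k < N.+1) b k by apply: sumr_ge0 => k _; apply: bcoef_ge0.
have B1 : 1 <= B by rewrite lerDr addr_ge0.
exists (n%:R * M * B ^+ n); first by rewrite !mulr_ge0 ?exprn_ge0 ?addr_ge0.
move=> r r' alpha r0 r2 r0' r2' alphaN.
have -> : ip (taylor_vec r' alpha) (taylor_vec r alpha) = \prod_i
    taylor1 N r' (alpha i) (fun w => (taylor1 N r (alpha i) (fun v => F (v * w^*)))^*).
  rewrite taylor_vec_ip -(taylor_prod r' alpha (fun i w => (taylor1 N r (alpha i) (fun v => F (v * w^*)))^*)).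
  apply: eq_taylor => // w Dw.
  rewrite ipC taylor_vec_ip -rmorph_prod; congr (_^*).
  rewrite -(taylor_prod r alpha (fun i v => F (v * (w ord0 i)^*))).
  by apply: eq_taylor => // v Dv; rewrite kappa_gram.
have bB i : b (alpha i) <= \sum_(k < N.+1) b k.
  rewrite (bigD1 (Ordinal (alphaN i : (alpha i < N.+1)%N))) //= lerDl.
  by apply: sumr_ge0 => k _; apply: bcoef_ge0.
have h i := HM r r' (alpha i) r0 r2 r0' r2' (alphaN i).
have rr1 : r * r' <= 1.
  have h1 : (2^-1 : C) <= 1 by rewrite invf_le1 // ler1n.
  rewrite -[1]mulr1; apply: ler_pM; rewrite ?(ltW r0) ?(ltW r0') //.
    exact: le_trans h1.
  exact: le_trans h1.
have rr0 : 0 <= r * r' by rewrite mulr_ge0 ?(ltW r0) ?(ltW r0').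
have bB' i : `|b (alpha i)| <= B.
  rewrite ger0_norm ?bcoef_ge0 //; apply: le_trans (bB i) _.
  by rewrite /B -addrA lerDl addr_ge0.
apply: le_trans (prod_distance (B := fun=> B) (theta := M * (r * r')) _ _ _ _ _) _ => //.
  move=> i; rewrite -[X in `|X|](subrK (b (alpha i))).
  apply: le_trans (ler_normD _ _) _; rewrite /B [X in _ <= X + 1]addrC -addrA.
  apply: lerD; last first.
    rewrite ger0_norm ?bcoef_ge0 //; apply: le_trans (bB i) _.
    by rewrite lerDl.
  by apply: le_trans (h i) _; rewrite -[leRHS]mulr1 ler_wpM2l.
rewrite prodr_const -sum1_size sum1_card !card_ord.
by rewrite le_eqVlt; apply/orP; left; apply/eqP; ring.
Qed.

End Taylor.
End Bergman.

Lemma cvg_big_prod (K : numFieldType) (T : Type) (F : set_system T)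
    {FF : Filter F} (I : Type) (s : seq I) (P : pred I) (u : I -> T -> K) (l : I -> K) :
  (forall i, P i -> u i @ F --> l i) ->
  (fun m => \prod_(i <- s | P i) u i m) @ F --> \prod_(i <- s | P i) l i.
Proof.
move=> ul; elim: s => [|i s IH].
  rewrite big_nil (_ : (fun _ => _) = cst 1); first exact: cvg_cst.
  by apply/funext => m; rewrite big_nil.
rewrite big_cons (_ : (fun _ => _) = if P i then
    fun m => u i m * \prod_(j <- s | P j) u j m
    else fun m => \prod_(j <- s | P j) u j m).
  by have [Pi|//] := ifP; apply: cvgM => //; apply: ul.
by apply/funext => m; rewrite big_cons; case: ifP.
Qed.

Lemma cvg_big_sum (K : numFieldType) (V : normedModType K) (T : Type)
    (F : set_system T) {FF : Filter F} (I : Type) (s : seq I) (u : I -> T -> V)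
    (l : I -> V) :
  (forall i, u i @ F --> l i) ->
  (fun m => \sum_(i <- s) u i m) @ F --> \sum_(i <- s) l i.
Proof.
move=> ul; elim: s => [|i s IH].
  rewrite big_nil (_ : (fun _ => _) = cst 0); first exact: cvg_cst.
  by apply/funext => m; rewrite big_nil.
rewrite big_cons (_ : (fun _ => _) = fun m => u i m + \sum_(j <- s) u j m).
  exact: cvgD.
by apply/funext => m; rewrite big_cons.
Qed.

Section Radii.
Variable R : realType.

(** Radii tending to 0 and at most 1/2 from the start, where the tail estimate of the binomial
    series holds. *)
Definition rad (m : nat) : R[i] := m.+2%:R^-1.

Lemma rad_gt0 m : 0 < rad m. Proof. by rewrite invr_gt0. Qed.

Lemma rad_le2 m : rad m <= 2^-1.
Proof. by rewrite lef_pV2 ?posrE // ler_nat. Qed.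

Lemma rad_mono k m : (k <= m)%N -> rad m <= rad k.
Proof. by move=> km; rewrite lef_pV2 ?posrE // ler_nat !ltnS. Qed.

Lemma rad_small (e : R[i]) : 0 < e -> exists k, rad k < e.
Proof.
move=> e0; have [d d0 de] : exists2 d : R, 0 < d & e = d%:C%C.
  exists (complex.Re e); last by rewrite RRe_real ?gtr0_real.
  by move: e0; rewrite ltcE => /andP[].
exists (Num.bound d^-1); rewrite /rad invf_plt ?posrE // de -fmorphV.
have -> : (Num.bound d^-1).+2%:R = ((Num.bound d^-1).+2%:R)%:C%C :> R[i].
  by rewrite rmorph_nat.
rewrite ltcR; apply: lt_trans (archi_boundP _) _; first by rewrite invr_ge0 ltW.
by rewrite ltr_nat.
Qed.
End Radii.

(** * Monomials as limits of combinations of kernel functions *)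

Section Monomials.
Variables (R : realType) (n : nat) (lambda : R).
Variables (H : completeNormedModType R[i]) (ip : {dot H for (@Num.conj R[i])}).
Variable ev : H -> 'rV[R[i]]_n -> R[i].
Hypotheses (lambda0 : 0 < lambda) (HB : is_bergman lambda ip ev).
Local Notation C := R[i].
Local Notation D := (polydisc R n).
Local Notation F := (binomial_fun lambda).
Local Notation b := (bcoef lambda).
Local Notation kappa := (kappa HB).
Local Notation rad := (@rad R).
Local Notation tvec := (taylor_vec HB).
Implicit Types (alpha beta : 'I_n -> nat).

Let ip_norm := bergman_norm HB.

(** The squared distance of two of these vectors is an alternating sum of four Gram entries that are
    all close to the same number, which cancels. *)
Lemma taylor_vec_cauchy N alpha : (forall i, alpha i <= N)%N ->
  cvgn (fun m => tvec N (rad m) alpha).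
Proof.
move=> alphaN; apply: cauchy_cvg; apply: cauchy_exP => e e0.
have [M M0 HM] := taylor_vec_gram lambda0 HB N.
have d0 : 0 < e / (2 * (1 + M)) by rewrite divr_gt0 // mulr_gt0 // ltr_wpDr.
have [k ke] := rad_small d0.
exists (tvec N (rad k) alpha); exists k => // m /= km.
rewrite -ball_normE /ball_ /=.
have Mr p q : (k <= p)%N -> (k <= q)%N ->
    `|ip (tvec N (rad p) alpha) (tvec N (rad q) alpha) - \prod_i b (alpha i)|
      <= M * rad k ^+ 2.
  move=> kp kq; apply: le_trans (HM (rad q) (rad p) alpha _ _ _ _ _) _;
    rewrite ?rad_gt0 ?rad_le2 //.
  apply: ler_wpM2l => //; rewrite expr2.
  by apply: ler_pM; rewrite ?rad_mono // ltW // rad_gt0.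
(* Since [4 M <= (2 (1 + M)) ^+ 2], this constant replaces a square root of [M]. *)
apply: (@le_lt_trans _ _ (2 * (1 + M) * rad k)); last first.
  by rewrite mulrC -ltr_pdivlMr // mulr_gt0 // ltr_wpDr.
rewrite -(@ler_pXn2r _ 2) // ?nnegrE ?mulr_ge0 ?addr_ge0 ?(ltW (rad_gt0 _ _)) //.
rewrite ip_norm ipBl !ipBr.
set P := \prod_i _ in Mr.
set kk := ip _ _; set km' := ip _ _; set mk := ip _ _; set mm := ip _ _.
have nE : kk - km' - (mk - mm) = (kk - P) - (km' - P) - ((mk - P) - (mm - P)).
  by ring.
have n0 : 0 <= kk - km' - (mk - mm).
  by rewrite /kk /km' /mk /mm -!ipBr -ipBl -ip_norm exprn_ge0.
rewrite -[leLHS]ger0_norm // nE.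
apply: (@le_trans _ _ (4 * (M * rad k ^+ 2))).
  have -> : 4 * (M * rad k ^+ 2) = (M * rad k ^+ 2 + M * rad k ^+ 2) +
     (M * rad k ^+ 2 + M * rad k ^+ 2) by ring.
  apply: le_trans (ler_normB _ _) _; apply: lerD.
    by apply: le_trans (ler_normB _ _) _; apply: lerD; apply: Mr.
  by apply: le_trans (ler_normB _ _) _; apply: lerD; apply: Mr.
have -> : (2 * (1 + M) * rad k) ^+ 2 = 4 * ((1 + M + M + M ^+ 2) * rad k ^+ 2).
  by ring.
apply: ler_wpM2l => //; apply: ler_wpM2r.
  by rewrite exprn_ge0 // ltW // rad_gt0.
by rewrite addrAC lerDr !addr_ge0 ?exprn_ge0.
Qed.

Lemma taylor_vec_cvg N alpha : (forall i, alpha i <= N)%N ->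
  exists2 E, (fun m => tvec N (rad m) alpha) @ \oo --> E &
    forall w, D w -> ip (kappa w) E = \prod_i (b (alpha i) * w ord0 i ^+ alpha i).
Proof.
move=> alphaN; have /cvg_ex[E hE] := taylor_vec_cauchy alphaN.
exists E => // w Dw; rewrite ipC.
have -> : ip E (kappa w) = \prod_i (b (alpha i) * (w ord0 i)^* ^+ alpha i).
  have [M M0 HM] := taylor1_binomial N lambda0.
  apply: (ip_cvg_unique ip_norm hE (v := fun m =>
    \prod_i taylor1 N (rad m) (alpha i) (fun x => F (x * (w ord0 i)^*)))).
    move=> m; rewrite taylor_vec_ip.
    rewrite -(taylor_prod N (rad m) alpha (fun i x => F (x * (w ord0 i)^*))).
    apply: eq_taylor; rewrite ?rad_gt0 ?rad_le2 // => v Dv.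
    by rewrite kappa_gram.
  apply: cvg_big_prod => i _; apply/cvgrPdist_le => e e0.
  have d0 : 0 < e / (1 + M) by rewrite divr_gt0 // ltr_wpDr.
  have [k ke] := rad_small d0; exists k => // m /= km.
  have w1 : `|(w ord0 i)^*| <= 1 by rewrite norm_conjC ltW.
  rewrite distrC; apply: le_trans (HM _ _ _ (rad_gt0 _ _) (rad_le2 _ _) (alphaN i) w1) _.
  apply: (@le_trans _ _ (M * rad m)).
    by rewrite ler_piMr ?mulr_ge0 ?(ltW (rad_gt0 _ _)) // exprn_ile1.
  apply: (@le_trans _ _ ((1 + M) * rad k)).
    by apply: ler_pM => //; rewrite ?(ltW (rad_gt0 _ _)) ?rad_mono ?lerDr.
  by rewrite mulrC -ler_pdivlMr ?ltr_wpDr // ltW.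
rewrite rmorph_prod; apply: eq_bigr => i _.
rewrite rmorphM rmorphXn /= conjCK; congr (_ * _).
by rewrite conj_Creal // ger0_real // bcoef_ge0.
Qed.

Let monomial_ex alpha : exists E, forall w, D w ->
  ip (kappa w) E = \prod_i (b (alpha i) * w ord0 i ^+ alpha i).
Proof.
have alphaN i : (alpha i <= \sum_j alpha j)%N by rewrite (bigD1 i) //= leq_addr.
by have [E _ hE] := taylor_vec_cvg alphaN; exists E.
Qed.

(** The factors [b] make pairing with this vector the limit of the functionals [taylor]; its squared
    norm is then the same product of [b]. *)
Definition monomial_vec alpha : H := projT1 (cid (monomial_ex alpha)).

Lemma kappa_monomial alpha w : D w ->
  ip (kappa w) (monomial_vec alpha) = \prod_i (b (alpha i) * w ord0 i ^+ alpha i).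
Proof. by rewrite /monomial_vec; case: cid => E /= h; apply: h. Qed.

Lemma ev_monomial alpha z : D z ->
  ev (monomial_vec alpha) z = \prod_i (b (alpha i) * z ord0 i ^+ alpha i).
Proof.
move=> Dz; rewrite (ev_ip HB) // ipC kappa_monomial; last exact: polydisc_conj.
rewrite rmorph_prod; apply: eq_bigr => i _.
rewrite rmorphM rmorphXn /= mxE conjCK; congr (_ * _).
by rewrite conj_Creal // ger0_real // bcoef_ge0.
Qed.

Lemma taylor_monomial_cvg N alpha f : (forall i, alpha i <= N)%N ->
  (fun m => taylor N (rad m) alpha (fun w => ip (kappa w) f)) @ \oo -->
  ip (monomial_vec alpha) f.
Proof.
move=> alphaN; have [E Ecvg hE] := taylor_vec_cvg alphaN.
have <- : E = monomial_vec alpha.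
  apply: (@kappa_total _ _ _ _ _ _ HB) => w Dw.
  by rewrite hE // kappa_monomial.
rewrite (_ : (fun _ => _) = fun m => ip (tvec N (rad m) alpha) f).
  exact: ip_cvgl.
by apply/funext => m; rewrite taylor_vec_ip.
Qed.

Lemma monomial_orthogonal alpha beta :
  ip (monomial_vec alpha) (monomial_vec beta) =
  \prod_i (b (beta i) * (beta i == alpha i)%:R).
Proof.
(* A degree bound for both exponents, so that [taylor] is exact on the monomial of exponent
   [beta]. *)
pose N := (\sum_j alpha j + \sum_j beta j)%N.
have alphaN i : (alpha i <= N)%N by rewrite /N (bigD1 i) //= -!addnA leq_addr.
have betaN i : (beta i <= N)%N.
  by rewrite /N [X in (_ + X)%N](bigD1 i) //= addnCA leq_addr.
apply: cvg_unique (taylor_monomial_cvg (f := _) alphaN) _ => //.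
rewrite (_ : (fun _ => _) = cst (\prod_i (b (beta i) * (beta i == alpha i)%:R))).
  exact: cvg_cst.
apply/funext => m /=.
transitivity (@taylor R n N (rad m) alpha (fun w : 'rV[C]_n =>
    \prod_i (b (beta i) * w ord0 i ^+ beta i))).
  by apply: eq_taylor => [||w Dw]; rewrite ?rad_gt0 ?rad_le2 ?kappa_monomial.
rewrite (taylor_prod _ _ _ (fun i x => b (beta i) * x ^+ beta i)).
by apply: eq_bigr => i _; rewrite taylor1_pow // gt_eqF ?rad_gt0.
Qed.

Lemma taylor_perm N (r : C) alpha (s : 'S_n) (phi : 'rV[C]_n -> C) :
  taylor N r alpha (fun w => phi (perm_act s w)) =
  taylor N r (fun i => alpha ((s^-1)%g i)) phi.
Proof.
rewrite /taylor (reindex (fun j : {ffun 'I_n -> 'I_N.+1} => [ffun i => j (s i)])).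
  apply: eq_bigr => j _; congr (_ * phi _).
    rewrite /grid_coef [RHS](reindex_perm s) /=.
    by apply: eq_bigr => i _; rewrite ffunE permK.
  by apply/rowP => i; rewrite !mxE ffunE permKV.
exists (fun j : {ffun 'I_n -> 'I_N.+1} => [ffun i => j ((s^-1)%g i)]) => j _;
  by apply/ffunP => i; rewrite !ffunE ?permK ?permKV.
Qed.

(** Apply [taylor] in [w] to the hypothesis and let the radius tend to 0; permuting the grid points
    permutes the exponents. *)
Lemma monomial_perm (c : 'S_n -> C) (h : H) alpha :
  (forall w, D w ->
    ip (kappa w) h = \sum_(s : 'S_n) c s * ip (kappa (perm_act s w)) h) ->
  ip (monomial_vec alpha) h =
  \sum_(s : 'S_n) c s * ip (monomial_vec (fun i => alpha ((s^-1)%g i))) h.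
Proof.
move=> hE.
have alphaN i : (alpha i <= \sum_j alpha j)%N by rewrite (bigD1 i) //= leq_addr.
apply: cvg_unique (taylor_monomial_cvg (f := h) alphaN) _ => //.
rewrite (_ : (fun _ => _) = fun m => \sum_(s : 'S_n) c s *
    taylor (\sum_j alpha j) (rad m) (fun i => alpha ((s^-1)%g i))
      (fun w => ip (kappa w) h)).
  apply: cvg_big_sum => s; apply: cvgM; first exact: cvg_cst.
  by apply: taylor_monomial_cvg => i; apply: alphaN.
apply/funext => m.
transitivity (@taylor R n (\sum_j alpha j) (rad m) alpha (fun w : 'rV[C]_n =>
    \sum_(s : 'S_n) c s * ip (kappa (perm_act s w)) h)).
  by apply: eq_taylor; rewrite ?rad_gt0 ?rad_le2.
rewrite [LHS]/taylor /=; under eq_bigr do rewrite mulr_sumr.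
rewrite exchange_big /=; apply: eq_bigr => s _.
rewrite -taylor_perm /taylor mulr_sumr; apply: eq_bigr => j _.
by rewrite mulrCA.
Qed.

End Monomials.

(** * Differentiability of limits with uniform quadratic remainder *)

Lemma mx_norm_coord (K : numFieldType) n (h : 'rV[K]_n) j : `|h ord0 j| <= `|h|.
Proof.
rewrite -[leRHS]/(mx_norm h) mx_normE -[leLHS]nngE num_le.
exact: (le_bigmax _ (fun i : 'I_1 * 'I_n => `|h i.1 i.2|%:nng) (ord0, j)).
Qed.

Lemma mx_norm_le (K : numFieldType) n (h : 'rV[K]_n) (e : K) : 0 <= e ->
  (forall j, `|h ord0 j| <= e) -> `|h| <= e.
Proof.
move=> e0 he; have [/eqP h0|h0] := boolP (mx_norm h == 0).
  by rewrite -[`|h|]/(mx_norm h) h0.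
have [[i j] hE] := mx_norm_neq0 h0.
by rewrite -[`|h|]/(mx_norm h) hE ord1 /=; apply: he.
Qed.

Lemma mx_norm_lt (K : numFieldType) n (h : 'rV[K]_n) (e : K) : 0 < e ->
  (forall j, `|h ord0 j| < e) -> `|h| < e.
Proof.
move=> e0 he; have [/eqP h0|h0] := boolP (mx_norm h == 0).
  by rewrite -[`|h|]/(mx_norm h) h0.
have [[i j] hE] := mx_norm_neq0 h0.
by rewrite -[`|h|]/(mx_norm h) hE ord1 /=; apply: he.
Qed.

Lemma differentiable_linear_approx (K : numFieldType) (V W : normedModType K)
    (f : V -> W) (L : {linear V -> W}) (x : V) : continuous L ->
  (forall e : K, 0 < e -> exists2 delta : K, 0 < delta & forall h : V,
    `|h| < delta -> `|f (h + x) - f x - L h| <= e * `|h|) ->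
  differentiable f x.
Proof.
move=> Lcont fd.
have E : f \o shift x = cst (f x) + L +o_ 0 id.
  apply/eqaddoP => e e0; have [del d0 H] := fd e e0.
  apply/nbhs_ballP; exists del => // h; rewrite -ball_normE /= sub0r normrN => hd.
  by rewrite opprD addrA; exact: H.
by apply/diff_locallyP; rewrite (diff_unique Lcont E).
Qed.

Lemma differentiable_rV (K : numFieldType) n (V : normedModType K)
    (f : 'rV[K]_n -> V) (x : 'rV[K]_n) (d : 'I_n -> V) :
  (forall e : K, 0 < e -> exists2 delta : K, 0 < delta & forall h : 'rV[K]_n,
    `|h| < delta -> `|f (h + x) - f x - \sum_j h ord0 j *: d j| <= e * `|h|) ->
  differentiable f x.
Proof.
move=> fd.
pose L (h : 'rV[K]_n) := \sum_j h ord0 j *: d j.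
have Llin : linear L.
  move=> a u v; rewrite /L scaler_sumr -big_split /=; apply: eq_bigr => j _.
  by rewrite !mxE scalerDl scalerA.
pose LM := GRing.isLinear.Build _ _ _ _ _ Llin.
pose LL : {linear _ -> _} := HB.pack L LM.
have Lcont : continuous LL.
  move=> y; apply: differentiable_continuous; rewrite /= /L.
  have -> : (fun h : 'rV[K]_n => \sum_j h ord0 j *: d j) =
      \sum_j (fun h : 'rV[K]_n => h ord0 j *: d j).
    by apply/funext => h; rewrite fct_sumE.
  apply: differentiable_sum => j; apply: differentiableZl.
  exact: differentiable_coord.
exact: differentiable_linear_approx Lcont fd.
Qed.

Section MonomialRemainder.
Variables (K : numFieldType) (n : nat).

(** Increment and first-order Taylor remainder of the power [x ^+ m] at [rho]. They majorize those
    of a monomial of degree [m] in several variables with coordinates bounded by [rho] and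
    increments by [eta]. *)
Let incr (rho eta : K) m := (rho + eta) ^+ m - rho ^+ m.
Let remd (rho eta : K) m := (rho + eta) ^+ m - rho ^+ m - m%:R * eta * rho ^+ m.-1.

Let incrS rho eta m : incr rho eta m.+1 = rho * incr rho eta m + eta * (rho + eta) ^+ m.
Proof. by rewrite /incr !exprS; ring. Qed.

Let remdS rho eta m : remd rho eta m.+1 = rho * remd rho eta m + eta * incr rho eta m.
Proof.
rewrite /remd /incr -natr1 /=; case: m => [|m] /=; first by rewrite !expr1 !expr0; ring.
by rewrite !exprS; ring.
Qed.

Let incr_scale rho eta delta m : 0 <= rho -> 0 <= eta -> eta <= delta ->
  delta * incr rho eta m <= eta * incr rho delta m.
Proof.
move=> r0 e0 ed; have d0 := le_trans e0 ed.
elim: m => [|m IH]; first by rewrite /incr !expr0 subrr !mulr0.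
rewrite !incrS [leLHS]mulrDr [leRHS]mulrDr; apply: lerD.
  by rewrite mulrCA [leRHS]mulrCA; apply: ler_wpM2l.
rewrite !mulrA [eta * delta]mulrC; apply: ler_wpM2l; first exact: mulr_ge0.
by apply: lerXn2r; rewrite ?nnegrE ?addr_ge0 // lerD2l.
Qed.

(** As a polynomial in [eta], [remd] has nonnegative coefficients and is divisible by [eta ^+ 2], so
    the quotient is monotone. *)
Let remd_scale rho eta delta m : 0 <= rho -> 0 <= eta -> eta <= delta ->
  delta ^+ 2 * remd rho eta m <= eta ^+ 2 * remd rho delta m.
Proof.
move=> r0 e0 ed; have d0 := le_trans e0 ed.
elim: m => [|m IH]; first by rewrite /remd !expr0 subrr !mul0r subr0 !mulr0.
rewrite !remdS [leLHS]mulrDr [leRHS]mulrDr; apply: lerD.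
  by rewrite mulrCA [leRHS]mulrCA; apply: ler_wpM2l.
have -> : delta ^+ 2 * (eta * incr rho eta m) = delta * eta * (delta * incr rho eta m).
  by ring.
have -> : eta ^+ 2 * (delta * incr rho delta m) = delta * eta * (eta * incr rho delta m).
  by ring.
by apply: ler_wpM2l; [exact: mulr_ge0 | exact: incr_scale].
Qed.

(** A list with repetitions in place of exponents lets the estimates proceed one linear factor at a
    time. *)
Definition seq_monomial (s : seq 'I_n) (w : 'rV[K]_n) := \prod_(i <- s) w ord0 i.

Let seq_monomial_est (s : seq 'I_n) (w : 'rV[K]_n) : exists d : 'I_n -> K,
  forall (rho eta : K) (h : 'rV[K]_n), 0 <= rho -> 0 <= eta ->
  (forall j, `|w ord0 j| <= rho) -> (forall j, `|h ord0 j| <= eta) ->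
  [/\ `|seq_monomial s (h + w)| <= (rho + eta) ^+ size s,
      `|seq_monomial s (h + w) - seq_monomial s w| <= incr rho eta (size s)
    & `|seq_monomial s (h + w) - seq_monomial s w - \sum_j h ord0 j * d j|
        <= remd rho eta (size s)].
Proof.
elim: s => [|i s [d IH]].
  exists (fun=> 0) => rho eta h r0 e0 wr he.
  rewrite /seq_monomial !big_nil /= /incr /remd !expr0 subrr mul0r mul0r subr0.
  by rewrite big1 ?subr0 ?normr0 ?normr1 // => j _; rewrite mulr0.
exists (fun j => w ord0 i * d j + (j == i)%:R * seq_monomial s w).
move=> rho eta h r0 e0 wr he; have [h1 h2 h3] := IH rho eta h r0 e0 wr he.
rewrite {1 2 3 4 5}/seq_monomial !big_cons -!/(seq_monomial s _) mxE.
have hw : `|h ord0 i + w ord0 i| <= rho + eta.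
  by rewrite addrC; apply: le_trans (ler_normD _ _) (lerD (wr i) (he i)).
set f1 := seq_monomial s (h + w); set f0 := seq_monomial s w.
split.
- by rewrite /= exprS normrM ler_pM.
- rewrite [size _]/= incrS.
  have -> : (h ord0 i + w ord0 i) * f1 - w ord0 i * f0 =
     w ord0 i * (f1 - f0) + h ord0 i * f1 by ring.
  apply: le_trans (ler_normD _ _) _; rewrite !normrM.
  by apply: lerD; apply: ler_pM.
rewrite [size _]/= remdS.
have -> : \sum_j h ord0 j * (w ord0 i * d j + (j == i)%:R * f0) =
    w ord0 i * (\sum_j h ord0 j * d j) + h ord0 i * f0.
  under eq_bigr do rewrite mulrDr; rewrite big_split /= mulr_sumr; congr (_ + _).
    by apply: eq_bigr => j _; rewrite mulrCA.
  rewrite (bigD1 i) //= eqxx mul1r big1 ?addr0 // => j /negPf ->.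
  by rewrite mul0r mulr0.
have -> : (h ord0 i + w ord0 i) * f1 - w ord0 i * f0 -
    (w ord0 i * (\sum_j h ord0 j * d j) + h ord0 i * f0) =
    w ord0 i * (f1 - f0 - \sum_j h ord0 j * d j) + h ord0 i * (f1 - f0) by ring.
apply: le_trans (ler_normD _ _) _; rewrite !normrM.
by apply: lerD; apply: ler_pM.
Qed.

(** [remd_scale] isolates the dependence on [h] in one quadratic factor common to all monomials;
    what remains can be summed over the exponents. *)
Lemma monomial_remainder (alpha : 'I_n -> nat) (w : 'rV[K]_n) :
  exists d : 'I_n -> K, forall (rho delta : K) (h : 'rV[K]_n),
  0 <= rho -> 0 < delta -> (forall j, `|w ord0 j| <= rho) -> `|h| <= delta ->
  `|\prod_i (h + w) ord0 i ^+ alpha i - \prod_i w ord0 i ^+ alpha i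
     - \sum_j h ord0 j * d j|
   <= (`|h| / delta) ^+ 2 * \prod_i (rho + delta) ^+ alpha i.
Proof.
pose s := flatten [seq nseq (alpha i) i | i <- index_enum 'I_n].
have sE (v : 'rV[K]_n) : \prod_i v ord0 i ^+ alpha i = seq_monomial s v.
  rewrite /seq_monomial big_flatten big_map; apply: eq_bigr => i _.
  by rewrite big_nseq iter_mulr_1.
have ss : size s = (\sum_i alpha i)%N.
  rewrite size_flatten /shape -map_comp sumnE big_map; apply: eq_bigr => i _.
  by rewrite /= size_nseq.
have [d hd] := seq_monomial_est s w.
exists d => rho delta h r0 d0 wr hle; rewrite !sE.
have [_ _] := hd rho `|h| h r0 (normr_ge0 _) wr (mx_norm_coord h).
move=> /le_trans; apply.
rewrite expr_div_n mulrAC ler_pdivlMr ?exprn_gt0 // mulrC.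
apply: le_trans (remd_scale _ r0 (normr_ge0 _) hle) _.
apply: ler_wpM2l; first by rewrite exprn_ge0.
rewrite ss /remd -prodrXr -addrA gerDl -opprD oppr_le0.
by rewrite addr_ge0 ?exprn_ge0 // !mulr_ge0 ?exprn_ge0 // ltW.
Qed.
End MonomialRemainder.

Section DifferentiableLimit.
Variables (K : numFieldType) (n : nat) (V : completeNormedModType K).
Variables (fs : nat -> 'rV[K]_n -> V) (f : 'rV[K]_n -> V) (x : 'rV[K]_n).
Variables (delta B : K) (ds : nat -> 'I_n -> V).
Hypotheses (delta0 : 0 < delta) (B0 : 0 <= B).
Hypothesis fs_cvg : forall h, `|h| <= delta -> (fun k => fs k (h + x)) @ \oo --> f (h + x).
Hypothesis fs_rem : forall k h, `|h| <= delta ->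
  `|fs k (h + x) - fs k x - \sum_j h ord0 j *: ds k j| <= (`|h| / delta) ^+ 2 * B.

Let small_radius (e : K) : 0 < e -> exists2 s, 0 < s <= delta &
  forall t, 0 <= t -> t <= s -> (t / delta) ^+ 2 * B <= e * t.
Proof.
move=> e0; have ed0 : 0 < e * delta by rewrite mulr_gt0.
have Bed0 : 0 < B + e * delta by rewrite ltr_wpDl.
(* For [t <= delta * y], [t * B] is at most [e * delta ^+ 2]; the summand [e * delta] in the
   denominator keeps [y] at most 1 and covers [B = 0]. *)
pose y := e * delta / (B + e * delta).
have y0 : 0 < y by rewrite divr_gt0.
exists (delta * y).
  rewrite mulr_gt0 //= ler_piMr ?(ltW delta0) //.
  by rewrite ler_pdivrMr // mul1r lerDr.
move=> t t0 ty; rewrite expr_div_n mulrAC ler_pdivrMr ?exprn_gt0 //.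
have tB : t * B <= e * delta ^+ 2.
  apply: (@le_trans _ _ (delta * y * B)); first by apply: ler_wpM2r.
  have -> : delta * y * B = e * delta ^+ 2 * (B / (B + e * delta)) by rewrite /y; ring.
  rewrite ler_piMr ?mulr_ge0 ?exprn_ge0 ?(ltW e0) ?(ltW delta0) //.
  by rewrite ler_pdivrMr // mul1r lerDl ltW.
have -> : t ^+ 2 * B = t * (t * B) by ring.
have -> : e * t * delta ^+ 2 = t * (e * delta ^+ 2) by ring.
exact: ler_wpM2l.
Qed.

Let delta_basis j (t : K) : 0 < t -> `|t *: delta_mx 0 j : 'rV[K]_n| <= t.
Proof.
move=> t0; apply: mx_norm_le => [|i]; first exact: ltW.
rewrite !mxE eqxx /=; case: eqP => _; last by rewrite mulr0 normr0 ltW.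
by rewrite mulr1 gtr0_norm.
Qed.

Let difference_split (a b c d e : V) : a - (b - c) = (c - d) - (b - e) - (e - d - a).
Proof.
have -> : c - d - (b - e) = (c - b) + (e - d).
  by rewrite opprB addrACA [- d - b]addrC addrACA.
by rewrite -addrA subKr addrC opprB.
Qed.

Let subrBB (a b c : V) : a - c - (b - c) = a - b.
Proof. by rewrite opprB addrA subrK. Qed.

(** For a fixed small step along a basis vector the difference quotients converge, and by the
    uniform remainder the derivatives stay close to them; so the derivatives form Cauchy sequences.
    The remainder bound then passes to the limit. *)
Lemma differentiable_limit : differentiable f x.
Proof.
have x_cvg : (fun k => fs k x) @ \oo --> f x.
  have := @fs_cvg 0; rewrite normr0 add0r; apply; exact: ltW.
have ds_cvg j : cvgn (fun k => ds k j).
  apply: cauchy_cvg; apply: cauchy_exP => e e0.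
  (* Each derivative is within [3 e / 8] of one difference quotient of [f], hence two of them are
     within [6 e / 8 < e]. *)
  have e4 : 0 < e / 8 by rewrite divr_gt0.
  have [t /andP[t0 td] tB] := small_radius e4.
  pose h : 'rV[K]_n := t *: delta_mx 0 j.
  have ht : `|h| <= t by exact: delta_basis.
  have hE k : \sum_i h ord0 i *: ds k i = t *: ds k j.
    rewrite (bigD1 j) //= big1 ?addr0 => [|i ij].
      by rewrite !mxE eqxx /= mulr1.
    by rewrite !mxE (negPf ij) andbF mulr0 scale0r.
  have te8 : 0 < e / 8 * t by rewrite mulr_gt0.
  have hd : `|h| <= delta by apply: le_trans td.
  have /cvgrPdist_le/(_ _ te8) [k1 _ H1] := fs_cvg hd.
  have /cvgrPdist_le/(_ _ te8) [k2 _ H2] := x_cvg.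
  pose k0 := maxn k1 k2.
  have est k : (k0 <= k)%N -> `|t *: ds k j - (f (h + x) - f x)| <= 3 * (e / 8 * t).
    rewrite geq_max => /andP[k1k k2k].
    rewrite (difference_split _ _ _ (fs k x) (fs k (h + x))).
    have -> : 3 * (e / 8 * t) = e / 8 * t + e / 8 * t + e / 8 * t by ring.
    apply: le_trans (ler_normB _ _) _; apply: lerD.
      apply: le_trans (ler_normB _ _) _; apply: lerD; first exact: H2.
      exact: H1.
    rewrite -hE; apply: le_trans (fs_rem k hd) _; apply: le_trans (tB _ _ ht) _ => //.
    by apply: ler_wpM2l => //; apply: ltW.
  exists (ds k0 j); exists k0 => // k /= k0k; rewrite -ball_normE /=.
  have : `|t *: (ds k0 j - ds k j)| <= 6 * (e / 8 * t).
    have -> : t *: (ds k0 j - ds k j) = (t *: ds k0 j - (f (h + x) - f x)) -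
      (t *: ds k j - (f (h + x) - f x)) by rewrite scalerBr subrBB.
    have -> : 6 * (e / 8 * t) = 3 * (e / 8 * t) + 3 * (e / 8 * t) by ring.
    apply: le_trans (ler_normB _ _) _; apply: lerD; exact: est.
  rewrite normrZ (gtr0_norm t0) mulrC -ler_pdivlMr // => /le_lt_trans; apply.
  rewrite mulrA mulfK ?gt_eqF // mulrCA -[ltRHS]mulr1 ltr_pM2l //.
  by rewrite ltr_pdivrMr // mul1r ltr_nat.
pose d j := lim (ds ^~ j @ \oo).
have rem h : `|h| <= delta ->
    `|f (h + x) - f x - \sum_j h ord0 j *: d j| <= (`|h| / delta) ^+ 2 * B.
  move=> hd; apply: (@cvg_norm_le _ _ _ \oo _ (fun k =>
    fs k (h + x) - fs k x - \sum_j h ord0 j *: ds k j)).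
    apply: cvgB; first by apply: cvgB => //; exact: fs_cvg.
    apply: cvg_big_sum => j; apply: cvgZ; first exact: cvg_cst.
    exact: ds_cvg.
  by near=> k; exact: fs_rem.
apply: (differentiable_rV (d := d)) => e e0.
have [s /andP[s0 sd] sB] := small_radius e0.
exists s => // h hs; apply: le_trans (rem h _) _.
  by apply: le_trans sd; apply: ltW.
by apply: sB => //; apply: ltW.
Unshelve. all: by end_near. Qed.
End DifferentiableLimit.

(** * Expansion of the kernel functions in monomials *)

Section KappaExpansion.
Variables (R : realType) (n : nat) (lambda : R).
Variables (H : completeNormedModType R[i]) (ip : {dot H for (@Num.conj R[i])}).
Variable ev : H -> 'rV[R[i]]_n -> R[i].
Hypotheses (lambda0 : 0 < lambda) (HB : is_bergman lambda ip ev).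
Local Notation C := R[i].
Local Notation D := (polydisc R n).
Local Notation F := (binomial_fun lambda).
Local Notation b := (bcoef lambda).
Local Notation kappa := (kappa HB).
Local Notation mvec := (monomial_vec lambda0 HB).

Let ip_norm := bergman_norm HB.

Lemma box_norm K (c : {ffun 'I_n -> 'I_K} -> C) :
  `|\sum_alpha c alpha *: mvec (fun i => alpha i)| ^+ 2 =
  \sum_alpha `|c alpha| ^+ 2 * \prod_i b (alpha i).
Proof.
rewrite ip_norm ip_suml; apply: eq_bigr => alpha _.
rewrite ip_sumr (bigD1 alpha) //= big1 ?addr0 => [|beta ba].
  rewrite ipZl ipZr mulrA -normCK monomial_orthogonal; congr (_ * _).
  by apply: eq_bigr => i _; rewrite eqxx mulr1.
rewrite ipZl ipZr monomial_orthogonal.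
have /existsP[i ni] : [exists i, beta i != alpha i].
  apply: contraNT ba; rewrite negb_exists => /forallP h.
  by apply/eqP/ffunP => i; apply/eqP; have := h i; rewrite negbK.
rewrite (bigD1 i) //= [(nat_of_ord _ == _)](negPf _); last by rewrite val_eqE.
by rewrite mulr0 mul0r !mulr0.
Qed.

(** A partial sum of the power series of [kappa w]; its binomial coefficients are contained in
    [mvec]. *)
Definition kappa_box K (w : 'rV[C]_n) : H :=
  \sum_(alpha : {ffun 'I_n -> 'I_K})
    (\prod_i w ord0 i ^+ alpha i) *: mvec (fun i => alpha i).

Lemma kappa_box_ip K w : D w ->
  ip (kappa_box K w) (kappa w) = \prod_i bseries lambda K (w ord0 i * (w ord0 i)^*).
Proof.
move=> Dw; rewrite ip_suml /bseries bigA_distr_bigA; apply: eq_bigr => alpha _.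
rewrite ipZl ipC kappa_monomial // rmorph_prod -big_split; apply: eq_bigr => i _ /=.
rewrite rmorphM rmorphXn /= [X in _ * (X * _)]conj_Creal ?ger0_real ?bcoef_ge0 //.
by rewrite mulrCA -exprMn.
Qed.

Lemma kappa_box_norm K w :
  ip (kappa_box K w) (kappa_box K w) =
  \prod_i bseries lambda K (w ord0 i * (w ord0 i)^*).
Proof.
rewrite -ip_norm box_norm /bseries bigA_distr_bigA; apply: eq_bigr => alpha _.
rewrite normCK rmorph_prod -big_split -big_split; apply: eq_bigr => i _ /=.
by rewrite rmorphXn /= -exprMn mulrC.
Qed.

(** The partial sum has the same inner product with itself and with [kappa w], so the squared error
    is the difference of squared norms, a truncation error of binomial series at |w_i|^2. *)
Lemma kappa_cvg w : D w -> (fun K => kappa_box K w) @ \oo --> kappa w.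
Proof.
move=> Dw; apply/cvgrPdist_lt => e e0.
have Q_cvg : (fun K => \prod_i bseries lambda K (w ord0 i * (w ord0 i)^*)) @ \oo
    --> \prod_i F (w ord0 i * (w ord0 i)^*).
  apply: cvg_big_prod => i _; apply: bseries_cvg => //.
  by rewrite normrM norm_conjC -[1]mulr1 ltr_pM // Dw.
have e20 : 0 < e ^+ 2 by rewrite exprn_gt0.
have /cvgrPdist_lt/(_ _ e20) [k _ hk] := Q_cvg.
exists k => // K /= kK; have := hk K kK; rewrite -(kappa_gram HB) //.
have -> : ip (kappa w) (kappa w) - \prod_i bseries lambda K (w ord0 i * (w ord0 i)^*)
    = `|kappa w - kappa_box K w| ^+ 2.
  rewrite ip_norm ipBl !ipBr kappa_box_ip // kappa_box_norm.
  rewrite [ip (kappa w) (kappa_box K w)]ipC kappa_box_ip //.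
  have -> : (\prod_i bseries lambda K (w ord0 i * (w ord0 i)^*))^* =
     \prod_i bseries lambda K (w ord0 i * (w ord0 i)^*).
    by rewrite -(kappa_box_norm K w) -ipC.
  by rewrite subrr subr0.
rewrite ger0_norm ?exprn_ge0 // => h.
by rewrite -(@ltr_pXn2r _ 2) ?nnegrE ?(ltW e0).
Qed.

Lemma monomial_total f g :
  (forall alpha, ip (mvec alpha) f = ip (mvec alpha) g) -> f = g.
Proof.
move=> fg; apply: (@kappa_total _ _ _ _ _ _ HB) => w Dw.
apply: (ip_cvg_unique ip_norm (kappa_cvg Dw) (v := fun K => ip (kappa_box K w) g)).
  by move=> K; rewrite !ip_suml; apply: eq_bigr => alpha _; rewrite !ipZl fg.
by apply: ip_cvgl => //; exact: kappa_cvg.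
Qed.

(** The partial sums have a quadratic remainder uniform in [K]: by orthogonality its squared norm is
    at most [S ^+ 2] times a product of partial binomial sums at [(rho + delta) ^+ 2 < 1]. The base
    [1 + M], being at least 1, makes the bound on the squared norm at most its own square, which
    avoids square roots. *)
Lemma kappa_differentiable w : D w -> differentiable kappa w.
Proof.
move=> Dw.
have w1 : `|w| < 1 by apply: mx_norm_lt.
pose rho : C := `|w|; pose delta : C := (1 - rho) / 2.
have rho0 : 0 <= rho by rewrite /rho.
have delta0 : 0 < delta by rewrite divr_gt0 // subr_gt0.
have rd : rho + delta = (1 + rho) / 2 by rewrite /delta; field.
have rd0 : 0 <= rho + delta by rewrite addr_ge0 // ltW.
have rd1 : rho + delta < 1.
  by rewrite rd ltr_pdivrMr // mul1r [ltRHS]mulr2n ltrD2l.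
have [M hM] := bseries_le lambda0 (exprn_ge0 2 rd0) (exprn_ilt1 _ rd0 rd1).
have M0 : 0 <= M by apply: le_trans (hM 0%N); rewrite bseries_ge0 ?exprn_ge0.
pose d (alpha : 'I_n -> nat) := projT1 (cid (monomial_remainder alpha w)).
pose ds K j := \sum_(alpha : {ffun 'I_n -> 'I_K})
  d (fun i => alpha i) j *: mvec (fun i => alpha i).
have wrho j : `|w ord0 j| <= rho by exact: mx_norm_coord.
apply: (differentiable_limit (fs := kappa_box) (delta := delta)
  (B := (1 + M) ^+ n) (ds := ds)) => //.
- by rewrite exprn_ge0 ?addr_ge0.
- move=> h hd; apply: kappa_cvg => j; rewrite mxE.
  apply: le_lt_trans (ler_normD _ _) _; apply: le_lt_trans rd1.
  by rewrite addrC lerD // (le_trans (mx_norm_coord _ _)).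
move=> K h hd.
pose r (alpha : {ffun 'I_n -> 'I_K}) : C :=
  \prod_i (h + w) ord0 i ^+ alpha i - \prod_i w ord0 i ^+ alpha i
     - \sum_j h ord0 j * d (fun i => alpha i) j.
have -> : kappa_box K (h + w) - kappa_box K w - \sum_j h ord0 j *: ds K j =
    \sum_alpha r alpha *: mvec (fun i => alpha i).
  rewrite /kappa_box /ds.
  under [X in _ - X]eq_bigr do rewrite scaler_sumr.
  rewrite exchange_big /= -!sumrB; apply: eq_bigr => alpha _.
  rewrite /r !scalerBl scaler_suml; congr (_ - _).
  by apply: eq_bigr => j _; rewrite scalerA.
set S := (`|h| / delta) ^+ 2.
have S0 : 0 <= S by rewrite exprn_ge0 // divr_ge0 // ltW.
have M1 : 1 <= 1 + M by rewrite lerDl.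
rewrite -(@ler_pXn2r _ 2) // ?nnegrE ?mulr_ge0 ?exprn_ge0 ?addr_ge0 ?invr_ge0 ?(ltW delta0) //.
rewrite box_norm exprMn.
apply: (@le_trans _ _ (S ^+ 2 * \prod_(i < n) bseries lambda K ((rho + delta) ^+ 2))).
  rewrite /bseries bigA_distr_bigA mulr_sumr; apply: ler_sum => alpha _.
  have rS : `|r alpha| <= S * \prod_i (rho + delta) ^+ alpha i.
    rewrite /r /d; case: cid => dd /= hdd; exact: hdd.
  rewrite big_split /= mulrCA mulrC.
  apply: ler_wpM2l; first by apply: prodr_ge0 => i _; apply: bcoef_ge0.
  have -> : \prod_i (rho + delta) ^+ 2 ^+ alpha i =
      (\prod_i (rho + delta) ^+ alpha i) ^+ 2.
    by rewrite -prodrXl; apply: eq_bigr => i _; rewrite exprAC.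
  rewrite -exprMn lerXn2r // nnegrE mulr_ge0 //.
  by apply: prodr_ge0 => i _; apply: exprn_ge0.
apply: ler_wpM2l; first exact: exprn_ge0.
apply: (@le_trans _ _ ((1 + M) ^+ n)).
  have -> : (1 + M) ^+ n = \prod_(i < n) (1 + M) by rewrite prodr_const card_ord.
  apply: ler_prod => i _.
  rewrite bseries_ge0 ?exprn_ge0 //=; apply: le_trans (hM K) _.
  by rewrite lerDr.
by rewrite expr2 ler_peMr ?exprn_ge0 ?addr_ge0 // exprn_ege1.
Qed.

End KappaExpansion.

(** * Local parametrization of the roots *)

(** The order of a [numFieldType] need not be total, so the inverse of 1 plus the sum of the
    inverses replaces a minimum. *)
Lemma finite_pos_lower_bound (K : numFieldType) (T : finType) (f : T -> K) :
  (forall t, 0 < f t) -> exists2 d, 0 < d & forall t, d <= f t.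
Proof.
move=> f0; have S0 : 0 < 1 + \sum_t (f t)^-1.
  by rewrite ltr_pwDl // sumr_ge0 // => t _; rewrite invr_ge0 ltW.
exists (1 + \sum_t (f t)^-1)^-1; first by rewrite invr_gt0.
move=> t; rewrite -[leRHS]invrK lef_pV2 ?posrE ?invr_gt0 //.
rewrite (bigD1 t) //= addrCA lerDl addr_ge0 // sumr_ge0 // => i _.
by rewrite invr_ge0 ltW.
Qed.

Section LocalRoots.
Variables (R : realType) (n : nat).
Local Notation C := R[i].
Local Notation esym := (@elem_sym R n).

Lemma elem_symE (z : 'rV[C]_n) : esym z = esym_row (z ord0).
Proof. by []. Qed.

Lemma elem_sym_surj (v : 'rV[C]_n) : exists z, esym z = v.
Proof.
have [x xv] := esym_row_surj v; exists (\row_i x i).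
rewrite elem_symE -xv; congr esym_row.
by apply/funext => i; rewrite mxE.
Qed.

Lemma elem_sym_perm (s : 'S_n) (z : 'rV[C]_n) : esym (perm_act s z) = esym z.
Proof.
rewrite !elem_symE -(esym_row_perm (z ord0) s^-1%g); congr esym_row.
by apply/funext => i; rewrite mxE.
Qed.

Lemma elem_sym_eq (z z' : 'rV[C]_n) : injective (z ord0) -> esym z = esym z' ->
  exists s : 'S_n, z' = perm_act s z.
Proof.
move=> zi; rewrite !elem_symE => /(esym_row_eq zi)[s hs]; exists s.
by apply/rowP => i; rewrite mxE -hs permKV.
Qed.

Lemma horner_vieta_esym (z : 'rV[C]_n) x :
  (vieta_poly (esym z)).[x] = \prod_i (x - z ord0 i).
Proof.
rewrite elem_symE vieta_poly_esym horner_prod.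
by apply: eq_bigr => i _; rewrite hornerXsubC.
Qed.

(** The absolute value at [x] is the product of the distances to the [n] roots; if it is below
    [d ^+ n], some distance is below [d]. *)
Lemma near_root (v : 'rV[C]_n) (x d : C) : 0 < d ->
  `|(vieta_poly v).[x]| < d ^+ n -> exists2 y, root (vieta_poly v) y & `|y - x| < d.
Proof.
move=> d0; have [z <-] := elem_sym_surj v; rewrite horner_vieta_esym => h.
have /existsP[i hi] : [exists i, `|x - z ord0 i| < d].
  apply: contraLR h => hn; rewrite -real_leNgt ?normr_real ?rpredX ?gtr0_real //.
  rewrite normr_prod -[n in _ ^+ n]card_ord -prodr_const; apply: ler_prod => i _.
  rewrite (ltW d0) real_leNgt ?normr_real ?gtr0_real //.
  by apply: contra hn => hi; apply/existsP; exists i.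
exists (z ord0 i); last by rewrite distrC.
by rewrite rootE horner_vieta_esym (bigD1 i) //= subrr mul0r.
Qed.

Lemma horner_vieta_affine (v h : 'rV[C]_n) x :
  (vieta_poly (h + v)).[x] = (vieta_poly v).[x] +
    \sum_(k < n) h ord0 k * ((-1) ^+ k.+1 * x ^+ (n - k.+1)).
Proof.
rewrite /vieta_poly !hornerD -addrA; congr (_ + _).
rewrite !horner_sum -big_split; apply: eq_bigr => k _ /=.
by rewrite !hornerZ hornerXn !mxE; ring.
Qed.

Lemma horner_vieta_continuous x :
  continuous (fun v : 'rV[C]_n => (vieta_poly v).[x]).
Proof.
move=> v; apply: differentiable_continuous.
apply: (@differentiable_rV _ _ _ _ _ (fun k : 'I_n => (-1) ^+ k.+1 * x ^+ (n - k.+1))).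
move=> e e0; exists 1 => // h _.
rewrite horner_vieta_affine [(vieta_poly v).[x] + _]addrC addrK subrr normr0.
by rewrite mulr_ge0 // ltW.
Qed.

Lemma near_small_horner (w : 'rV[C]_n) x d : 0 < d -> (vieta_poly w).[x] = 0 ->
  \forall v \near w, `|(vieta_poly v).[x]| < d ^+ n.
Proof.
move=> d0 wx; have dn : 0 < d ^+ n by rewrite exprn_gt0.
have /(_ w)/cvgrPdist_lt/(_ _ dn) := @horner_vieta_continuous x.
by apply: filterS => v; rewrite wx sub0r normrN.
Qed.

(** The implicit function theorem for simple roots, by hand: existence and continuity come from
    [near_root], differentiability from the affine dependence of the polynomial on [v]. *)
Lemma local_roots (a : 'rV[C]_n) (r : C) : injective (a ord0) -> 0 < r ->
  exists (U : set 'rV[C]_n) (z : 'rV[C]_n -> 'rV[C]_n),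
  [/\ open U, U (esym a), forall v, U v -> esym (z v) = v,
      forall v, U v -> injective (z v ord0) /\ (forall i, `|z v ord0 i - a ord0 i| < r)
    & forall v, U v -> differentiable z v].
Proof.
move=> ai r0.
have [d d0 [dr dsep]] : exists2 d : C, 0 < d & d <= r /\
    forall i j, i != j -> 2 * d <= `|a ord0 i - a ord0 j|.
  (* One finite family collects all constraints on [d]: [None] stands for the bound [r], a pair for
     half the distance of two roots. *)
  pose f (p : option ('I_n * 'I_n)) : C := if p is Some p then
    if p.1 == p.2 then 1 else `|a ord0 p.1 - a ord0 p.2| / 2 else r.
  have f0 p : 0 < f p.
    rewrite /f; case: p => [p|] //; case: eqP => // ne.
    by rewrite divr_gt0 // normr_gt0 subr_eq0; apply/eqP => /ai.
  have [e e0 he] := finite_pos_lower_bound f0; exists e => //; split.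
    exact: (he None).
  move=> i j ij; have := he (Some (i, j)).
  by rewrite /f /= (negPf ij) ler_pdivlMr // mulrC.
have sep i j x : `|x - a ord0 i| < d -> `|x - a ord0 j| < d -> i = j.
  move=> xi xj; apply/eqP; apply: contraT => /dsep h.
  suff : `|a ord0 i - a ord0 j| < 2 * d by move=> /lt_geF; rewrite h.
  have -> : a ord0 i - a ord0 j = (x - a ord0 j) - (x - a ord0 i) by ring.
  apply: le_lt_trans (ler_normB _ _) _.
  by rewrite mulrDl mul1r ltrD.
(* On [S] each [a i] has a root within [d]. Separation by [2 d] makes these roots distinct, so they
   are all [n] roots, and any choice of them is unique. *)
pose S : set 'rV[C]_n := [set v | forall i, `|(vieta_poly v).[a ord0 i]| < d ^+ n].
pose isroot (v : 'rV[C]_n) i y := root (vieta_poly v) y /\ `|y - a ord0 i| < d.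
pose zf (v : 'rV[C]_n) : 'rV[C]_n := \row_i
  if pselect (exists y, isroot v i y) is left e then projT1 (cid e) else 0.
have zP v i : S v -> isroot v i (zf v ord0 i).
  move=> Sv; rewrite mxE; case: pselect => [e|]; first by case: cid.
  by case; have [y ry ya] := near_root d0 (Sv i); exists y.
have zinj v : S v -> injective (zf v ord0).
  move=> Sv i j e; apply: (sep _ _ (zf v ord0 i)); first by have [] := zP v i Sv.
  by rewrite e; have [] := zP v j Sv.
have zsym v : S v -> esym (zf v) = v.
  move=> Sv; have [zeta zv] := elem_sym_surj v.
  have hf i : exists j, zeta ord0 j = zf v ord0 i.
    have [/eqP rt _] := zP v i Sv; apply: root_prod_XsubC_fin.
    by rewrite -vieta_poly_esym -elem_symE zv.
  pose f i := projT1 (cid (hf i)).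
  have fE i : zeta ord0 (f i) = zf v ord0 i by rewrite /f; case: cid.
  have fi : injective f by move=> i j ij; apply: (zinj v Sv); rewrite -!fE ij.
  rewrite -[RHS]zv !elem_symE -(esym_row_perm (zeta ord0) (perm fi)); congr esym_row.
  by apply/funext => i; rewrite permE fE.
have zuniq v i x : S v -> isroot v i x -> x = zf v ord0 i.
  move=> Sv [/eqP rx xa]; have : (vieta_poly (esym (zf v))).[x] = 0 by rewrite zsym.
  rewrite elem_symE vieta_poly_esym => /root_prod_XsubC_fin[j xj].
  have [_ ja] := zP v j Sv; rewrite xj in ja.
  by rewrite (sep _ _ _ xa ja).
have zcont v i : nbhs v S -> {for v, continuous (fun w => zf w ord0 i : C)}.
  move=> nS; have Sv : S v := nbhs_singleton nS.
  have FF : Filter (nbhs v) := nbhs_filter v.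
  have [rv va] := zP v i Sv.
  apply/cvgrPdist_lt => e e0.
  have [eta eta0 heta] : exists2 eta : C, 0 < eta &
      forall t : bool, eta <= (if t then e else d - `|zf v ord0 i - a ord0 i|).
    by apply: finite_pos_lower_bound => -[]; rewrite ?subr_gt0.
  apply: (@filterS _ _ FF _ _ _
    (filterI nS (near_small_horner eta0 (eqP rv)))) => w [Sw hw].
  have [y ry yv] := near_root eta0 hw.
  have ya : `|y - a ord0 i| < d.
    have -> : y - a ord0 i = (y - zf v ord0 i) + (zf v ord0 i - a ord0 i) by ring.
    apply: le_lt_trans (ler_normD _ _) _; rewrite -ltrBrDr.
    exact: lt_le_trans yv (heta false).
  rewrite -(zuniq w i y) // distrC; exact: lt_le_trans yv (heta true).
have zdiff v i : nbhs v S -> differentiable (fun w => zf w ord0 i : C) v.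
  move=> nS; have Sv : S v := nbhs_singleton nS.
  have FF : Filter (nbhs v) := nbhs_filter v.
  (* The polynomial of [w = h + v] at the old root [b i] is [(b i - z i) * q w], with [z i] the new
     root, and also the linear form in [h] with coefficients [c]. So the root moves by minus this
     form over [q w], and [q] is continuous and nonzero at [v]. *)
  pose b := zf v; pose q w := \prod_(j | j != i) (b ord0 i - zf w ord0 j).
  pose c (k : 'I_n) : C := (-1) ^+ k.+1 * b ord0 i ^+ (n - k.+1).
  have q0 : q v != 0.
    apply/prodf_neq0 => j ji; rewrite subr_eq0; apply: contra ji => /eqP.
    by move/(zinj v Sv) ->.
  have qcvg : {for v, continuous q}.
    apply: cvg_big_prod => j _; apply: cvgB; [exact: cvg_cst | exact: zcont].
  apply: (differentiable_rV (d := fun k => - (c k / q v))) => e e0.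
  pose M := \sum_k `|c k|; have M0 : 0 <= M by apply: sumr_ge0.
  have eM : 0 < e / (1 + M) by rewrite divr_gt0 // ltr_pwDl.
  have qVcvg : {for v, continuous (fun w => (q w)^-1)} by apply: cvgV.
  have near_ok : \forall w \near v,
      [/\ S w, q w != 0 & `|(q v)^-1 - (q w)^-1| < e / (1 + M)].
    have h1 := cvgr_neq0 _ qcvg q0.
    move/cvgrPdist_lt: qVcvg => /(_ _ eM) h2.
    have h12 := @filterI _ _ FF _ _ nS (@filterI _ _ FF _ _ (h1 FF) h2).
    by refine (@filterS _ _ FF _ _ _ h12) => w [? []].
  have /nbhs_ballP[del del0 hdel] := near_ok; exists del => // h hh.
  have : ball v del (h + v).
    by rewrite -ball_normE /= opprD addrCA subrr addr0 normrN.
  move=> /hdel[Sw qw0 qdist].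
  set w := h + v in Sw qw0 qdist *.
  have lE : (b ord0 i - zf w ord0 i) * q w = \sum_k h ord0 k * c k.
    have : (vieta_poly w).[b ord0 i] = \sum_k h ord0 k * c k.
      rewrite horner_vieta_affine; have [/eqP -> _] := zP v i Sv.
      by rewrite add0r.
    by rewrite -{1}(zsym w Sw) horner_vieta_esym (bigD1 i).
  have -> : zf w ord0 i - zf v ord0 i - \sum_j h ord0 j *: - (c j / q v) =
      (\sum_k h ord0 k * c k) * ((q v)^-1 - (q w)^-1).
    rewrite mulrBr -{2}lE mulfK // mulr_suml -[X in _ - X]opprK -sumrN opprK.
    rewrite opprB addrC; congr (_ + _); apply: eq_bigr => k _.
    by rewrite /GRing.scale /= mulrN opprK mulrA.
  rewrite normrM; have lM : `|\sum_k h ord0 k * c k| <= `|h| * M.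
    apply: le_trans (ler_norm_sum _ _ _) _; rewrite mulr_sumr.
    apply: ler_sum => k _; rewrite normrM; apply: ler_wpM2r => //.
    exact: mx_norm_coord.
  apply: (@le_trans _ _ (`|h| * (1 + M) * (e / (1 + M)))).
    apply: ler_pM => //; last exact: ltW.
    by apply: le_trans lM _; apply: ler_wpM2l => //; rewrite lerDr.
  rewrite -mulrA [(1 + M) * _]mulrC divfK 1?mulrC //.
  by rewrite gt_eqF // ltr_pwDl.
exists S^°, zf; split.
- exact: open_interior.
- refine (@filter_forall _ _ _ _ (nbhs_filter (esym a)) _) => i.
  apply: near_small_horner => //.
  by rewrite horner_vieta_esym (bigD1 i) //= subrr mul0r.
- by move=> v /nbhs_singleton; exact: zsym.
- move=> v /nbhs_singleton Sv; split; first exact: zinj.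
  by move=> i; apply: lt_le_trans dr; have [] := zP v i Sv.
move=> v nS.
have -> : zf = \sum_i (fun w => zf w ord0 i *: delta_mx 0 i).
  apply/funext => w; rewrite fct_sumE; exact: row_sum_delta.
by apply: differentiable_sum => i; apply: differentiableZl; exact: zdiff.
Unshelve. all: by end_near. Qed.

End LocalRoots.

(** * The isotypic submodule and its fibres *)

Section PermAct.
Variables (R : realType) (n : nat).
Local Notation C := R[i].
Implicit Types (s t : 'S_n) (z : 'rV[C]_n).

Lemma perm_actM s t z : perm_act t (perm_act s z) = perm_act (s * t)%g z.
Proof. by apply/rowP => j; rewrite !mxE invMg permM. Qed.

Lemma perm_act1 z : perm_act 1%g z = z.
Proof. by apply/rowP => j; rewrite mxE invg1 perm1. Qed.

Lemma polydisc_perm s z : polydisc R n z -> polydisc R n (perm_act s z).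
Proof. by move=> Dz j; rewrite mxE. Qed.

Lemma conj_perm_act s z : conj_rV (perm_act s z) = perm_act s (conj_rV z).
Proof. by apply/rowP => j; rewrite !mxE. Qed.

Lemma elem_sym_conj z : elem_sym (conj_rV z) = conj_rV (elem_sym z).
Proof.
apply/rowP => k; rewrite !mxE /mpoly.mesym rmorph_sum.
rewrite [mpoly.meval (z ord0) _]rmorph_sum [RHS]rmorph_sum.
apply: eq_bigr => h _ /=; rewrite rmorph_prod [mpoly.meval (z ord0) _]rmorph_prod.
rewrite [RHS]rmorph_prod; apply: eq_bigr => i _ /=.
by rewrite !mpoly.mevalXU mxE.
Qed.
End PermAct.

Section Isotypic.
Variables (R : realType) (n : nat) (lambda : R) (p : seq nat).
Variables (H : completeNormedModType R[i]) (ip : {dot H for (@Num.conj R[i])}).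
Variable ev : H -> 'rV[R[i]]_n -> R[i].
Hypotheses (lambda0 : 0 < lambda) (HB : is_bergman lambda ip ev).
Hypothesis sump : sumn p = n.
Local Notation C := R[i].
Local Notation D := (polydisc R n).
Local Notation F := (binomial_fun lambda).
Local Notation b := (bcoef lambda).
Local Notation kappa := (kappa HB).
Local Notation mvec := (monomial_vec lambda0 HB).
Local Notation d := (specht_dim C n p).
Local Notation chi := (specht_char C n p).
Local Notation M := (isotypic ev p).

Let ip_norm := bergman_norm HB.

Definition proj_coef (s : 'S_n) : C := d%:R / n`!%:R * chi s.

Lemma proj_coefV s : proj_coef s^-1%g = proj_coef s.
Proof. by rewrite /proj_coef specht_charV. Qed.

Lemma proj_coef_conj s : (proj_coef s)^* = proj_coef s.
Proof.
by rewrite conj_Creal // rpredM ?specht_char_real // rpredM ?rpredV ?realn.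
Qed.

Let fact0 : n`!%:R != 0 :> C.
Proof. by rewrite pnatr_eq0 -lt0n fact_gt0. Qed.

Lemma proj_coef_conv u :
  \sum_s proj_coef s * proj_coef (s^-1 * u)%g = proj_coef u.
Proof.
rewrite /proj_coef.
have -> : \sum_s (d%:R / n`!%:R * chi s) * (d%:R / n`!%:R * chi (s^-1 * u)%g) =
    (d%:R / n`!%:R) ^+ 2 * fconv chi chi u.
  by rewrite /fconv mulr_sumr; apply: eq_bigr => s _; rewrite mulrACA expr2.
rewrite specht_char_conv //.
have [->|d0] := eqVneq (d%:R : C) 0; first by rewrite !mul0r expr0n !mul0r.
by field; rewrite fact0 d0.
Qed.

(** Conjugating, and replacing [s] by its inverse, does not change the coefficients: they are real
    and invariant under inversion. *)
Lemma isotypicP g : M g <-> exists f, forall w, D w ->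
  ip (kappa w) g = \sum_s proj_coef s * ip (kappa (perm_act s w)) f.
Proof.
have e f w : D w -> \sum_s proj_coef s * ip (kappa (perm_act s w)) f =
   (chi 1%g / n`!%:R * \sum_(s : 'S_n) (chi s)^* * ev f (perm_act s^-1%g (conj_rV w)))^*.
  move=> Dw; rewrite mulr_sumr rmorph_sum (reindex_inj invg_inj) /=.
  apply: eq_bigr => s _; rewrite proj_coefV kappa_ip; last exact: polydisc_perm.
  rewrite conj_perm_act mulrA rmorphM; congr (_ * _).
  have chic : (chi s)^* = chi s by rewrite conj_Creal // specht_char_real.
  by rewrite chic specht_char1; exact: esym (proj_coef_conj s).
split=> [[f hf]|[f hf]]; exists f.
  move=> w Dw; rewrite e // kappa_ip // hf //; exact: polydisc_conj.
move=> z Dz; have Dcz := polydisc_conj Dz.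
by rewrite -[LHS]conjCK -[z in LHS]conj_rVK -(kappa_ip HB) // hf // e // conjCK conj_rVK.
Qed.

(** By [proj_coef_conv] a second application of the projection changes nothing, so [f] may be
    replaced by [g] itself. *)
Lemma isotypic_fix g w : M g -> D w ->
  ip (kappa w) g = \sum_s proj_coef s * ip (kappa (perm_act s w)) g.
Proof.
move=> /isotypicP[f hf] Dw; rewrite hf //.
transitivity (\sum_s \sum_u proj_coef s * proj_coef (s^-1 * u)%g *
    ip (kappa (perm_act u w)) f).
  rewrite exchange_big /=; apply: eq_bigr => u _.
  by rewrite -mulr_suml proj_coef_conv.
apply: eq_bigr => s _; rewrite hf; last exact: polydisc_perm.
rewrite mulr_sumr (reindex_inj (mulgI s)) /=; apply: eq_bigr => t _.
by rewrite mulKg perm_actM mulrA.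
Qed.

Lemma isotypic_lin (I : finType) (c : I -> C) (x : I -> H) :
  (forall i, M (x i)) -> M (\sum_i c i *: x i).
Proof.
move=> Mx; apply/isotypicP.
have hf i : exists f, forall w, D w ->
    ip (kappa w) (x i) = \sum_s proj_coef s * ip (kappa (perm_act s w)) f.
  exact/isotypicP.
exists (\sum_i c i *: projT1 (cid (hf i))) => w Dw.
rewrite ip_sumr; under [RHS]eq_bigr do rewrite ip_sumr mulr_sumr.
rewrite exchange_big; apply: eq_bigr => i _ /=.
rewrite ipZr; case: cid => f /= -> //; rewrite mulr_sumr; apply: eq_bigr => s _.
by rewrite ipZr mulrCA.
Qed.

Definition kappa_proj (w : 'rV[C]_n) : H :=
  \sum_s proj_coef s *: kappa (perm_act s w).

Lemma kappa_perm_gram s v w : D v -> D w ->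
  ip (kappa v) (kappa (perm_act s w)) = ip (kappa (perm_act s^-1%g v)) (kappa w).
Proof.
move=> Dv Dw; rewrite !kappa_gram //; try exact: polydisc_perm.
rewrite (reindex_perm s); apply: eq_bigr => j _.
by rewrite !mxE invgK permK.
Qed.

Lemma kappa_ip_proj v w : D v -> D w ->
  ip (kappa v) (kappa_proj w) =
  \sum_s proj_coef s * ip (kappa (perm_act s v)) (kappa w).
Proof.
move=> Dv Dw; rewrite ip_sumr (reindex_inj invg_inj) /=; apply: eq_bigr => s _.
by rewrite ipZr proj_coef_conj proj_coefV kappa_perm_gram // invgK.
Qed.

Lemma kappa_proj_isotypic w : D w -> M (kappa_proj w).
Proof.
by move=> Dw; apply/isotypicP; exists (kappa w) => v Dv; rewrite kappa_ip_proj.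
Qed.

(** The coefficients are the entries of [isotypic_mx], so the span of the projected kernel functions
    over an orbit is described by a row space. *)
Lemma kappa_proj_perm s w :
  kappa_proj (perm_act s^-1%g w) =
  \sum_u proj_coef (u * s^-1)%g *: kappa (perm_act u^-1%g w).
Proof.
rewrite /kappa_proj (reindex (fun u => s * u^-1)%g) /=; last first.
  exists (fun t => t^-1 * s)%g => u _; first by rewrite invMg invgK mulgKV.
  by rewrite invMg invgK mulKVg.
apply: eq_bigr => u _; rewrite perm_actM mulKg -proj_coefV.
by rewrite invMg invgK.
Qed.

End Isotypic.

(** * The fibre over a point off the discriminant *)

Section Fibre.
Variables (R : realType) (n : nat) (lambda : R) (p : seq nat).
Variables (H : completeNormedModType R[i]) (ip : {dot H for (@Num.conj R[i])}).
Variable ev : H -> 'rV[R[i]]_n -> R[i].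
Hypotheses (lambda0 : 0 < lambda) (HB : is_bergman lambda ip ev).
Hypothesis sump : sumn p = n.
Local Notation C := R[i].
Local Notation D := (polydisc R n).
Local Notation b := (bcoef lambda).
Local Notation kappa := (kappa HB).
Local Notation mvec := (monomial_vec lambda0 HB).
Local Notation M := (isotypic ev p).
Local Notation kappa_proj := (kappa_proj p HB).
Local Notation pc := (@proj_coef R n p).
Local Notation B := (mpoly.mpoly n C).

Let ip_norm := bergman_norm HB.

(* The vector representing z |-> q (s^-1 . z), for a polynomial q. *)
Definition poly_vec (s : 'S_n) (q : B) : H :=
  \sum_(m <- mpoly.msupp q) (mpoly.mcoeff m q * (\prod_i b (m i))^-1)
    *: mvec (fun i => m (s^-1%g i)).

Lemma ev_lin (I : Type) (r : seq I) (c : I -> C) (x : I -> H) z : D z ->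
  ev (\sum_(i <- r) c i *: x i) z = \sum_(i <- r) c i * ev (x i) z.
Proof.
move=> Dz; rewrite (ev_ip HB) // ip_suml; apply: eq_bigr => i _.
by rewrite ipZl -(ev_ip HB).
Qed.

Lemma ev_poly_vec s q z : D z ->
  ev (poly_vec s q) z = mpoly.meval (perm_act s^-1%g z ord0) q.
Proof.
move=> Dz; rewrite ev_lin // mpoly.mevalE; apply: eq_bigr => m _.
rewrite ev_monomial // big_split /=.
have -> : \prod_i b (m (s^-1%g i)) = \prod_i b (m i).
  by rewrite (reindex_perm s); apply: eq_bigr => i _; rewrite permK.
rewrite -mulrA; congr (_ * _).
rewrite mulKf; last by apply/prodf_neq0 => i _; apply: bcoef_neq0.
rewrite (reindex_perm s) /=; apply: eq_bigr => i _.
by rewrite permK mxE invgK.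
Qed.

Lemma ev_poly_vec1 q z : D z -> ev (poly_vec 1%g q) z = mpoly.meval (z ord0) q.
Proof. by move=> Dz; rewrite ev_poly_vec // invg1 perm_act1. Qed.

(** [h] is fixed by the projection, so [q] may be projected when paired with [h]; [monomial_perm]
    carries the invariance of [h] from kernel functions to polynomials. *)
Lemma poly_vec_ip q h : M h ->
  ip (poly_vec 1%g q) h = \sum_s pc s * ip (poly_vec s q) h.
Proof.
move=> Mh; rewrite /poly_vec ip_suml.
under [RHS]eq_bigr do rewrite ip_suml mulr_sumr.
rewrite exchange_big /=; apply: eq_bigr => m _; rewrite ipZl.
have hE w : D w -> ip (kappa w) h = \sum_s pc s * ip (kappa (perm_act s w)) h.
  by move=> Dw; apply: isotypic_fix.
have -> : mvec (fun i => m ((1^-1 : 'S_n)%g i)) = mvec m.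
  by congr mvec; apply/funext => i; rewrite invg1 perm1.
rewrite (monomial_perm lambda0 m hE) mulr_sumr; apply: eq_bigr => s _.
by rewrite ipZl mulrCA.
Qed.

Lemma poly_vec_lin a q r s :
  poly_vec s (a *: q + r) = a *: poly_vec s q + poly_vec s r.
Proof.
apply: (bergman_ext HB) => z Dz.
by rewrite (bergman_linear HB) // !ev_poly_vec // mpoly.mevalD mpoly.mevalZ.
Qed.

Let functional h (q : B) : C := ip (poly_vec 1%g q) h.

Let functional_linear h : scalar (functional h).
Proof. by move=> a q r; rewrite /functional poly_vec_lin ipDl ipZl. Qed.

Let L h : {scalar B} := HB.pack (functional h)
  (GRing.isLinear.Build _ _ _ _ _ (functional_linear h)).

(** The polynomial [y] is arbitrary, while the fibre relations involve only vectors of [M]. As s_k -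
    u_k is symmetric, the projection [g] of its product with [y] is its product with the projection
    of [y], hence a relation; and [h], lying in [M], pairs with the unprojected product as it does
    with [g]. *)
Lemma fibre_kills_ideal w h (k : 'I_n) (y : B) : D w ->
  fibre ip ev M (elem_sym (conj_rV w)) h ->
  ip (poly_vec 1%g ((mpoly.mesym n C k.+1 -
     (esym_row (conj_rV w ord0) ord0 k)%:A) * y)) h = 0.
Proof.
move=> Dw [Mh hperp]; set q := _ * y.
pose g := \sum_s pc s *: poly_vec s q.
have gperp : ip h g = 0.
  apply: hperp; apply: subset_closure.
  exists 1%N, (fun=> 1), (fun=> g); split; last by rewrite big_ord1 scale1r.
  move=> _; exists (mpoly.mpolyX C (mpoly.mnm1 k)).
  exists (\sum_s pc s *: poly_vec s y); split.
    apply/(isotypicP HB sump); exists (poly_vec 1%g y) => v Dv.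
    rewrite ip_sumr (reindex_inj invg_inj) /=; apply: eq_bigr => s _.
    rewrite ipZr proj_coef_conj // proj_coefV // !(kappa_ip HB) //; last first.
      exact: polydisc_perm.
    rewrite ev_poly_vec ?ev_poly_vec1 ?invgK ?conj_perm_act //.
      by apply: polydisc_perm; exact: polydisc_conj.
    exact: polydisc_conj.
  move=> z Dz; rewrite !ev_lin // mulr_sumr; apply: eq_bigr => s _.
  rewrite !ev_poly_vec // [RHS]mulrCA; congr (_ * _).
  rewrite /q mpoly.mevalM mpoly.mevalB mpoly.mevalZ mpoly.meval1 mulr1.
  congr (_ * _); congr (_ - _); last by rewrite mpoly.mevalXU.
  by rewrite mpoly.mevalXU -(elem_sym_perm s^-1%g) mxE.
transitivity (ip g h); last by rewrite ipC gperp conjC0.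
rewrite poly_vec_ip // /g [RHS]ip_suml.
by apply: eq_bigr => s _; rewrite ipZl.
Qed.

Let meval_perm t (z : 'rV[C]_n) (q : B) :
  mpoly.meval (perm_act t^-1%g z ord0) q = mpoly.meval (fun i => z ord0 (t i)) q.
Proof. by apply: mpoly.meval_eq => i; rewrite mxE invgK. Qed.

Lemma kappa_free w (c : 'S_n -> C) : D w -> injective (w ord0) -> 'I_n ->
  \sum_s c s *: kappa (perm_act s^-1%g w) = 0 -> forall s, c s = 0.
Proof.
move=> Dw wi i0 c0 s.
have wci : injective (conj_rV w ord0).
  by move=> i j; rewrite !mxE => /(can_inj (@conjCK _)) /wi.
(* The zero functional serves to obtain the polynomials [e s] dual to the orbit; pairing with them
   isolates the coefficients. *)
have L0 (k : 'I_n) y : L 0 ((mpoly.mesym n C k.+1 -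
     (esym_row (conj_rV w ord0) ord0 k)%:A) * y) = 0.
  by rewrite /L /= /functional linear0r.
have [e [_ he]] := symmetric_ideal_functional wci L0 i0.
have := ip0l ip (poly_vec 1%g (e s)); rewrite -c0 ip_suml (bigD1 s) //= big1.
  rewrite addr0 ipZl (kappa_ip HB); last exact: polydisc_perm.
  rewrite conj_perm_act ev_poly_vec1; last by apply/polydisc_perm/polydisc_conj.
  by rewrite meval_perm he eqxx rmorph1 mulr1.
move=> t ts; rewrite ipZl (kappa_ip HB); last exact: polydisc_perm.
rewrite conj_perm_act ev_poly_vec1; last by apply/polydisc_perm/polydisc_conj.
by rewrite meval_perm he eq_sym (negPf ts) rmorph0 mulr0.
Qed.

Lemma fibre_span w h : D w -> injective (w ord0) -> 'I_n ->
  fibre ip ev M (elem_sym (conj_rV w)) h ->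
  exists c : 'S_n -> C, h = \sum_s c s *: kappa_proj (perm_act s^-1%g w).
Proof.
move=> Dw wi i0 fh; have [Mh _] := fh.
have wci : injective (conj_rV w ord0).
  by move=> i j; rewrite !mxE => /(can_inj (@conjCK _)) /wi.
have Lh (k : 'I_n) y : L h ((mpoly.mesym n C k.+1 -
     (esym_row (conj_rV w ord0) ord0 k)%:A) * y) = 0.
  exact: fibre_kills_ideal.
have [e [hL _]] := symmetric_ideal_functional wci Lh i0.
(* The pairing is conjugate-linear in [h], hence the conjugates. *)
exists (fun s => (L h (e s))^*).
have hk : h = \sum_s (L h (e s))^* *: kappa (perm_act s^-1%g w).
  apply: (monomial_total (lambda0 := lambda0) (HB := HB)) => alpha.
  pose q : B := (\prod_i b (alpha i)) *: \prod_i mpoly.mpolyX C (mpoly.mnm1 i) ^+ alpha i.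
  have -> : mvec alpha = poly_vec 1%g q.
    apply: (bergman_ext HB) => z Dz; rewrite ev_monomial // ev_poly_vec1 //.
    rewrite big_split /= mpoly.mevalZ rmorph_prod; congr (_ * _).
    by apply: eq_bigr => i _; rewrite rmorphXn /= mpoly.mevalXU.
  rewrite -[LHS]/(L h q) hL ip_sumr; apply: eq_bigr => s _.
  rewrite ipZr conjCK mulrC; congr (_ * _).
  rewrite ipC (kappa_ip HB); last exact: polydisc_perm.
  rewrite conjCK conj_perm_act ev_poly_vec1; last by apply/polydisc_perm/polydisc_conj.
  by rewrite meval_perm.
(* Since [h] is its own projection, the kernel functions in [hk] may be replaced by projected
   ones. *)
apply: (@kappa_total _ _ _ _ _ _ HB) => v Dv.
rewrite (isotypic_fix HB sump Mh) // {1}hk.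
under eq_bigr do rewrite ip_sumr mulr_sumr.
rewrite exchange_big ip_sumr; apply: eq_bigr => s _ /=.
rewrite ipZr (kappa_ip_proj HB sump) //; last exact: polydisc_perm.
by rewrite mulr_sumr; apply: eq_bigr => t _; rewrite ipZr mulrCA.
Qed.

Lemma closure_orthogonal (A : set H) h g :
  (forall x, A x -> ip h x = 0) -> closure (lin_span A) g -> ip h g = 0.
Proof.
move=> hA gA; apply/eqP; rewrite -normr_le0; apply/negPn/negP.
rewrite -real_ltNge ?normr_real ?real0 // => hg0.
have h0 : 0 < 1 + `|h| by rewrite ltr_pwDl.
have e0 : 0 < `|ip h g| / (1 + `|h|) by rewrite divr_gt0.
have [x [[m [c [y [Ay xE]]]]]] := gA _ (nbhsx_ballx g _ e0).
rewrite -ball_normE /= => gx.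
have hx : ip h x = 0.
  by rewrite xE ip_sumr big1 // => i _; rewrite ipZr hA ?mulr0.
have : `|ip h g| < `|ip h g|.
  rewrite -{1}[ip h g]subr0 -hx -ipBr.
  apply: le_lt_trans (ip_CauchySchwarz ip_norm _ _) _.
  apply: (@le_lt_trans _ _ ((1 + `|h|) * `|g - x|)).
    by apply: ler_wpM2r => //; rewrite lerDr.
  by rewrite mulrC -ltr_pdivlMr.
by rewrite ltxx.
Qed.

(** A relation vanishes at every point of the orbit, where the symmetric factor takes the value 0,
    so it is orthogonal to the kernel functions of the orbit. *)
Lemma span_fibre w (c : 'S_n -> C) : D w ->
  fibre ip ev M (elem_sym (conj_rV w))
    (\sum_s c s *: kappa_proj (perm_act s^-1%g w)).
Proof.
move=> Dw; split.
  apply: (isotypic_lin HB sump) => s; apply: (kappa_proj_isotypic HB sump).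
  exact: polydisc_perm.
move=> g; apply: closure_orthogonal => x [q [f [_ xE]]].
rewrite ip_suml big1 // => s _; rewrite ipZl ip_suml big1 ?mulr0 // => t _.
rewrite ipZl (kappa_ip HB); last by do 2! apply: polydisc_perm.
rewrite xE; last by apply: polydisc_conj; do 2! apply: polydisc_perm.
by rewrite !conj_perm_act !elem_sym_perm subrr mul0r conjC0 mulr0.
Qed.

End Fibre.

(** * The holomorphic frame *)

Section Frame.
Variables (R : realType) (n : nat) (lambda : R) (p : seq nat).
Variables (H : completeNormedModType R[i]) (ip : {dot H for (@Num.conj R[i])}).
Variable ev : H -> 'rV[R[i]]_n -> R[i].
Hypotheses (lambda0 : 0 < lambda) (HB : is_bergman lambda ip ev).
Hypothesis sump : sumn p = n.
Local Notation C := R[i].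
Local Notation D := (polydisc R n).
Local Notation kappa := (kappa HB).
Local Notation M := (isotypic ev p).
Local Notation N := #|[set: 'S_n]%SET|.
Local Notation Pi := (isotypic_mx C n p).

Let idx (s : 'S_n) : 'I_N := enum_rank_in (finset.in_setT (1%g : 'S_n)) s.

Let idxK i : idx (enum_val i) = i.
Proof. exact: enum_valK_in. Qed.

Let sum_enum_perm (V : nmodType) (f : 'S_n -> V) :
  \sum_(i < N) f (enum_val i) = \sum_g f g.
Proof. exact: sum_enum_val. Qed.

Definition orbit_kappa (w : 'rV[C]_n) (j : 'I_N) : H :=
  kappa (perm_act (enum_val j)^-1%g w).

Lemma orbit_kappa_free w (x : 'rV[C]_N) : D w -> injective (w ord0) -> 'I_n ->
  \sum_j x ord0 j *: orbit_kappa w j = 0 -> x = 0.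
Proof.
move=> Dw wi i0 x0; apply/rowP => j; rewrite mxE.
have := kappa_free lambda0 Dw wi i0
  (c := fun s => x ord0 (idx s)) (HB := HB).
rewrite -sum_enum_perm => /(_ _ (enum_val j)); rewrite idxK; apply.
by apply: etrans x0; apply: eq_bigr => k _; rewrite idxK.
Qed.

Lemma fibreE w : D w -> injective (w ord0) -> 'I_n ->
  fibre ip ev M (elem_sym (conj_rV w)) =
  [set h | exists c : 'rV[C]_N, h = \sum_j (c *m Pi) ord0 j *: orbit_kappa w j].
Proof.
move=> Dw wi i0.
have projE (c : 'S_n -> C) :
    \sum_s c s *: kappa_proj p HB (perm_act s^-1%g w) =
    \sum_j ((\row_i c (enum_val i)) *m Pi) ord0 j *: orbit_kappa w j.
  rewrite -sum_enum_perm.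
  under eq_bigr do rewrite (kappa_proj_perm HB sump) -sum_enum_perm scaler_sumr.
  rewrite exchange_big; apply: eq_bigr => j _ /=.
  rewrite mxE scaler_suml; apply: eq_bigr => i _.
  by rewrite !mxE scalerA.
apply/seteqP; split=> h /=.
  move=> /(fibre_span lambda0 HB sump Dw wi i0)[c ->].
  by exists (\row_i c (enum_val i)); rewrite projE.
move=> [c ->]; pose c' (s : 'S_n) := c ord0 (idx s).
have -> : c = \row_i c' (enum_val i).
  by apply/rowP => i; rewrite mxE /c' idxK.
by rewrite -projE; apply: span_fibre.
Qed.

Lemma perm_act_differentiable (s : 'S_n) (x : 'rV[C]_n) :
  differentiable (@perm_act R n s) x.
Proof.
have -> : @perm_act R n s =
    \sum_i (fun w : 'rV[C]_n => w ord0 (s^-1%g i) *: (delta_mx 0 i : 'rV[C]_n)).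
  apply/funext => w; rewrite fct_sumE [LHS]row_sum_delta.
  by apply: eq_bigr => i _; rewrite mxE.
apply: differentiable_sum => i; apply: differentiableZl.
exact: differentiable_coord.
Qed.

Lemma isotypic_locally_free : 'I_n ->
  locally_free ip ev M (specht_dim C n p ^ 2)%N
    (symmetrized_polydisc R n `\` (@elem_sym R n) @` diagonal_locus R n).
Proof.
move=> i0 w0 [[z0 Dz0 z0w] z0nd].
have z0i : injective (z0 ord0).
  move=> i j ij; apply/eqP/negPn/negP => nij; apply: z0nd.
  by exists z0 => //; split=> //; exists i, j.
(* The fibre at [v] lies over the conjugate of [v], and [kappa] contains a second conjugation: the
   frame is built from the roots belonging to [v] itself, near the conjugate of [z0]. *)
pose a := conj_rV z0; have Da : D a := polydisc_conj Dz0.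
have ai : injective (a ord0).
  by move=> i j; rewrite !mxE => /(can_inj (@conjCK _)) /z0i.
have aw : elem_sym a = w0.
  by rewrite elem_sym_conj z0w; exact: conj_rVK.
(* Roots within [r] of the coordinates of [a] stay in the unit disc. *)
have [r r0 hr] := @finite_pos_lower_bound C 'I_n (fun i => 1 - `|a ord0 i|)
  (fun i => etrans (subr_gt0 _ _) (Da i)).
have [U [z [Uo Ua zU zinj zdiff]]] := local_roots ai r0.
have zD v : U v -> D (z v).
  move=> Uv j; have [_ /(_ j) za] := zinj v Uv.
  rewrite -[z v ord0 j](subrK (a ord0 j)); apply: le_lt_trans (ler_normD _ _) _.
  by rewrite -ltrBrDr; apply: lt_le_trans za (hr j).
(* A fixed basis of the row space: the frame depends on [v] only through the roots and [kappa]. *)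
have [B [Bfree BPi]] : exists B : 'M[C]_(specht_dim C n p ^ 2, N),
    row_free B /\ (B :=: Pi)%MS.
  rewrite -(rank_isotypic_mx C sump); exists (row_base Pi).
  by split; [exact: row_base_free | exact: eq_row_base].
exists U, (fun i v => \sum_j B i j *: orbit_kappa (z v) j); split => //.
- by rewrite -aw.
- move=> v Uv; split.
    exists (conj_rV (z v)); first by apply: polydisc_conj; exact: zD.
    by rewrite elem_sym_conj zU.
  (* Any preimage [y] of the same point is a permutation of distinct roots and cannot lie on the
     diagonal. *)
  move=> [y [Dy [i [j [nij yij]]]] yv].
  have [zi _] := zinj v Uv.
  have zci : injective (conj_rV (z v) ord0).
    by move=> k l; rewrite !mxE => /(can_inj (@conjCK _)) /zi.
  have [|s ys] := @elem_sym_eq _ _ (conj_rV (z v)) y zci.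
    by rewrite elem_sym_conj zU.
  move: yij nij; rewrite ys !mxE => /(can_inj (@conjCK _)) /zi /perm_inj ->.
  by rewrite eqxx.
- move=> i v Uv.
  have -> : (fun v => \sum_j B i j *: orbit_kappa (z v) j) =
      \sum_j (B i j *: (fun v => orbit_kappa (z v) j)).
    by apply/funext => u; rewrite fct_sumE.
  apply: differentiable_sum => j; apply: differentiableZ.
  apply: (@differentiable_comp _ _ _ _ z (fun w => orbit_kappa w j)).
    exact: zdiff.
  apply: (@differentiable_comp _ _ _ _ (perm_act (enum_val j)^-1%g) kappa).
    exact: perm_act_differentiable.
  by apply: kappa_differentiable => //; apply: polydisc_perm; exact: zD.
move=> v Uv; have [zi _] := zinj v Uv.
have combE (x : 'I_(specht_dim C n p ^ 2) -> C) :
    \sum_i x i *: \sum_j B i j *: orbit_kappa (z v) j =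
    \sum_j ((\row_i x i) *m B) ord0 j *: orbit_kappa (z v) j.
  under eq_bigr do rewrite scaler_sumr.
  rewrite exchange_big; apply: eq_bigr => j _ /=.
  rewrite mxE scaler_suml; apply: eq_bigr => i _.
  by rewrite mxE scalerA.
split.
  move=> x; rewrite combE => /(orbit_kappa_free (zD v Uv) zi i0)/eqP.
  rewrite mulmx_free_eq0 // => /eqP/rowP x0 i.
  by have := x0 i; rewrite !mxE.
have -> : map_mx Num.conj v = elem_sym (conj_rV (z v)).
  by rewrite elem_sym_conj zU.
rewrite (fibreE (zD v Uv) zi i0); apply/seteqP; split=> h /=.
  move=> [x ->]; rewrite combE.
  have /submxP[c ->] : ((\row_i x i) *m B <= Pi)%MS by rewrite -BPi submxMl.
  by exists c.
move=> [c ->].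
have /submxP[x ->] : (c *m Pi <= B)%MS by rewrite BPi submxMl.
exists (fun i => x ord0 i); rewrite combE.
suff -> : \row_i x ord0 i = x by [].
by apply/rowP => i; rewrite mxE.
Qed.

End Frame.

Theorem corollary2p15 (R : realType) (n : nat) (lambda : R) (p : seq nat)
    (H : completeNormedModType R[i]) (ip : {dot H for (@Num.conj R[i])})
    (ev : H -> 'rV[R[i]]_n -> R[i]) :
  (1 <= n)%N -> 0 < lambda -> is_intpart n p ->
  is_bergman lambda ip ev ->
  locally_free ip ev (isotypic ev p) (specht_dim R[i] n p ^ 2)%N
    (symmetrized_polydisc R n `\` (@elem_sym R n) @` diagonal_locus R n).
Proof.
move=> n1 lambda0 /and3P[_ _ /eqP sump] HB.
exact: (isotypic_locally_free lambda0 HB sump (Ordinal n1)).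
Qed.
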